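(* Let $f(u)=u^2/2$, $\bar u_l>\bar u_r$, and $w_0\in L^\infty(\mathbb{R})$ $p$-periodic with zero average. Let $T_S$ and the shock curve $X(t)$, $t>T_S$, be as in the shock stability theorem: i.e. the entropy solution $u$ with data $\bar u_l+w_0$ for $x<0$ and $\bar u_r+w_0$ for $x>0$ equals $u_l$ for $x<X(t)$ and $u_r$ for $x>X(t)$ when $t>T_S$, where $u_l,u_r$ are the entropy solutions with data $\bar u_l+w_0$, $\bar u_r+w_0$ on $\mathbb{R}$. Let $s=(\bar u_l+\bar u_r)/2$. Then whenever $t>T_S$ and $(\bar u_l-\bar u_r)t/p$ is an integer, $X(t)=st$.
   Context: Entropy solutions of Burgers' equation $u_t+(u^2/2)_x=0$ with $L^\infty$ data. $T_S>0$ is a time (depending on $p,\bar u_l,\bar u_r$) after which the perturbed solution consists of $u_l$ and $u_r$ separated by a single Lipschitz shock curve $X(t)$. *)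

(* Defs.v *)
From HB Require Import structures.
From mathcomp Require Import all_boot all_order all_algebra.
From mathcomp Require Import all_classical all_reals all_analysis.
Set Implicit Arguments. Unset Strict Implicit. Unset Printing Implicit Defensive.
Import Order.TTheory GRing.Theory Num.Theory.
Import numFieldNormedType.Exports.
Local Open Scope classical_set_scope.
Local Open Scope ring_scope.

Definition burgers_flux {R : realType} (u : R) : R := u ^+ 2 / 2.

Definition leb2 {R : realType} := ((@lebesgue_measure R) \x (@lebesgue_measure R))%E.

Definition test_fun {R : realType} (phi : R -> R -> R) : Prop :=
  (forall t x, 0 <= phi t x) /\
  (exists M : R, forall t x, M < `|t| \/ M < `|x| -> phi t x = 0) /\
  (forall t x, derivable (fun s => phi s x) t 1) /\
  (forall t x, derivable (fun y => phi t y) x 1) /\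
  continuous (fun z : R * R => phi z.1 z.2) /\
  continuous (fun z : R * R => 'D_1 (fun s => phi s z.2) z.1) /\
  continuous (fun z : R * R => 'D_1 (fun y => phi z.1 y) z.2).

(* Kruzhkov entropy solution of u_t + (u^2/2)_x = 0 on t > 0 with initial data u0,
   u(t,x) given as a (bounded measurable representative) function of (t,x):
   for all k and all nonnegative C^1 test functions phi on [0,oo) x R,
   int_{t>0} int_x ( |u-k| phi_t + sgn(u-k)(f(u)-f(k)) phi_x ) dx dt
     + int_x |u0(x)-k| phi(0,x) dx >= 0. *)
Definition entropy_solution {R : realType} (u0 : R -> R) (u : R -> R -> R) : Prop :=
  measurable_fun setT (fun z : R * R => u z.1 z.2) /\
  (exists M : R, forall t x, `|u t x| <= M) /\
  forall (k : R) (phi : R -> R -> R), test_fun phi ->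
    (0 <= (\int[leb2]_(z in [set z : R * R | (0 < z.1)%R])
            (`|u z.1 z.2 - k| * 'D_1 (fun s => phi s z.2) z.1
             + Num.sg (u z.1 z.2 - k) * (burgers_flux (u z.1 z.2) - burgers_flux k)
               * 'D_1 (fun y => phi z.1 y) z.2)%:E)
        + \int[@lebesgue_measure R]_x (`|u0 x - k| * phi 0 x)%:E)%E.

Definition periodic_zero_avg {R : realType} (p : R) (w0 : R -> R) : Prop :=
  measurable_fun setT w0 /\
  (exists M : R, forall x, `|w0 x| <= M) /\
  (forall x, w0 (x + p) = w0 x) /\
  (\int[@lebesgue_measure R]_(x in `[0%R, p]%classic) (w0 x)%:E = 0)%E.

Definition riemann_data {R : realType} (ul ur : R) (w0 : R -> R) (x : R) : R :=
  if x < 0 then ul + w0 x else ur + w0 x.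

Definition lipschitz_after {R : realType} (T : R) (X : R -> R) : Prop :=
  exists L : R, forall t1 t2, T < t1 -> T < t2 -> `|X t1 - X t2| <= L * `|t1 - t2|.

(* Main.v *)
(* An entropy solution a with data a0 has a potential A with A_x = a,
   A_t = - a^2/2, and A is given by the Hopf-Lax formula
   H(t,x) = inf_y (A0(y) + (x-y)^2/(2t)), where A0 is a primitive of a0.
   That A <= H follows from (a-q)^2 >= 0 along the line of slope q = (x-y)/t.
   For A >= H, one tests the Kruzhkov inequalities with (F^+)^2, F being a
   paraboloid minus A, to see that A is a viscosity supersolution of
   A_t + A_x^2/2 = 0, and compares it with strict subsolutions. All of this is
   done on mollified potentials, whose derivatives converge in L^1.

   The primitive of the perturbed Riemann data is the minimum of those of the
   data of u_l and u_r, hence H_u = min(H_l, H_r). By Galilean invariance and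
   periodicity, H_l - H_r = (ubl - ubr)(x - s t) when (ubl - ubr) t / p is an
   integer. Since u = u_l on the left of X(t), H_u - H_l is constant there, and
   H_u - H_r is constant on the right of X(t); so X(t), where the minimum
   switches, is s t. *)
Require Import Defs.
From HB Require Import structures.
From mathcomp Require Import all_boot all_order all_algebra.
From mathcomp Require Import all_classical all_reals all_analysis.
From mathcomp Require Import measurable_realfun lebesgue_Rintegral.
From mathcomp Require Import ring lra.
Import Order.TTheory GRing.Theory Num.Theory.
Import numFieldNormedType.Exports.
Local Open Scope classical_set_scope.
Local Open Scope ring_scope.
Set Implicit Arguments. Unset Strict Implicit. Unset Printing Implicit Defensive.

(** The solutions are mere measurable functions, without traces at fixed times, so nothing is
    evaluated at a time [t] before smoothing. The Lipschitz constants of the smoothed potential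
    [pot] do not depend on the scale [e], but its derivatives are controlled only in the mean, on
    boxes away from [t = 0]. The supersolution property is therefore quantified instead of being
    stated at one touching point: for small [e], no paraboloid of given curvature touches [pot] from
    below, even up to a fixed slack [eta], and both [eta] and the smallness of [e] are uniform in
    the touching point and the slopes. The slack leaves room for a test function of definite mass,
    against which the mean error is negligible; it also lets the comparison run on approximate
    minima, without compactness. The Kruzhkov inequality alone is weak where [a] is close to the
    slope [k], because of its factor [|a - k|]; the mass inequality obtained from large constants
    covers that set. *)

(** * Bounded functions supported in a set of finite measure *)

Section BoundedFiniteSupport.
Context d (T : measurableType d) (R : realType) (mu : {measure set T -> \bar R}).

(** A class in which integrability is structural: it is closed under linear operations and under
    multiplication by bounded measurable functions. Kernels belong to it and solutions are bounded,
    so every integral of a kernel against a solution is finite and can be split freely. *)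
Definition bfs (f : T -> R) : Prop :=
  measurable_fun setT f /\
  exists2 A, measurable A & (mu A < +oo)%E /\
    exists C, forall x, `|f x| <= C * (\1_A x : R).

Lemma bfs_integrable D f : measurable D -> bfs f ->
  mu.-integrable D (EFin \o f).
Proof.
move=> mD [mf [A mA [Afin [C hC]]]].
apply: (@integrableS _ _ _ mu setT) => //.
apply: (@le_integrable _ _ _ mu setT _ _ (fun x => C%:E * (\1_A x : R)%:E)%E) => //.
- exact/measurable_EFinP.
- by move=> x _; rewrite -EFinM !abse_EFin lee_fin (le_trans (hC x))// ler_norm.
- apply: integrableZl => //; apply/integrableP; split.
    exact/measurable_EFinP/measurable_indic.
  under eq_integral do rewrite gee0_abs//.
  by rewrite integral_indic// setIT.
Qed.

Lemma bfs_dominated (f g : T -> R) : measurable_fun setT f -> bfs g ->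
  (forall x, `|f x| <= `|g x|) -> bfs f.
Proof.
move=> mf [mg [A mA [Afin [C hC]]]] fg; split => //; exists A => //; split=> //.
by exists C => x; exact: le_trans (fg x) (hC x).
Qed.

Lemma bfs_indic A : measurable A -> (mu A < +oo)%E -> bfs (\1_A : T -> R).
Proof.
move=> mA fA; split; first exact: measurable_indic.
by exists A => //; split => //; exists 1 => x; rewrite mul1r ger0_norm.
Qed.

Lemma bfsD f g : bfs f -> bfs g -> bfs (fun x => f x + g x).
Proof.
move=> [mf [A mA [fA [C hC]]]] [mg [B mB [fB [D hD]]]].
split; first exact: measurable_funD.
exists (A `|` B); first exact: measurableU.
split; first by apply: (le_lt_trans (measureU2 _ mA mB)); exact: lte_add_pinfty.
exists (`|C| + `|D|) => x.
rewrite (le_trans (ler_normD _ _))//.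
have := hC x; have := hD x; rewrite !indicE in_setU.
have := ler_norm C; have := ler_norm D; have := normr_ge0 C; have := normr_ge0 D.
by case: (x \in A); case: (x \in B) => /=; lra.
Qed.

Lemma bfsM (f g : T -> R) M : bfs f -> measurable_fun setT g -> (forall x, `|g x| <= M) ->
  bfs (fun x => f x * g x).
Proof.
move=> [mf [A mA [fA [C hC]]]] mg hM.
split; first exact: measurable_funM.
exists A => //; split => //; exists (C * M) => x.
by rewrite normrM mulrAC ler_pM.
Qed.

Lemma bfsZ k f : bfs f -> bfs (fun x => k * f x).
Proof.
move=> bf; under eq_fun do rewrite mulrC.
exact: (@bfsM _ (cst k) `|k| bf).
Qed.

Lemma bfsN f : bfs f -> bfs (fun x => - f x).
Proof.
move=> [mf h]; apply: (bfs_dominated _ (conj mf h)).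
  exact: measurable_funN.
by move=> x; rewrite normrN.
Qed.

Lemma bfsB f g : bfs f -> bfs g -> bfs (fun x => f x - g x).
Proof. by move=> bf bg; apply: bfsD => //; exact: bfsN. Qed.

Lemma bfs_norm f : bfs f -> bfs (fun x => `|f x|).
Proof.
move=> [mf h]; apply: (bfs_dominated _ (conj mf h)).
  exact: measurableT_comp.
by move=> x; rewrite normr_id.
Qed.

Lemma bfs_restrict D f : measurable D -> bfs f -> bfs (f \_ D).
Proof.
move=> mD bf; apply: (bfs_dominated _ bf).
  by apply/(measurable_restrictT _ mD).1; apply: measurable_funTS; case: bf.
by move=> x; rewrite patchE; case: ifPn => // _; rewrite normr0.
Qed.

Variable D : set T.
Hypothesis mD : measurable D.

Lemma bfs_intD f g : bfs f -> bfs g ->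
  \int[mu]_(x in D) (f x + g x) = \int[mu]_(x in D) f x + \int[mu]_(x in D) g x.
Proof. by move=> bf bg; rewrite RintegralD//; exact: bfs_integrable. Qed.

Lemma bfs_intB f g : bfs f -> bfs g ->
  \int[mu]_(x in D) (f x - g x) = \int[mu]_(x in D) f x - \int[mu]_(x in D) g x.
Proof. by move=> bf bg; rewrite RintegralB//; exact: bfs_integrable. Qed.

Lemma bfs_intZ k f : bfs f ->
  \int[mu]_(x in D) (k * f x) = k * \int[mu]_(x in D) f x.
Proof. by move=> bf; rewrite RintegralZl//; exact: bfs_integrable. Qed.

Lemma bfs_le_int f g : bfs f -> bfs g -> (forall x, D x -> f x <= g x) ->
  \int[mu]_(x in D) f x <= \int[mu]_(x in D) g x.
Proof. by move=> bf bg fg; apply: le_Rintegral => //; exact: bfs_integrable. Qed.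

Lemma bfs_norm_int f g : bfs f -> bfs g -> (forall x, D x -> `|f x| <= g x) ->
  `|\int[mu]_(x in D) f x| <= \int[mu]_(x in D) g x.
Proof.
move=> bf bg fg; apply: (le_trans (le_normr_Rintegral mD (bfs_integrable mD bf))).
by apply: bfs_le_int => //; exact: bfs_norm.
Qed.

Lemma bfs_EFin_int f : bfs f ->
  (\int[mu]_(x in D) (f x)%:E)%E = (\int[mu]_(x in D) f x)%:E.
Proof.
by move=> bf; rewrite /Rintegral fineK//; apply: integrable_fin_num => //;
  exact: bfs_integrable.
Qed.

End BoundedFiniteSupport.

(** * Derivatives and continuity from explicit remainder bounds *)

Section ScalarCalculus.
Context {R : realType}.
Implicit Types (F : R -> R) (x l C : R).

(** The [+ 1] covers [C = 0]; radii are chosen in the form [x / (C + 1)] throughout. *)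
Lemma mul_div_succ_le C x : 0 <= C -> 0 < x -> C * (x / (C + 1)) <= x.
Proof. by move=> C0 x0; rewrite mulrA ler_pdivrMr; nra. Qed.

(** A quadratic remainder bound survives integration against a bounded function. This criterion thus
    replaces differentiation under the integral sign for all smoothed quantities. *)
Lemma is_derive_quad F x l C :
  (forall y, `|y - x| <= 1 -> `|F y - F x - (y - x) * l| <= C * (y - x) ^+ 2) ->
  is_derive x 1 F l.
Proof.
move=> hF.
have C0 : 0 <= C.
  have := hF (x + 1); rewrite (_ : x + 1 - x = 1) ?expr1n ?mulr1; last by ring.
  by rewrite normr1 => /(_ (lexx _)); exact: le_trans.
have cv : h^-1 *: ((F \o shift x) (h *: 1) - F x) @[h --> 0^'] --> l.
  apply/cvgrPdist_le => /= eps eps0.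
  near=> h.
  have h0 : h != 0 by near: h; exact: nbhs_dnbhs_neq.
  rewrite /= [h%:A]mulr1.
  have h1 : `|h| <= 1 by near: h; apply: dnbhs0_le.
  have := hF (h + x); rewrite addrK => /(_ h1).
  have -> : l - h^-1 *: (F (h + x) - F x) =
            - (h^-1 * (F (h + x) - F x - h * l)).
    by rewrite [h^-1 *: _]/GRing.scale/=; field.
  move=> hh; rewrite normrN normrM normfV ler_pdivrMl ?normr_gt0//.
  apply: (le_trans hh); rewrite -(real_normK (num_real h)) expr2 mulrA mulrC.
  rewrite ler_wpM2l//.
  have hs : `|h| <= eps / (C + 1).
    near: h; apply: dnbhs0_le; rewrite divr_gt0//; lra.
  apply: (@le_trans _ _ (C * (eps / (C + 1)))); first by rewrite ler_wpM2l.
  exact: mul_div_succ_le.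
by apply: DeriveDef; [apply/cvg_ex; exists l|exact: cvg_lim].
Unshelve. all: by end_near. Qed.

Lemma lipschitz_cont F C : (forall x y, `|F x - F y| <= C * `|x - y|) ->
  continuous F.
Proof.
move=> hF x; apply/cvgrPdist_le => /= eps eps0.
have C0 : 0 <= C.
  have := hF (x + 1) x; rewrite (_ : x + 1 - x = 1) ?normr1 ?mulr1; last by ring.
  exact: le_trans.
have d0 : 0 < eps / (C + 1) by rewrite divr_gt0//; lra.
near=> y.
apply: (le_trans (hF _ _)).
have hs : `|x - y| <= eps / (C + 1).
  near: y; apply: (@cvgr_dist_le _ _ _ _ _ id x) => //; exact: cvg_id.
apply: (@le_trans _ _ (C * (eps / (C + 1)))); first by rewrite ler_wpM2l.
exact: mul_div_succ_le.
Unshelve. all: by end_near. Qed.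

Lemma lipschitz_cont2 (F : R -> R -> R) C D :
  (forall t x s y, `|F t x - F s y| <= C * `|t - s| + D * `|x - y|) ->
  continuous (fun z : R * R => F z.1 z.2).
Proof.
move=> hF [t x]; apply/cvgrPdist_le => /= eps eps0.
have C0 : 0 <= C.
  have := hF 1 x 0 x; rewrite !subrr normr0 mulr0 addr0 subr0 normr1 mulr1.
  exact: le_trans.
have D0 : 0 <= D.
  have := hF t 1 t 0; rewrite !subrr normr0 mulr0 add0r subr0 normr1 mulr1.
  exact: le_trans.
have d0 : 0 < eps / (C + D + 1) by rewrite divr_gt0//; lra.
near=> z.
apply: (le_trans (hF _ _ _ _)).
have h1 : `|t - z.1| <= eps / (C + D + 1).
  near: z; apply: (@cvgr_dist_le _ _ _ _ _ fst t) => //; exact: cvg_fst.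
have h2 : `|x - z.2| <= eps / (C + D + 1).
  near: z; apply: (@cvgr_dist_le _ _ _ _ _ snd x) => //; exact: cvg_snd.
apply: (@le_trans _ _ ((C + D) * (eps / (C + D + 1)))).
  by rewrite mulrDl lerD// ler_wpM2l.
by apply: mul_div_succ_le => //; exact: addr_ge0.
Unshelve. all: by end_near. Qed.

Lemma bounded_derive_lipschitz F (f : R -> R) C :
  (forall x, is_derive x 1 F (f x)) -> (forall x, `|f x| <= C) ->
  forall x y, `|F x - F y| <= C * `|x - y|.
Proof.
move=> dF bf x y; wlog xy : x y / y <= x.
  move=> W; case: (leP y x) => [/W//|/ltW /W].
  by rewrite distrC (distrC y).
move: xy; rewrite le_eqVlt => /predU1P[->|yx].
  by rewrite !subrr normr0 mulr0.
have cF : {within `[y, x], continuous F}.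
  apply: continuous_subspaceT => z; apply: differentiable_continuous.
  by apply/derivable1_diffP; have [] := dF z.
have [z _ ->] := MVT yx (fun z _ => dF z) cF.
by rewrite normrM ler_wpM2r.
Qed.

End ScalarCalculus.

(** * The smoothing kernel *)

Section Kernel.
Context {R : realType}.
Implicit Types (r x y e : R).

Definition clamp r : R := if r <= -1 then -1 else if 1 <= r then 1 else r.

(* The Epanechnikov kernel at scale [e]. *)
Definition kerc e r : R := 3 / 4 * (1 - clamp (r / e) ^+ 2) / e.

(* The primitive of [kerc e] that vanishes at [-oo]. *)
Definition kerp e r : R :=
  1 / 2 + 3 / 4 * (clamp (r / e) - clamp (r / e) ^+ 3 / 3).

Lemma clamp_itv r : -1 <= clamp r <= 1.
Proof. by rewrite /clamp; case: ifPn; [lra|]; case: ifPn; lra. Qed.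

Lemma clamp_nd x y : x <= y -> clamp x <= clamp y.
Proof. by rewrite /clamp => xy; repeat (case: ifPn => ?); lra. Qed.

Lemma clamp_lip x y : `|clamp x - clamp y| <= `|x - y|.
Proof.
wlog xy : x y / x <= y.
  by move=> W; case: (leP x y) => [/W//|/ltW /W]; rewrite distrC (distrC y).
rewrite distrC (distrC x) !ger0_norm ?subr_ge0 ?clamp_nd//.
by rewrite /clamp; repeat (case: ifPn => ?); lra.
Qed.

(** The weight [1 - clamp x ^+ 2] vanishes outside []-1, 1[], where [clamp] need not have slope 1.
    For [x] inside, the overshoot of [y] past a kink and the distance from [x] to that kink add up
    to [|y - x|], and their product is quadratic. *)
Lemma clamp_quad x y :
  `|(clamp y - clamp x - (y - x)) * (1 - clamp x ^+ 2)| <= (y - x) ^+ 2.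
Proof.
rewrite {2 3}/clamp; case: ifPn => x1.
  by rewrite (_ : 1 - (-1) ^+ 2 = 0) ?mulr0 ?normr0 ?sqr_ge0//; ring.
case: ifPn => x2.
  by rewrite (_ : 1 - 1 ^+ 2 = 0) ?mulr0 ?normr0 ?sqr_ge0//; ring.
rewrite -ltNge in x1; rewrite -ltNge in x2.
rewrite ler_norml /clamp; case: ifPn => y1.
  have h1 : 0 <= (-1 - y) * (1 + x) by apply: mulr_ge0; lra.
  have h2 : 0 <= (-1 - y) * (1 + x) * (1 + x) by apply: mulr_ge0 => //; lra.
  have h3 : 0 <= (-1 - y) * (1 + x) * (1 - x) by apply: mulr_ge0 => //; lra.
  have h4 := sqr_ge0 (-1 - y); have h5 := sqr_ge0 (1 + x).
  by apply/andP; split; lra.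
case: ifPn => y2.
  have h1 : 0 <= (y - 1) * (1 - x) by apply: mulr_ge0; lra.
  have h2 : 0 <= (y - 1) * (1 - x) * (1 + x) by apply: mulr_ge0 => //; lra.
  have h3 : 0 <= (y - 1) * (1 - x) * (1 - x) by apply: mulr_ge0 => //; lra.
  have h4 := sqr_ge0 (y - 1); have h5 := sqr_ge0 (1 - x).
  by apply/andP; split; lra.
by rewrite subrr mul0r oppr_le0 sqr_ge0.
Qed.

Lemma kerp_quad1 x y :
  `|kerp 1 y - kerp 1 x - (y - x) * kerc 1 x| <= 2 * (y - x) ^+ 2.
Proof.
rewrite /kerp /kerc !divr1.
have h1 := clamp_quad x y; have h2 := clamp_lip y x.
have h3 := clamp_itv x; have h4 := clamp_itv y.
have h5 : (clamp y - clamp x) ^+ 2 <= (y - x) ^+ 2.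
  by rewrite -(real_normK (num_real (clamp y - clamp x)))
    -(real_normK (num_real (y - x))) lerXn2r// nnegrE.
move: (clamp x) (clamp y) h1 h2 h3 h4 h5 => c d h1 h2 h3 h4 h5.
(* The first summand is the Taylor remainder of the cubic [c - c^3 / 3] between the clamped values;
   the second replaces [d - c] by [y - x] in the linear term. *)
rewrite (_ : _ - _ - _ = 1 / 4 * ((d - c) * (c - d) * (2 * c + d))
   + 3 / 4 * ((d - c - (y - x)) * (1 - c ^+ 2))); last by field.
rewrite (le_trans (ler_normD _ _))//.
have h6 : `|(d - c) * (c - d) * (2 * c + d)| <= 3 * (y - x) ^+ 2.
  rewrite normrM mulrC (_ : (d - c) * (c - d) = - (d - c) ^+ 2); last by ring.
  rewrite normrN (ger0_norm (sqr_ge0 _)) ler_pM// ?sqr_ge0//.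
  by rewrite ler_norml; lra.
have n1 : `|1 / 4| = 1 / 4 :> R by rewrite ger0_norm; lra.
have n2 : `|3 / 4| = 3 / 4 :> R by rewrite ger0_norm; lra.
by rewrite (normrM (1 / 4)) (normrM (3 / 4)) n1 n2; have := sqr_ge0 (y - x); lra.
Qed.

Section pos.
Variable e : R.
Hypothesis e0 : 0 < e.

Lemma kerpE r : kerp e r = kerp 1 (r / e).
Proof. by rewrite /kerp divr1. Qed.

Lemma kercE r : kerc e r = kerc 1 (r / e) / e.
Proof. by rewrite /kerc !divr1. Qed.

Lemma kerp_quad x y :
  `|kerp e y - kerp e x - (y - x) * kerc e x| <= 2 / e ^+ 2 * (y - x) ^+ 2.
Proof.
have := kerp_quad1 (x / e) (y / e).
rewrite !kerpE kercE -mulrBl => h.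
rewrite (_ : _ * (_ / e) = (y - x) / e * kerc 1 (x / e)); last by ring.
by apply: (le_trans h); rewrite exprMn exprVn mulrA mulrAC.
Qed.

Lemma is_derive_kerp x : is_derive x 1 (kerp e) (kerc e x).
Proof. by apply: (@is_derive_quad _ _ _ _ (2 / e ^+ 2)) => y _; exact: kerp_quad. Qed.

Lemma kerc_ge0 r : 0 <= kerc e r.
Proof.
rewrite /kerc; apply: divr_ge0; last exact: ltW.
by have := clamp_itv (r / e); nra.
Qed.

Lemma kerc_le r : kerc e r <= e^-1.
Proof.
rewrite /kerc ler_pdivrMr// mulVf ?gt_eqF//.
by have := clamp_itv (r / e); nra.
Qed.

Lemma kerc_lip x y : `|kerc e x - kerc e y| <= 2 / e ^+ 2 * `|x - y|.
Proof.
rewrite /kerc -mulrBl -mulrBr.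
rewrite (_ : (1 - _ - _) = (clamp (y / e) - clamp (x / e))
  * (clamp (y / e) + clamp (x / e))); last by ring.
have h1 := clamp_lip (y / e) (x / e).
rewrite -mulrBl normrM [X in _ <= _ * X]gtr0_norm ?invr_gt0// in h1.
have h : `|clamp (y / e) + clamp (x / e)| <= 2.
  by rewrite ler_norml; have := clamp_itv (x / e); have := clamp_itv (y / e); lra.
rewrite !normrM [`|e^-1|]gtr0_norm ?invr_gt0// (distrC x y) normfV !normr_nat.
rewrite (_ : 2 / e ^+ 2 * `|y - x| = 2 * (`|y - x| / e) / e); last first.
  by field; rewrite gt_eqF.
rewrite ler_pM2r ?invr_gt0//.
rewrite (@le_trans _ _ (3 / 4 * (`|y - x| / e * 2)))//.
  by rewrite ler_wpM2l ?ler_pM//; lra.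
have : 0 <= `|y - x| / e by rewrite divr_ge0// ltW.
lra.
Qed.

Lemma kerc_cont : continuous (kerc e).
Proof. exact: lipschitz_cont kerc_lip. Qed.

Lemma kerp_cont : continuous (kerp e).
Proof.
move=> x; apply: differentiable_continuous; apply/derivable1_diffP.
by have [] := is_derive_kerp x.
Qed.

Lemma kerc_out r : e <= `|r| -> kerc e r = 0.
Proof.
move=> h; rewrite /kerc /clamp; case: ifPn => [_|h1]; first by ring.
case: ifPn => [_|h2]; first by ring.
exfalso; move: h1 h2; rewrite -!ltNge ltr_pdivlMr// ltr_pdivrMr// => h1 h2.
have : `|r| < e by rewrite ltr_norml; apply/andP; split; lra.
by rewrite ltNge h.
Qed.

Lemma kerp_left r : r <= - e -> kerp e r = 0.
Proof.
move=> h; rewrite /kerp /clamp ifT; first by field.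
by rewrite ler_pdivrMr//; lra.
Qed.

Lemma kerp_right r : e <= r -> kerp e r = 1.
Proof.
move=> h; have h1 : 1 <= r / e by rewrite ler_pdivlMr//; lra.
by rewrite /kerp /clamp ifF ?h1; [field|apply/negbTE; rewrite -ltNge; lra].
Qed.

Lemma kerp_itv r : 0 <= kerp e r <= 1.
Proof.
rewrite /kerp; have := clamp_itv (r / e); move: (clamp _) => c hc.
have h1 : 0 <= (c - 1) ^+ 2 * (c + 2) by apply: mulr_ge0; [exact: sqr_ge0|lra].
have h2 : 0 <= (c + 1) ^+ 2 * (2 - c) by apply: mulr_ge0; [exact: sqr_ge0|lra].
lra.
Qed.

Lemma kerp_nd x y : x <= y -> kerp e x <= kerp e y.
Proof.
move=> xy; rewrite /kerp.
have h : clamp (x / e) <= clamp (y / e).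
  by apply: clamp_nd; rewrite ler_pM2r ?invr_gt0.
have := clamp_itv (x / e); have := clamp_itv (y / e).
move: (clamp (x / e)) (clamp (y / e)) h => c d cd h1 h2.
have h3 : c ^+ 2 <= 1 by nra.
have h4 : d ^+ 2 <= 1 by nra.
have h5 := sqr_ge0 (c - d).
suff : 0 <= (d - c) * (3 - (d ^+ 2 + c * d + c ^+ 2)) by lra.
by apply: mulr_ge0; lra.
Qed.

Lemma kerp_lip x y : `|kerp e x - kerp e y| <= e^-1 * `|x - y|.
Proof.
apply: (bounded_derive_lipschitz is_derive_kerp) => z.
by rewrite ger0_norm ?kerc_ge0 ?kerc_le.
Qed.

End pos.
End Kernel.

(** * Kernel integrals on the half plane and smoothed indicators *)

Section KernelIntegrals.
Context {R : realType}.
Implicit Types (t x y s e a b : R).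
Local Notation mu := (@lebesgue_measure R).
Local Notation leb2 := (@leb2 R).

Definition halfplane : set (R * R) := [set z | 0 < z.1].

Lemma measurable_halfplane : measurable halfplane.
Proof.
have -> : halfplane = (`]0, +oo[%classic : set R) `*` setT.
  by apply/seteqP; split=> -[s y]; rewrite /halfplane/= in_itv/= andbT => // -[].
by apply: measurableX.
Qed.

Lemma bfs_itv (f : R -> R) C a b : measurable_fun setT f ->
  (forall x, `|f x| <= C) -> (forall x, ~~ (a <= x <= b) -> f x = 0) -> bfs mu f.
Proof.
move=> mf hC h0; split => //; exists `[a, b]%classic => //; split.
  by rewrite /= lebesgue_measure_itv/=; case: ifP => //; rewrite -EFinB ltry.
exists C => x; rewrite indicE mem_setE in_itv/=.
by case: (boolP (a <= x <= b)) => [_|/h0 ->]; rewrite ?mulr1// normr0 mulr0.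
Qed.

Lemma bfs_prod (p q : R -> R) : bfs mu p -> bfs mu q ->
  bfs leb2 (fun z : R * R => p z.1 * q z.2).
Proof.
move=> [mp [A mA [fA [C hC]]]] [mq [B mB [fB [D hD]]]].
split.
  by apply: measurable_funM; apply: measurableT_comp.
exists (A `*` B); first exact: measurableX.
split.
  rewrite [X in (X < _)%E](_ : _ = (mu A * mu B)%E); last exact: product_measure1E.
  by apply: lte_mul_pinfty => //; rewrite ge0_fin_numE.
exists (C * D) => -[s y]/=; rewrite normrM.
rewrite (_ : \1_(A `*` B) (s, y) = (\1_A s : R) * (\1_B y : R)); last first.
  by rewrite !indicE in_setX/= -mulnb natrM.
by rewrite mulrACA ler_pM.
Qed.

Lemma int_prod (p q : R -> R) : bfs mu p -> bfs mu q ->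
  \int[leb2]_(z in halfplane) (p z.1 * q z.2) =
  (\int[mu]_(s in `]0, +oo[) p s) * (\int[mu]_y q y).
Proof.
move=> bp bq.
have bp' : bfs mu (p \_ `]0, +oo[).
  by apply: bfs_restrict => //; exact: measurable_itv.
apply: (@congr1 _ _ fine _ (_ * _)%:E).
transitivity (\int[leb2]_z (((p \_ `]0, +oo[) z.1) * q z.2)%:E)%E.
  rewrite integral_mkcond; apply: eq_integral => -[s y] _.
  rewrite !patchE/= /halfplane; case: ifPn; rewrite ?inE/=.
    by move=> s0; rewrite mem_set//= in_itv/= s0.
  rewrite notin_setE/= => s0; rewrite memNset ?mul0r//=.
  by rewrite in_itv/= andbT.
rewrite -integral12_prod_meas1/=; last first.
  exact: (bfs_integrable measurableT (bfs_prod bp' bq)).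
rewrite /fubini_F/=.
under eq_integral => s _.
  under eq_integral do rewrite EFinM.
  rewrite integralZl//; last exact: bfs_integrable.
  rewrite bfs_EFin_int//.
  over.
rewrite /= integralZr//; last exact: bfs_integrable.
by rewrite bfs_EFin_int//= [in RHS]Rintegral_mkcond EFinM.
Qed.

Lemma measurable_kerc e (e0 : 0 < e) x : measurable_fun setT (fun y => kerc e (y - x)).
Proof.
apply: continuous_measurable_fun => y.
apply: (@continuous_comp _ _ _ (fun y => y - x) (kerc e)); last exact: kerc_cont.
by apply: cvgB; [exact: cvg_id|exact: cvg_cst].
Qed.

Lemma measurable_kerp e (e0 : 0 < e) x : measurable_fun setT (fun y => kerp e (y - x)).
Proof.
apply: continuous_measurable_fun => y.
apply: (@continuous_comp _ _ _ (fun y => y - x) (kerp e)); last exact: kerp_cont.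
by apply: cvgB; [exact: cvg_id|exact: cvg_cst].
Qed.

Lemma bfs_kerc e (e0 : 0 < e) x : bfs mu (fun y => kerc e (y - x)).
Proof.
apply: (@bfs_itv _ e^-1 (x - e) (x + e)); first exact: measurable_kerc.
  by move=> y; rewrite ger0_norm ?kerc_ge0 ?kerc_le.
move=> y h; apply: kerc_out => //; rewrite leNgt; apply: contra h.
by rewrite ltr_norml => /andP[]; lra.
Qed.

Lemma int_kerc_itv e (e0 : 0 < e) x a b : a < b ->
  \int[mu]_(y in `[a, b]) kerc e (y - x) = kerp e (b - x) - kerp e (a - x).
Proof.
move=> ab.
have dK y : is_derive y 1 (fun y => kerp e (y - x)) (kerc e (y - x)).
  apply: (@is_derive_quad _ _ _ _ (2 / e ^+ 2)) => z _.
  by have := kerp_quad e (y - x) (z - x); rewrite (_ : z - x - (y - x) = z - y)//; ring.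
have cK : continuous (fun y => kerp e (y - x)).
  move=> y; apply: differentiable_continuous; apply/derivable1_diffP.
  by have [] := dK y.
rewrite /Rintegral (@continuous_FTC2 _ _ (fun y => kerp e (y - x)))//.
- apply: continuous_subspaceT => y.
  apply: (@continuous_comp _ _ _ (fun y => y - x) (kerc e)); last exact: kerc_cont.
  by apply: cvgB; [exact: cvg_id|exact: cvg_cst].
- split=> [y _||]; first by have [] := dK y.
    by apply: cvg_at_right_filter; exact: cK.
  by apply: cvg_at_left_filter; exact: cK.
- by move=> y _; rewrite derive1E; exact: derive_val.
Qed.

Lemma int_kerc e (e0 : 0 < e) x : \int[mu]_y kerc e (y - x) = 1.
Proof.
transitivity (kerp e (x + e - x) - kerp e (x - e - x)); last first.
  have -> : x + e - x = e by ring.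
  have -> : x - e - x = - e by ring.
  by rewrite (kerp_right e0 (lexx _)) (kerp_left e0 (lexx _)) subr0.
have xe : x - e < x + e by lra.
rewrite -(int_kerc_itv e0 x xe).
rewrite [RHS]Rintegral_mkcond; apply: eq_Rintegral => y _.
rewrite patchE; case: ifPn => //; rewrite mem_setE in_itv/= => h.
apply: kerc_out => //; rewrite leNgt; apply: contra h.
by rewrite ltr_norml => /andP[]; lra.
Qed.

(** The half plane cuts off the mass [kerp e (- t)] of the kernel, which is zero as soon as
    [e <= t]. This is the source of the conditions [e <= t] in later estimates. *)
Lemma int_kerc_pos e (e0 : 0 < e) t : \int[mu]_(s in `]0, +oo[) kerc e (s - t) = 1 - kerp e (- t).
Proof.
(* An upper end beyond the support of the kernel, positive also when [t] is negative. *)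
pose b := `|t| + e.
have b0 : 0 < b by rewrite /b; have := normr_ge0 t; lra.
have bt : e <= b - t by rewrite /b; have := ler_norm t; lra.
transitivity (kerp e (b - t) - kerp e (0 - t)); last first.
  by rewrite (kerp_right e0 bt) sub0r.
rewrite -(int_kerc_itv e0)// -Rintegral_itv_obnd_cbnd; last first.
  by apply: bfs_integrable => //; exact: bfs_kerc.
rewrite Rintegral_mkcond [RHS]Rintegral_mkcond; apply: eq_Rintegral => s _.
rewrite !patchE !mem_setE !in_itv/= andbT; case: (ltrP 0 s) => //= s0.
case: ifPn => //; rewrite -ltNge => bs.
apply: kerc_out => //; rewrite ler_normr; apply/orP; left.
by move: bs; rewrite /b; have := ler_norm t; lra.
Qed.

(* Smoothed indicator of the interval between [a] and [b], signed when [b < a]. *)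
Definition trapeze e a b y : R := kerp e (y - a) - kerp e (y - b).

(* Smoothed indicator of [0 < s < t]. *)
Definition tramp e t s : R := if 0 < s then 1 - kerp e (s - t) else 0.

Lemma trapeze_le1 e (e0 : 0 < e) a b y : `|trapeze e a b y| <= 1.
Proof.
by rewrite ler_norml /trapeze; have := kerp_itv e (y - a);
   have := kerp_itv e (y - b); lra.
Qed.

Lemma trapeze_out e (e0 : 0 < e) a b y : ~~ (- (`|a| + `|b| + e) <= y <= `|a| + `|b| + e) ->
  trapeze e a b y = 0.
Proof.
have ha := ler_norm a; have hb := ler_norm b.
have ha' := ler_norm (- a); have hb' := ler_norm (- b); rewrite !normrN in ha' hb'.
rewrite negb_and -!ltNge /trapeze => /orP[h|h].
  by rewrite !kerp_left ?subrr//; lra.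
by rewrite !kerp_right ?subrr//; lra.
Qed.

Lemma bfs_trapeze e (e0 : 0 < e) a b : bfs mu (trapeze e a b).
Proof.
apply: (@bfs_itv _ 1 _ _ _ (trapeze_le1 e0 a b) (@trapeze_out _ e0 a b)).
by apply: measurable_funB; exact: measurable_kerp.
Qed.

Lemma bfs_tramp e (e0 : 0 < e) t : bfs mu (tramp e t).
Proof.
apply: (@bfs_itv _ 1 0 (`|t| + e)).
- apply: measurable_fun_ifT => //; last first.
    by apply: measurable_funB => //; exact: measurable_kerp.
  by apply: measurable_fun_ltr.
- move=> s; rewrite /tramp; case: ifPn; rewrite ?normr0// ler_norml => _.
  by have := kerp_itv e (s - t); lra.
- move=> s; rewrite negb_and -!ltNge /tramp => /orP[h|h].
    by rewrite ltNge (ltW h).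
  by rewrite kerp_right ?subrr ?if_same//; have := ler_norm t; lra.
Qed.

Section halfplane_integral.
Implicit Types f g : R * R -> R.

Lemma hp_intD f g : bfs leb2 f -> bfs leb2 g ->
  \int[leb2]_(z in halfplane) (f z + g z) =
  \int[leb2]_(z in halfplane) f z + \int[leb2]_(z in halfplane) g z.
Proof. by move=> *; exact: (@bfs_intD _ _ _ leb2 halfplane measurable_halfplane). Qed.

Lemma hp_intB f g : bfs leb2 f -> bfs leb2 g ->
  \int[leb2]_(z in halfplane) (f z - g z) =
  \int[leb2]_(z in halfplane) f z - \int[leb2]_(z in halfplane) g z.
Proof. by move=> *; exact: (@bfs_intB _ _ _ leb2 halfplane measurable_halfplane). Qed.

Lemma hp_intZ k f : bfs leb2 f ->
  \int[leb2]_(z in halfplane) (k * f z) = k * \int[leb2]_(z in halfplane) f z.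
Proof. by move=> *; exact: (@bfs_intZ _ _ _ leb2 halfplane measurable_halfplane). Qed.

Lemma hp_le_int f g : bfs leb2 f -> bfs leb2 g ->
  (forall z, halfplane z -> f z <= g z) ->
  \int[leb2]_(z in halfplane) f z <= \int[leb2]_(z in halfplane) g z.
Proof. by move=> *; exact: (@bfs_le_int _ _ _ leb2 halfplane measurable_halfplane). Qed.

Lemma hp_norm_int f g : bfs leb2 f -> bfs leb2 g ->
  (forall z, halfplane z -> `|f z| <= g z) ->
  `|\int[leb2]_(z in halfplane) f z| <= \int[leb2]_(z in halfplane) g z.
Proof. by move=> *; exact: (@bfs_norm_int _ _ _ leb2 halfplane measurable_halfplane). Qed.

Lemma eq_hp_int f g : (forall z, halfplane z -> f z = g z) ->
  \int[leb2]_(z in halfplane) f z = \int[leb2]_(z in halfplane) g z.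
Proof. by move=> fg; apply: eq_Rintegral => z; rewrite inE => /fg. Qed.

End halfplane_integral.

Section line_integral.
Implicit Types f g : R -> R.

Lemma ln_intD f g : bfs mu f -> bfs mu g ->
  \int[mu]_x (f x + g x) = \int[mu]_x f x + \int[mu]_x g x.
Proof. exact: (bfs_intD measurableT). Qed.

Lemma ln_intB f g : bfs mu f -> bfs mu g ->
  \int[mu]_x (f x - g x) = \int[mu]_x f x - \int[mu]_x g x.
Proof. exact: (bfs_intB measurableT). Qed.

Lemma ln_intZ k f : bfs mu f -> \int[mu]_x (k * f x) = k * \int[mu]_x f x.
Proof. exact: (bfs_intZ measurableT). Qed.

Lemma ln_norm_int f g : bfs mu f -> bfs mu g -> (forall x, `|f x| <= g x) ->
  `|\int[mu]_x f x| <= \int[mu]_x g x.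
Proof. by move=> bf bg fg; exact: (bfs_norm_int measurableT). Qed.

Lemma eq_ln_int f g : f =1 g -> \int[mu]_x f x = \int[mu]_x g x.
Proof. by move=> fg; apply: eq_Rintegral => z _. Qed.

End line_integral.

End KernelIntegrals.

(** * The entropy inequality and the weak equation *)

Section Kruzhkov.
Context {R : realType}.
Implicit Types (t x y s k : R).
Local Notation mu := (@lebesgue_measure R).
Local Notation leb2 := (@leb2 R).

(** An open set is the union of the rational boxes that it contains. This ties the topology of the
    plane to the product sigma-algebra that carries [leb2]. *)
Lemma open_measurable_plane (U : set (R * R)) : open U -> measurable U.
Proof.
move=> oU.
pose B (w : rat * rat * nat) : set (R * R) :=
  ball (ratr w.1.1 : R) w.2.+1%:R^-1 `*` ball (ratr w.1.2 : R) w.2.+1%:R^-1.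
have mB w : measurable (B w) by apply: measurableX; exact: measurable_ball.
rewrite (_ : U = \bigcup_w (if `[< B w `<=` U >] then B w else set0)).
  by apply: countable_bigcupT_measurable => // w; case: ifP.
apply/seteqP; split => [z Uz|z [w _]]; last by case: ifPn => // /asboolP; exact.
have /nbhs_ballP[eps /= eps0 hU] : nbhs z U by rewrite openE in oU; exact: oU.
(* The factor 2 pays for the distance from [z] to the rational centre and for the radius of the box
   around that centre. *)
have [n hn] : exists n, (2 * n.+1%:R^-1 : R) < eps.
  have eps2 : 0 < eps / 2 by rewrite divr_gt0.
  by have [n] := ltr_add_invr eps2; rewrite add0r => hn; exists n; rewrite mulrC -ltr_pdivlMr.
have n0 : (0 : R) < n.+1%:R^-1 by rewrite invr_gt0.
set d : R := n.+1%:R^-1 in hn n0 *.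
have [|p hp] := @rat_in_itvoo R (z.1 - d) (z.1 + d); first lra.
have [|q hq] := @rat_in_itvoo R (z.2 - d) (z.2 + d); first lra.
rewrite !in_itv/= in hp hq.
have zB : B (p, q, n) z.
  by split; rewrite /ball/= ltr_norml -/d; lra.
exists (p, q, n) => //; rewrite ifT//; apply/asboolP => y [].
rewrite /ball/= !ltr_norml -/d => y1 y2.
by apply: hU; split; rewrite /ball/= ltr_norml; lra.
Qed.

Lemma continuous_measurable_plane (f : R * R -> R) :
  continuous f -> measurable_fun setT f.
Proof.
move=> /continuousP cf; apply: (measurability _ (RGenOpens.measurableE R)).
move=> _ [_ [a [b ->] <-]]; rewrite setTI; apply: open_measurable_plane.
exact/cf/interval_open.
Qed.

(** Carrying the partial derivatives as explicit functions keeps ['D_1] out of the integrals, and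
    the last three fields allow the entropy inequality to be split into separate integrals. *)
Record test_C1 (phi phit phix : R -> R -> R) : Prop := TestC1 {
  test_ge0 : forall t x, 0 <= phi t x;
  test_supp : exists B : R, forall t x, B < `|t| \/ B < `|x| -> phi t x = 0;
  test_dt : forall t x, is_derive t 1 (phi^~ x) (phit t x);
  test_dx : forall t x, is_derive x 1 (phi t) (phix t x);
  test_cont : continuous (fun z : R * R => phi z.1 z.2);
  test_cont_t : continuous (fun z : R * R => phit z.1 z.2);
  test_cont_x : continuous (fun z : R * R => phix z.1 z.2);
  test_bfs_t : bfs leb2 (fun z => phit z.1 z.2);
  test_bfs_x : bfs leb2 (fun z => phix z.1 z.2);
  test_bfs_0 : bfs mu (phi 0)
}.

Lemma test_C1_test_fun phi phit phix :
  test_C1 phi phit phix -> test_fun phi.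
Proof.
case=> p0 [B hB] dt dx c ct cx _ _ _; split => //; split; first by exists B.
split; first by move=> t x; have [] := dt t x.
split; first by move=> t x; have [] := dx t x.
split => //; split.
  by rewrite (_ : (fun z => _) = (fun z => phit z.1 z.2))//; apply/funext => z;
    exact: derive_val.
by rewrite (_ : (fun z => _) = (fun z => phix z.1 z.2))//; apply/funext => z;
  exact: derive_val.
Qed.

(* Kruzhkov's flux [sgn (a - k) (a^2 / 2 - k^2 / 2)] is [|a - k| (a + k) / 2]. *)
Record kruzhkov (M : R) (a0 : R -> R) (a : R -> R -> R) : Prop := Kruzhkov {
  kr_meas : measurable_fun setT (fun z : R * R => a z.1 z.2);
  kr_meas0 : measurable_fun setT a0;
  kr_bd : forall t x, `|a t x| <= M;
  kr_bd0 : forall x, `|a0 x| <= M;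
  kr_ineq : forall k phi phit phix, test_C1 phi phit phix ->
    0 <= \int[leb2]_(z in halfplane) (`|a z.1 z.2 - k| *
           (phit z.1 z.2 + (a z.1 z.2 + k) / 2 * phix z.1 z.2))
         + \int[mu]_x (`|a0 x - k| * phi 0 x)
}.

Lemma bfs_entropy (a : R -> R -> R) M k phi phit phix :
  measurable_fun setT (fun z : R * R => a z.1 z.2) ->
  (forall t x, `|a t x| <= M) -> test_C1 phi phit phix ->
  bfs leb2 (fun z : R * R => `|a z.1 z.2 - k| *
           (phit z.1 z.2 + (a z.1 z.2 + k) / 2 * phix z.1 z.2)).
Proof.
move=> ma bM test.
under eq_fun do rewrite mulrC.
apply: (@bfsM _ _ _ _ _ _ (M + `|k|)) => //; last 2 first.
- by apply: measurableT_comp => //; apply: measurable_funB.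
- by move=> z; rewrite normr_id (le_trans (ler_normB _ _))// lerD.
apply: bfsD; first exact: test_bfs_t test.
under eq_fun do rewrite mulrC.
apply: (@bfsM _ _ _ _ _ _ ((M + `|k|) / 2)); first exact: test_bfs_x test.
  by apply: measurable_funM => //; apply: measurable_funD.
move=> z; rewrite normrM [X in _ * X]ger0_norm ?invr_ge0// ler_wpM2r ?invr_ge0//.
by rewrite (le_trans (ler_normD _ _))// lerD.
Qed.

Lemma bfs_entropy0 (a0 : R -> R) M k phi phit phix :
  measurable_fun setT a0 -> (forall x, `|a0 x| <= M) -> test_C1 phi phit phix ->
  bfs mu (fun x => `|a0 x - k| * phi 0 x).
Proof.
move=> ma bM test.
under eq_fun do rewrite mulrC.
apply: (@bfsM _ _ _ _ _ _ (M + `|k|)) => //; last 2 first.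
- by apply: measurableT_comp => //; apply: measurable_funB.
- by move=> z; rewrite normr_id (le_trans (ler_normB _ _))// lerD.
exact: test_bfs_0 test.
Qed.

Lemma entropy_solution_kruzhkov (a0 : R -> R) (a : R -> R -> R) (M0 : R) :
  measurable_fun setT a0 -> (forall x, `|a0 x| <= M0) -> entropy_solution a0 a ->
  exists M, kruzhkov M a0 a.
Proof.
move=> ma0 ba0 [ma [[M1 bM1] ent]].
pose M := Num.max M0 M1.
have bdM t x : `|a t x| <= M by rewrite le_max bM1 orbT.
have bd0 x : `|a0 x| <= M by rewrite le_max ba0.
exists M; split => // k phi phit phix test.
have := ent k phi (test_C1_test_fun test).
have b1 := bfs_entropy k ma bdM test; have b2 := bfs_entropy0 k ma0 bd0 test.
have E1 := @bfs_EFin_int _ _ _ leb2 halfplane measurable_halfplane _ b1.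
have E2 := bfs_EFin_int measurableT b2.
move=> h; rewrite -lee_fin EFinD.
apply: (eq_ind _ (fun v => (0%:E <= v)%E) h); congr (_ + _)%E; last exact: E2.
refine (etrans _ E1).
apply: eq_integral => z _; congr EFin.
have -> : 'D_1 (fun s => phi s z.2) z.1 = phit z.1 z.2.
  by have dt := test_dt test z.1 z.2; exact: derive_val.
have -> : 'D_1 (fun y => phi z.1 y) z.2 = phix z.1 z.2.
  by have dx := test_dx test z.1 z.2; exact: derive_val.
rewrite [RHS]mulrDr; congr (_ + _); rewrite mulrA; congr (_ * _).
rewrite /burgers_flux normrEsg.
by rewrite -!mulrA; congr (_ * _); field.
Qed.

End Kruzhkov.

Section WeakEquation.
Context {R : realType}.
Implicit Types (t x y s k e : R).
Local Notation mu := (@lebesgue_measure R).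
Local Notation leb2 := (@leb2 R).

Lemma bfs_kerc2 e (e0 : 0 < e) x1 x2 :
  bfs mu (fun y => kerc e (y - x1) - kerc e (y - x2)).
Proof. by apply: bfsB; exact: bfs_kerc. Qed.

Lemma is_derive_trapeze e x1 x2 y :
  is_derive y 1 (trapeze e x1 x2) (kerc e (y - x1) - kerc e (y - x2)).
Proof.
apply: (@is_derive_quad _ _ _ _ (2 / e ^+ 2 + 2 / e ^+ 2)) => z _.
have h1 := kerp_quad e (y - x1) (z - x1).
have h2 := kerp_quad e (y - x2) (z - x2).
rewrite (_ : z - x1 - (y - x1) = z - y) in h1; last by ring.
rewrite (_ : z - x2 - (y - x2) = z - y) in h2; last by ring.
rewrite /trapeze (_ : _ - _ - _ =
  (kerp e (z - x1) - kerp e (y - x1) - (z - y) * kerc e (y - x1)) -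
  (kerp e (z - x2) - kerp e (y - x2) - (z - y) * kerc e (y - x2))); last by ring.
by rewrite (le_trans (ler_normB _ _))// [leRHS]mulrDl lerD.
Qed.

Lemma continuous_kerc_sub e (e0 : 0 < e) x : continuous (fun y => kerc e (y - x)).
Proof.
apply: (@lipschitz_cont _ _ (2 / e ^+ 2)) => y z.
by have := kerc_lip e0 (y - x) (z - x); rewrite (_ : y - x - (z - x) = y - z)//; ring.
Qed.

Lemma continuous_trapeze e x1 x2 : continuous (trapeze e x1 x2).
Proof.
move=> y; apply: differentiable_continuous; apply/derivable1_diffP.
by have [] := is_derive_trapeze e x1 x2 y.
Qed.

Lemma continuous_tensor (p q : R -> R) : continuous p -> continuous q ->
  continuous (fun z : R * R => p z.1 * q z.2).
Proof.
move=> cp cq z; apply: cvgM.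
  by apply: (@continuous_comp _ _ _ fst p); [exact: cvg_fst|exact: cp].
by apply: (@continuous_comp _ _ _ snd q); [exact: cvg_snd|exact: cq].
Qed.

Lemma test_C1_trapeze e (e0 : 0 < e) t1 t2 x1 x2 : t1 <= t2 -> x1 <= x2 ->
  test_C1 (fun s y => trapeze e t1 t2 s * trapeze e x1 x2 y)
    (fun s y => (kerc e (s - t1) - kerc e (s - t2)) * trapeze e x1 x2 y)
    (fun s y => trapeze e t1 t2 s * (kerc e (y - x1) - kerc e (y - x2))).
Proof.
move=> t12 x12.
have tr0 a b y : a <= b -> 0 <= trapeze e a b y.
  by move=> ab; rewrite /trapeze subr_ge0 kerp_nd//; lra.
have ck a b : continuous (fun y => kerc e (y - a) - kerc e (y - b)).
  by move=> y; apply: cvgB; exact: continuous_kerc_sub.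
split.
- by move=> s y; rewrite mulr_ge0 ?tr0.
- exists (Num.max (`|t1| + `|t2| + e) (`|x1| + `|x2| + e)) => s y [h|h].
    rewrite trapeze_out ?mul0r//; apply/negP; rewrite -ler_norml.
    by move=> h'; move: h; rewrite ltNge le_max h'.
  rewrite [X in _ * X]trapeze_out ?mulr0//; apply/negP; rewrite -ler_norml.
  by move=> h'; move: h; rewrite ltNge le_max h' orbT.
- move=> s y; rewrite mulrC; under eq_fun do rewrite mulrC.
  exact: (is_deriveZ (trapeze e x1 x2 y) (is_derive_trapeze e t1 t2 s)).
- move=> s y; exact: (is_deriveZ (trapeze e t1 t2 s) (is_derive_trapeze e x1 x2 y)).
- by apply: continuous_tensor; exact: continuous_trapeze.
- by apply: (@continuous_tensor (fun s => kerc e (s - t1) - kerc e (s - t2)));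
    [exact: ck|exact: continuous_trapeze].
- by apply: (@continuous_tensor _ (fun y => kerc e (y - x1) - kerc e (y - x2)));
    [exact: continuous_trapeze|exact: ck].
- by apply: (@bfs_prod _ (fun s => kerc e (s - t1) - kerc e (s - t2)));
    [exact: bfs_kerc2|exact: bfs_trapeze].
- by apply: (@bfs_prod _ _ (fun y => kerc e (y - x1) - kerc e (y - x2)));
    [exact: bfs_trapeze|exact: bfs_kerc2].
- by apply: bfsZ; exact: bfs_trapeze.
Qed.

Variables (M : R) (a0 : R -> R) (a : R -> R -> R).
Hypothesis kr : kruzhkov M a0 a.

Lemma kr_M_ge0 : 0 <= M.
Proof. exact: le_trans (normr_ge0 _) (kr_bd0 kr 0). Qed.

Lemma measurable_kr_sq : measurable_fun setT (fun z : R * R => a z.1 z.2 ^+ 2 / 2).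
Proof.
by apply: measurable_funM => //; apply: measurable_funX; exact: kr_meas kr.
Qed.

Lemma kr_sq_le t x : `|a t x ^+ 2 / 2| <= M ^+ 2 / 2.
Proof.
rewrite normrM [X in _ * X]ger0_norm ?invr_ge0// ler_wpM2r ?invr_ge0//.
by rewrite normrX lerXn2r ?nnegrE ?(kr_bd kr)// kr_M_ge0.
Qed.

Lemma bfs_kr (f : R * R -> R) : bfs leb2 f -> bfs leb2 (fun z : R * R => f z * a z.1 z.2).
Proof.
move=> bf; apply: (@bfsM _ _ _ _ _ _ M) => //; first exact: kr_meas kr.
by move=> z; exact: kr_bd kr _ _.
Qed.

Lemma bfs_kr_sq (f : R * R -> R) : bfs leb2 f ->
  bfs leb2 (fun z : R * R => f z * (a z.1 z.2 ^+ 2 / 2)).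
Proof.
move=> bf; apply: (@bfsM _ _ _ _ _ _ (M ^+ 2 / 2)) => //.
  exact: measurable_kr_sq.
by move=> z; exact: kr_sq_le.
Qed.

Lemma bfs_kr0 (f : R -> R) : bfs mu f -> bfs mu (fun x => f x * a0 x).
Proof.
move=> bf; apply: (@bfsM _ _ _ _ _ _ M) => //; first exact: kr_meas0 kr.
by move=> z; exact: kr_bd0 kr _.
Qed.

(* Adding the Kruzhkov inequalities for two large opposite constants [k]. *)
Lemma test_mass_ge0 phi phit phix : test_C1 phi phit phix ->
  0 <= \int[leb2]_(z in halfplane) phit z.1 z.2 + \int[mu]_x phi 0 x.
Proof.
move=> test.
pose N := M + 1; have M0 := kr_M_ge0; have N0 : 0 < N by rewrite /N; lra.
have i1 := kr_ineq kr N test; have i2 := kr_ineq kr (- N) test.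
have b k := bfs_entropy k (kr_meas kr) (kr_bd kr) test.
have b' k := bfs_entropy0 k (kr_meas0 kr) (kr_bd0 kr) test.
have := addr_ge0 i1 i2; rewrite addrACA -(hp_intD (b _) (b _)) -(ln_intD (b' _) (b' _)).
rewrite (@eq_hp_int _ _ (fun z => (2 * N) * phit z.1 z.2)); last first.
  move=> z _; have := kr_bd kr z.1 z.2; rewrite ler_norml => /andP[h1 h2].
  rewrite ler0_norm ?ger0_norm /N; [by field|lra|lra].
rewrite (@eq_ln_int _ _ (fun x => (2 * N) * phi 0 x)); last first.
  move=> x; have := kr_bd0 kr x; rewrite ler_norml => /andP[h1 h2].
  rewrite ler0_norm ?ger0_norm /N; [by ring|lra|lra].
rewrite hp_intZ//; last exact: test_bfs_t test.
rewrite ln_intZ//; last exact: test_bfs_0 test.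
by rewrite -mulrDr pmulr_rge0// mulr_gt0.
Qed.

(** For [|k| > M] the modulus [|a - k|] is affine in [a], so the Kruzhkov inequalities at [k = N]
    and [k = - N] bound the weak form [S] from opposite sides. Tested on a product of two trapezes,
    this is conservation of mass between [x1] and [x2] up to time [t]. *)
Lemma weak_equation e (e0 : 0 < e) t x1 x2 : x1 <= x2 ->
  \int[leb2]_(z in halfplane)
     (kerc e (z.1 - t) * trapeze e x1 x2 z.2 * a z.1 z.2) =
  (1 - kerp e (- t)) * \int[mu]_y (trapeze e x1 x2 y * a0 y) +
  \int[leb2]_(z in halfplane)
     (tramp e t z.1 * (kerc e (z.2 - x1) - kerc e (z.2 - x2)) * (a z.1 z.2 ^+ 2 / 2)).
Proof.
move=> x12.
(* The time trapeze starts at [- r], so that its rising flank lies below [s = 0]: on the half plane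
   only the flank at [t] is seen. The choice also gives [- r <= t] for negative [t], as
   nonnegativity of the test function requires. *)
pose r := `|t| + e; have tr : - r <= t.
  by rewrite /r; have := ler_norm (- t); rewrite normrN; lra.
have re : e <= r by rewrite /r; have := normr_ge0 t; lra.
have test := test_C1_trapeze e0 tr x12.
pose z0 := trapeze e x1 x2; pose al := trapeze e (- r) t.
pose phit (z : R * R) := (kerc e (z.1 - - r) - kerc e (z.1 - t)) * z0 z.2.
pose phix (z : R * R) := al z.1 * (kerc e (z.2 - x1) - kerc e (z.2 - x2)).
have bt : bfs leb2 phit := test_bfs_t test.
have bx : bfs leb2 phix := test_bfs_x test.
have b0 : bfs mu (fun y => al 0 * z0 y) := test_bfs_0 test.
pose P (z : R * R) := phit z * a z.1 z.2 + phix z * (a z.1 z.2 ^+ 2 / 2).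
have bP : bfs leb2 P by apply: bfsD; [exact: bfs_kr|exact: bfs_kr_sq].
pose Q y := al 0 * z0 y * a0 y.
have bQ : bfs mu Q by exact: bfs_kr0.
have [J JE] : exists J, J = \int[leb2]_(z in halfplane) phit z by eexists.
have [L LE] : exists L, L = \int[leb2]_(z in halfplane) phix z by eexists.
have [J0 J0E] : exists J0, J0 = \int[mu]_y (al 0 * z0 y) by eexists.
have [S SE] : exists S, S = \int[leb2]_(z in halfplane) P z + \int[mu]_y Q y.
  by eexists.
have al0 : al 0 = 1 - kerp e (- t).
  by rewrite /al /trapeze opprK !add0r (kerp_right e0 re).
have JJ : J + J0 = 0.
  rewrite JE /phit (@int_prod _ (fun s => kerc e (s - - r) - kerc e (s - t)) z0);
    [|exact: bfs_kerc2|exact: bfs_trapeze].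
  rewrite bfs_intB//; [|exact: bfs_kerc|exact: bfs_kerc].
  rewrite !int_kerc_pos// opprK (kerp_right e0 re) J0E ln_intZ; last exact: bfs_trapeze.
  by rewrite al0; ring.
have key N : M < N -> - S + N ^+ 2 / 2 * L >= 0 /\ S - N ^+ 2 / 2 * L >= 0.
  move=> MN.
  have i1 := kr_ineq kr N test; have i2 := kr_ineq kr (- N) test.
  split.
    apply: (le_trans i1).
    rewrite (@eq_hp_int _ _ (fun z => (N * phit z + N ^+ 2 / 2 * phix z) - P z)); last first.
      move=> z _; have := kr_bd kr z.1 z.2; rewrite ler_norml => /andP[h1 h2].
      rewrite ler0_norm; last by rewrite subr_le0 (le_trans h2)// ltW.
      by rewrite /P /phit /phix /al /z0; field.
    rewrite (@eq_ln_int _ _ (fun y => N * (al 0 * z0 y) - Q y)); last first.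
      move=> x; have := kr_bd0 kr x; rewrite ler_norml => /andP[h1 h2].
      rewrite ler0_norm; last by rewrite subr_le0 (le_trans h2)// ltW.
      by rewrite /Q /al /z0; ring.
    rewrite hp_intB//; last by apply: bfsD; exact: bfsZ.
    rewrite hp_intD//; [|exact: bfsZ|exact: bfsZ].
    rewrite !hp_intZ// ln_intB//; last exact: bfsZ.
    rewrite ln_intZ// -JE -LE -J0E SE.
    by rewrite [leLHS](_ : _ = N * (J + J0) +
      (- (\int[leb2]_(z in halfplane) P z + \int[mu]_y Q y) + N ^+ 2 / 2 * L));
      [rewrite JJ mulr0 add0r|ring].
  apply: (le_trans i2).
  rewrite (@eq_hp_int _ _ (fun z => P z + (N * phit z - N ^+ 2 / 2 * phix z))); last first.
    move=> z _; have := kr_bd kr z.1 z.2; rewrite ler_norml => /andP[h1 h2].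
    rewrite ger0_norm; last by rewrite opprK -lerBlDr sub0r (le_trans _ h1)// lerN2 ltW.
    by rewrite /P /phit /phix /al /z0; field.
  rewrite (@eq_ln_int _ _ (fun y => Q y + N * (al 0 * z0 y))); last first.
    move=> x; have := kr_bd0 kr x; rewrite ler_norml => /andP[h1 h2].
    rewrite ger0_norm; last by rewrite opprK -lerBlDr sub0r (le_trans _ h1)// lerN2 ltW.
    by rewrite /Q /al /z0; ring.
  rewrite hp_intD//; last by apply: bfsB; exact: bfsZ.
  rewrite hp_intB//; [|exact: bfsZ|exact: bfsZ].
  rewrite !hp_intZ// ln_intD//; last exact: bfsZ.
  rewrite ln_intZ// -JE -LE -J0E SE.
  by rewrite [leLHS](_ : _ = N * (J + J0) +
    ((\int[leb2]_(z in halfplane) P z + \int[mu]_y Q y) - N ^+ 2 / 2 * L));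
    [rewrite JJ mulr0 add0r|ring].
(* [key] gives [S = N ^+ 2 / 2 * L] for every [N > M]; two values of [N] force [L = 0], hence
   [S = 0]. *)
have S0 : S = 0.
  clear -key kr; have M0 := kr_M_ge0.
  have [|h1 h2] := key (M + 1); first by lra.
  have [|h3 h4] := key (M + 2); first by lra.
  have e1 : S = (M + 1) ^+ 2 / 2 * L by lra.
  have e2 : S = (M + 2) ^+ 2 / 2 * L by lra.
  have : (2 * M + 3) * L = 0.
    by transitivity (2 * ((M + 2) ^+ 2 / 2 * L - (M + 1) ^+ 2 / 2 * L));
      [field|rewrite -e1 -e2; ring].
  move=> /eqP; rewrite mulf_eq0 => /orP[/eqP|/eqP L0]; first by lra.
  by rewrite e1 L0 mulr0.
move: S0; rewrite SE /P hp_intD//; [|exact: bfs_kr|exact: bfs_kr_sq].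
have bl : bfs leb2 (fun z : R * R => kerc e (z.1 - t) * z0 z.2 * a z.1 z.2).
  apply: bfs_kr; apply: (@bfs_prod _ (fun s => kerc e (s - t))).
    exact: bfs_kerc.
  exact: bfs_trapeze.
rewrite (@eq_hp_int _ _ (fun z => -1 * (kerc e (z.1 - t) * z0 z.2 * a z.1 z.2))); last first.
  move=> z; rewrite /halfplane/= => z0'.
  have zr : e <= z.1 - - r by clear -re z0'; lra.
  rewrite /phit (kerc_out e0 (le_trans zr (ler_norm _))).
  by clear; ring.
rewrite hp_intZ//.
rewrite (@eq_hp_int _ (fun z => phix z * _) (fun z => tramp e t z.1 *
   (kerc e (z.2 - x1) - kerc e (z.2 - x2)) * (a z.1 z.2 ^+ 2 / 2))); last first.
  move=> z; rewrite /halfplane/= => z0'; rewrite /phix /tramp z0' /al /trapeze.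
  have zr : e <= z.1 - - r by clear -re z0'; lra.
  by rewrite (kerp_right e0 zr).
rewrite /Q (@eq_ln_int _ _ (fun y => al 0 * (z0 y * a0 y))); last first.
  by move=> y; rewrite mulrA.
rewrite ln_intZ; last by apply: bfs_kr0; exact: bfs_trapeze.
by rewrite al0 /z0; lra.
Qed.

End WeakEquation.

(** * The smoothed potential *)

Section Potential.
Context {R : realType}.
Implicit Types (t x y s k e a b : R).
Local Notation mu := (@lebesgue_measure R).
Local Notation leb2 := (@leb2 R).

Lemma bfs_box a b : bfs mu (\1_`[a, b] : R -> R).
Proof.
apply: bfs_indic; first exact: measurable_itv.
by rewrite /= lebesgue_measure_itv/=; case: ifP => // _; rewrite -EFinB ltry.
Qed.

Lemma int_box a b : a <= b -> \int[mu]_x (\1_`[a, b] x : R) = b - a.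
Proof.
move=> ab; rewrite /Rintegral integral_indic//.
rewrite setIT [X in fine X](_ : _ = (b - a)%:E)//.
rewrite [LHS]lebesgue_measure_itv/= lte_fin.
move: ab; rewrite le_eqVlt => /predU1P[->|->]; last by rewrite -EFinB.
by rewrite ltxx subrr.
Qed.

Lemma in_box_ge0 a b y : 0 <= (\1_`[a, b] y : R).
Proof. by rewrite indicE. Qed.

Lemma in_box a b y : a <= y <= b -> \1_`[a, b] y = 1 :> R.
Proof. by move=> h; rewrite indicE mem_set//= in_itv. Qed.

Lemma le_int_halfline (P : R -> R) : bfs mu P -> (forall s, 0 <= P s) ->
  \int[mu]_(s in `]0, +oo[) P s <= \int[mu]_s P s.
Proof.
move=> bP P0; rewrite Rintegral_mkcond.
apply: (bfs_le_int measurableT) => //.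
  by apply: bfs_restrict => //; exact: measurable_itv.
by move=> s _; rewrite patchE; case: ifP.
Qed.

(** The common form of the estimates on smoothed quantities: [p] and [q] are differences or Taylor
    remainders of kernels, [P] and [Q] majorants of known integral, and [w] is [a] or its flux. *)
Lemma tensor_bound (p q P Q : R -> R) (w : R * R -> R) (C : R) :
  bfs mu p -> bfs mu q -> bfs mu P -> bfs mu Q ->
  (forall s, `|p s| <= P s) -> (forall y, `|q y| <= Q y) ->
  measurable_fun setT w -> (forall z, `|w z| <= C) ->
  `|\int[leb2]_(z in halfplane) (p z.1 * q z.2 * w z)| <=
    (\int[mu]_s P s) * (\int[mu]_y Q y) * C.
Proof.
move=> bp bq bP bQ pP qQ mw wC.
have C0 : 0 <= C by exact: le_trans (normr_ge0 _) (wC (0, 0)).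
have P0 s : 0 <= P s by exact: le_trans (normr_ge0 _) (pP s).
have Q0 s : 0 <= Q s by exact: le_trans (normr_ge0 _) (qQ s).
have bPQ := bfs_prod bP bQ.
have bPQC : bfs leb2 (fun z : R * R => C * (P z.1 * Q z.2)) by exact: bfsZ.
have bpqw : bfs leb2 (fun z : R * R => p z.1 * q z.2 * w z).
  exact: (@bfsM _ _ _ leb2 (fun z : R * R => p z.1 * q z.2) w C (bfs_prod bp bq) mw wC).
apply: (le_trans (hp_norm_int bpqw bPQC _)).
  move=> z _; rewrite mulrC !normrM.
  by rewrite ler_pM// ?mulr_ge0// ler_pM.
rewrite hp_intZ// int_prod// mulrC ler_wpM2r// ler_wpM2r ?le_int_halfline//.
exact: Rintegral_ge0.
Qed.

Lemma line_bound (q Q w : R -> R) (C : R) :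
  bfs mu q -> bfs mu Q -> (forall y, `|q y| <= Q y) ->
  measurable_fun setT w -> (forall z, `|w z| <= C) ->
  `|\int[mu]_y (q y * w y)| <= (\int[mu]_y Q y) * C.
Proof.
move=> bq bQ qQ mw wC.
have C0 : 0 <= C by exact: le_trans (normr_ge0 _) (wC 0).
have bQC : bfs mu (fun z : R => C * Q z) by exact: bfsZ.
have bqw : bfs mu (fun z : R => q z * w z) by exact: (@bfsM _ _ _ mu q w C bq mw wC).
apply: (le_trans (ln_norm_int bqw bQC _)).
  by move=> z; rewrite mulrC normrM ler_pM.
by rewrite ln_intZ// mulrC.
Qed.

(** The plain Lipschitz bound of the kernel is constant in [y] and not integrable; cutting it off to
    the two supports makes it integrable, with total mass [8 / e * |t - s|]. *)
Lemma kerc_box_lip e (e0 : 0 < e) t s y :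
  `|kerc e (y - t) - kerc e (y - s)| <=
  2 / e ^+ 2 * `|t - s| * (\1_`[t - e, t + e] y + \1_`[s - e, s + e] y).
Proof.
have h := kerc_lip e0 (y - t) (y - s).
rewrite (_ : y - t - (y - s) = s - t) in h; last by ring.
rewrite (distrC s t) in h.
have h0 : 0 <= 2 / e ^+ 2 * `|t - s|.
  by rewrite mulr_ge0// divr_ge0// sqr_ge0.
have b1 := in_box_ge0 (t - e) (t + e) y; have b2 := in_box_ge0 (s - e) (s + e) y.
have [ht|ht] := boolP (t - e <= y <= t + e).
  apply: (le_trans h); rewrite (in_box ht).
  by rewrite -[leLHS]mulr1 ler_wpM2l// lerDl.
have [hs|hs] := boolP (s - e <= y <= s + e).
  apply: (le_trans h); rewrite (in_box hs).
  by rewrite -[leLHS]mulr1 ler_wpM2l// lerDr.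
have out r : ~~ (r - e <= y <= r + e) -> kerc e (y - r) = 0.
  move=> hr; apply: kerc_out => //; rewrite leNgt; apply: contra hr.
  by rewrite ltr_norml => /andP[? ?]; lra.
by rewrite (out _ ht) (out _ hs) subrr normr0 mulr_ge0// addr_ge0.
Qed.

(** The same localisation for a Taylor remainder: since [|s - t| <= 1], both flanks of the trapeze
    lie within [1 + e] of [t]. *)
Lemma kerp_box_quad e (e0 : 0 < e) t s y : `|s - t| <= 1 ->
  `|trapeze e t s y - (s - t) * kerc e (y - t)| <=
  2 / e ^+ 2 * (s - t) ^+ 2 * \1_`[t - (1 + e), t + (1 + e)] y.
Proof.
move=> st.
have h0 : 0 <= 2 / e ^+ 2 * (s - t) ^+ 2.
  by rewrite mulr_ge0 ?sqr_ge0// divr_ge0// sqr_ge0.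
have [ht|ht] := boolP (t - (1 + e) <= y <= t + (1 + e)).
  rewrite (in_box ht) mulr1.
  have := kerp_quad e (y - t) (y - s).
  rewrite (_ : y - s - (y - t) = - (s - t)); last by ring.
  rewrite sqrrN => h; rewrite -normrN (le_trans _ h)// le_eqVlt.
  by apply/orP; left; apply/eqP; congr (`| _ |); rewrite /trapeze; ring.
move: st; rewrite ler_norml => /andP[s1 s2].
suff -> : trapeze e t s y - (s - t) * kerc e (y - t) = 0.
  by rewrite normr0 mulr_ge0// in_box_ge0.
have out : e <= `|y - t| /\ (y - t <= - e /\ y - s <= - e \/ e <= y - t /\ e <= y - s).
  move: ht; rewrite negb_and -!ltNge ler_normr => /orP[h|h]; split.
  - by apply/orP; right; lra.
  - by left; lra.
  - by apply/orP; left; lra.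
  - by right; lra.
case: out => out1 [[h1 h2]|[h1 h2]]; rewrite /trapeze (kerc_out e0 out1) mulr0 subr0.
  by rewrite (kerp_left e0 h1) (kerp_left e0 h2) subrr.
by rewrite (kerp_right e0 h1) (kerp_right e0 h2) subrr.
Qed.

Lemma int_kerc_norm_lip e (e0 : 0 < e) t s :
  \int[mu]_y (2 / e ^+ 2 * `|t - s| *
     (\1_`[t - e, t + e] y + \1_`[s - e, s + e] y)) = 8 / e * `|t - s|.
Proof.
rewrite ln_intZ; last by apply: bfsD; exact: bfs_box.
rewrite ln_intD; [|exact: bfs_box|exact: bfs_box].
rewrite !int_box; [|lra|lra].
by field; rewrite gt_eqF.
Qed.

(* The mass of [a0] in [0, x] minus the flux through [x] up to time [t], both
   smoothed at scale [e]. *)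
Definition pot e (a0 : R -> R) (a : R -> R -> R) t x : R :=
  \int[mu]_y (trapeze e 0 x y * a0 y) -
  \int[leb2]_(z in halfplane)
     (tramp e t z.1 * kerc e (z.2 - x) * (a z.1 z.2 ^+ 2 / 2)).

Definition gmol e (a : R -> R -> R) t x : R :=
  \int[leb2]_(z in halfplane)
     (kerc e (z.1 - t) * kerc e (z.2 - x) * (a z.1 z.2 ^+ 2 / 2)).

(* The first term, present only for [t < e], makes up for the part of the
   kernel that lies in [s < 0]. *)
Definition amol e (a0 : R -> R) (a : R -> R -> R) t x : R :=
  kerp e (- t) * \int[mu]_y (kerc e (y - x) * a0 y) +
  \int[leb2]_(z in halfplane)
     (kerc e (z.1 - t) * kerc e (z.2 - x) * a z.1 z.2).

End Potential.

Section PotentialCalculus.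
Context {R : realType}.
Implicit Types (t x y s k e : R).
Local Notation mu := (@lebesgue_measure R).
Local Notation leb2 := (@leb2 R).

Lemma bfs_weighted (p q : R -> R) (w : R * R -> R) (C : R) :
  bfs mu p -> bfs mu q -> measurable_fun setT w -> (forall z, `|w z| <= C) ->
  bfs leb2 (fun z : R * R => p z.1 * q z.2 * w z).
Proof.
by move=> bp bq mw wC; exact: (@bfsM _ _ _ leb2 (fun z : R * R => p z.1 * q z.2) w C (bfs_prod bp bq) mw wC).
Qed.

(** The constant degenerates as [e] tends to 0. This is harmless, because it only serves regularity
    at a fixed [e]. *)
Lemma mol_lip e (e0 : 0 < e) (w : R * R -> R) (C : R) t x s y :
  measurable_fun setT w -> (forall z, `|w z| <= C) ->
  `|\int[leb2]_(z in halfplane) (kerc e (z.1 - t) * kerc e (z.2 - x) * w z) -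
    \int[leb2]_(z in halfplane) (kerc e (z.1 - s) * kerc e (z.2 - y) * w z)| <=
  8 / e * C * `|t - s| + 8 / e * C * `|x - y|.
Proof.
move=> mw wC.
pose m t' x' := \int[leb2]_(z in halfplane) (kerc e (z.1 - t') * kerc e (z.2 - x') * w z).
have bm t' x' : bfs leb2 (fun z : R * R => kerc e (z.1 - t') * kerc e (z.2 - x') * w z).
  by apply: (@bfs_weighted (fun s => kerc e (s - t')) (fun y => kerc e (y - x')) _ C) => //;
    exact: bfs_kerc.
rewrite -!/(m _ _) (_ : m t x - m s y = (m t x - m s x) + (m s x - m s y)); last by ring.
rewrite (le_trans (ler_normD _ _))// lerD//.
  rewrite /m -hp_intB// (@eq_hp_int _ _ (fun z => (kerc e (z.1 - t) - kerc e (z.1 - s)) *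
    kerc e (z.2 - x) * w z)); last by move=> z _; ring.
  rewrite [leRHS](_ : _ = 8 / e * `|t - s| * 1 * C); last by ring.
  rewrite -(int_kerc_norm_lip e0 t s) -[X in _ * X * C](int_kerc e0 x).
  apply: (@tensor_bound _ (fun r => kerc e (r - t) - kerc e (r - s))
    (fun r => kerc e (r - x))) => //.
  - exact: bfs_kerc2.
  - exact: bfs_kerc.
  - by apply: bfsZ; apply: bfsD; exact: bfs_box.
  - exact: bfs_kerc.
  - by move=> r; exact: kerc_box_lip.
  - by move=> r; rewrite ger0_norm// kerc_ge0.
rewrite /m -hp_intB// (@eq_hp_int _ _ (fun z => kerc e (z.1 - s) *
    (kerc e (z.2 - x) - kerc e (z.2 - y)) * w z)); last by move=> z _; ring.
rewrite [leRHS](_ : _ = 1 * (8 / e * `|x - y|) * C); last by ring.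
rewrite -(int_kerc_norm_lip e0 x y) -[X in X * _ * C](int_kerc e0 s).
apply: (@tensor_bound _ (fun r => kerc e (r - s))
    (fun r => kerc e (r - x) - kerc e (r - y))) => //.
- exact: bfs_kerc.
- exact: bfs_kerc2.
- exact: bfs_kerc.
- by apply: bfsZ; apply: bfsD; exact: bfs_box.
- by move=> r; rewrite ger0_norm// kerc_ge0.
- by move=> r; exact: kerc_box_lip.
Qed.

Section kr.
Variables (M : R) (a0 : R -> R) (a : R -> R -> R).

Lemma gmol_le e t x : kruzhkov M a0 a -> 0 < e -> `|gmol e a t x| <= M ^+ 2 / 2.
Proof.
move=> kr e0.
have := @tensor_bound _ (fun r => kerc e (r - t)) (fun r => kerc e (r - x))
    (fun r => kerc e (r - t)) (fun r => kerc e (r - x))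
    (fun z : R * R => a z.1 z.2 ^+ 2 / 2) (M ^+ 2 / 2).
rewrite !int_kerc// !mul1r; apply; do ?exact: bfs_kerc.
- by move=> r; rewrite ger0_norm// kerc_ge0.
- by move=> r; rewrite ger0_norm// kerc_ge0.
- exact: measurable_kr_sq kr.
- by move=> z; exact: kr_sq_le kr _ _.
Qed.

Lemma gmol_lip e t x s y : kruzhkov M a0 a -> 0 < e ->
  `|gmol e a t x - gmol e a s y| <=
  8 / e * (M ^+ 2 / 2) * `|t - s| + 8 / e * (M ^+ 2 / 2) * `|x - y|.
Proof.
move=> kr e0; apply: (mol_lip e0); first exact: measurable_kr_sq kr.
by move=> z; exact: kr_sq_le kr _ _.
Qed.

Lemma amol_initial_le e x : kruzhkov M a0 a -> 0 < e ->
  `|\int[mu]_y (kerc e (y - x) * a0 y)| <= M.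
Proof.
move=> kr e0.
have := @line_bound _ (fun r => kerc e (r - x)) (fun r => kerc e (r - x)) a0 M.
rewrite !int_kerc// !mul1r; apply; do ?exact: bfs_kerc.
- by move=> r; rewrite ger0_norm// kerc_ge0.
- exact: kr_meas0 kr.
- exact: kr_bd0 kr.
Qed.

Lemma amol_le e t x : kruzhkov M a0 a -> 0 < e -> `|amol e a0 a t x| <= 2 * M.
Proof.
move=> kr e0; rewrite mulrDl mul1r (le_trans (ler_normD _ _))// lerD//.
  have /andP[h1 h2] := kerp_itv e (- t).
  rewrite normrM (ger0_norm h1) -[leRHS]mul1r ler_pM//.
  exact: amol_initial_le.
have := @tensor_bound _ (fun r => kerc e (r - t)) (fun r => kerc e (r - x))
    (fun r => kerc e (r - t)) (fun r => kerc e (r - x))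
    (fun z : R * R => a z.1 z.2) M.
rewrite !int_kerc// !mul1r; apply; do ?exact: bfs_kerc.
- by move=> r; rewrite ger0_norm// kerc_ge0.
- by move=> r; rewrite ger0_norm// kerc_ge0.
- exact: kr_meas kr.
- by move=> z; exact: kr_bd kr _ _.
Qed.

Lemma amol_lip e t x s y : kruzhkov M a0 a -> 0 < e ->
  `|amol e a0 a t x - amol e a0 a s y| <=
  16 / e * M * `|t - s| + 16 / e * M * `|x - y|.
Proof.
move=> kr e0; have M0 := kr_M_ge0 kr.
have h := @mol_lip e e0 (fun z : R * R => a z.1 z.2) M t x s y (kr_meas kr)
  (fun z => kr_bd kr z.1 z.2).
pose I r := \int[mu]_y (kerc e (y - r) * a0 y).
have hI r r' : `|I r - I r'| <= 8 / e * M * `|r - r'|.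
  have bI r1 : bfs mu (fun y => kerc e (y - r1) * a0 y).
    by apply: (bfs_kr0 kr); exact: bfs_kerc.
  rewrite /I -ln_intB// (@eq_ln_int _ _ (fun y => (kerc e (y - r) - kerc e (y - r')) * a0 y));
    last by move=> y'; ring.
  rewrite mulrAC -(int_kerc_norm_lip e0 r r').
  apply: (@line_bound _ (fun y => kerc e (y - r) - kerc e (y - r'))).
  - exact: bfs_kerc2.
  - by apply: bfsZ; apply: bfsD; exact: bfs_box.
  - by move=> r1; exact: kerc_box_lip.
  - exact: kr_meas0 kr.
  - exact: kr_bd0 kr.
rewrite /amol -!/(I _).
set m1 := Rintegral _ _ _ in h *; set m2 := Rintegral _ _ _ in h *.
rewrite (_ : _ - _ = (kerp e (- t) - kerp e (- s)) * I x + kerp e (- s) * (I x - I y) +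
  (m1 - m2)); last by ring.
have h1 : `|(kerp e (- t) - kerp e (- s)) * I x| <= 1 / e * M * `|t - s|.
  rewrite normrM mulrAC ler_pM//; last exact: amol_initial_le.
  have := kerp_lip e0 (- t) (- s).
  by rewrite (_ : - t - - s = s - t) ?(distrC s t) ?mul1r//; ring.
have h2 : `|kerp e (- s) * (I x - I y)| <= 8 / e * M * `|x - y|.
  have /andP[k1 k2] := kerp_itv e (- s).
  by rewrite normrM (ger0_norm k1) -[leRHS]mul1r ler_pM.
have n1 : 0 <= M / e * `|t - s| by rewrite mulr_ge0// divr_ge0// ltW.
have n2 : 0 <= M / e * `|x - y| by rewrite mulr_ge0// divr_ge0// ltW.
apply: (le_trans (ler_normD _ _)); apply: (le_trans (lerD (ler_normD _ _) h)).
apply: (le_trans (lerD (lerD h1 h2) (lexx _))).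
rewrite -subr_ge0 (_ : _ - _ = 7 * (M / e * `|t - s|)); last by ring.
by rewrite mulr_ge0.
Qed.

End kr.
End PotentialCalculus.

Section PotentialDerivatives.
Context {R : realType}.
Implicit Types (t x y s k e : R).
Local Notation mu := (@lebesgue_measure R).
Local Notation leb2 := (@leb2 R).
Variables (M : R) (a0 : R -> R) (a : R -> R -> R).

Lemma pot_dt e t x : kruzhkov M a0 a -> 0 < e ->
  is_derive t 1 ((pot e a0 a)^~ x) (- gmol e a t x).
Proof.
move=> kr e0.
have bg p : bfs mu p -> bfs leb2 (fun z : R * R =>
    p z.1 * kerc e (z.2 - x) * (a z.1 z.2 ^+ 2 / 2)).
  move=> bp; apply: (@bfs_weighted _ p (fun y => kerc e (y - x))
    (fun z => a z.1 z.2 ^+ 2 / 2) (M ^+ 2 / 2)) => //.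
  - exact: bfs_kerc.
  - exact: measurable_kr_sq kr.
  - by move=> z; exact: kr_sq_le kr _ _.
apply: (@is_derive_quad _ _ _ _ (2 / e ^+ 2 * (2 * (1 + e)) * (M ^+ 2 / 2))) => s st.
rewrite /pot /gmol.
rewrite (_ : _ - _ - _ = - (
   (\int[leb2]_(z in halfplane) (tramp e s z.1 * kerc e (z.2 - x) * (a z.1 z.2 ^+ 2 / 2))
   - \int[leb2]_(z in halfplane) (tramp e t z.1 * kerc e (z.2 - x) * (a z.1 z.2 ^+ 2 / 2)))
   - (s - t) * \int[leb2]_(z in halfplane)
      (kerc e (z.1 - t) * kerc e (z.2 - x) * (a z.1 z.2 ^+ 2 / 2)))); last by ring.
have b1 := bg _ (bfs_tramp e0 t); have b2 := bg _ (bfs_tramp e0 s).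
have b3 := bg _ (bfs_kerc e0 t).
rewrite normrN -hp_intB// -hp_intZ// -hp_intB//; [|exact: bfsB|exact: bfsZ].
rewrite (@eq_hp_int _ _ (fun z => (trapeze e t s z.1 - (s - t) * kerc e (z.1 - t)) *
   kerc e (z.2 - x) * (a z.1 z.2 ^+ 2 / 2))); last first.
  by move=> z; rewrite /halfplane/= /tramp /trapeze => ->; ring.
rewrite [leRHS](_ : _ =
  (\int[mu]_r (2 / e ^+ 2 * (s - t) ^+ 2 * \1_`[t - (1 + e), t + (1 + e)] r)) *
  (\int[mu]_y kerc e (y - x)) * (M ^+ 2 / 2)); last first.
  rewrite int_kerc// ln_intZ; last exact: bfs_box.
  rewrite int_box; last by lra.
  by ring.
apply: (@tensor_bound _ (fun r => trapeze e t s r - (s - t) * kerc e (r - t))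
    (fun r => kerc e (r - x)) _ _ (fun z => a z.1 z.2 ^+ 2 / 2)).
- by apply: bfsB; [exact: bfs_trapeze|apply: bfsZ; exact: bfs_kerc].
- exact: bfs_kerc.
- by apply: bfsZ; exact: bfs_box.
- exact: bfs_kerc.
- by move=> r; exact: kerp_box_quad.
- by move=> r; rewrite ger0_norm// kerc_ge0.
- exact: measurable_kr_sq kr.
- by move=> z; exact: kr_sq_le kr _ _.
Qed.

(** This is where conservation enters: by [weak_equation], the initial mass between [x] and [x']
    minus the net outflow is the smoothed mass at time [t]. Hence the function defined through the
    flux across [x] is also a primitive in [x]. *)
Lemma pot_diff e t x x' : kruzhkov M a0 a -> 0 < e ->
  pot e a0 a t x' - pot e a0 a t x =
  kerp e (- t) * \int[mu]_y (trapeze e x x' y * a0 y) +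
  \int[leb2]_(z in halfplane) (kerc e (z.1 - t) * trapeze e x x' z.2 * a z.1 z.2).
Proof.
move=> kr e0.
have anti y1 y2 y : trapeze e y1 y2 y = - 1 * trapeze e y2 y1 y.
  by rewrite /trapeze; ring.
have b0 y1 y2 : bfs mu (fun y => trapeze e y1 y2 y * a0 y).
  by apply: (bfs_kr0 kr); exact: bfs_trapeze.
have ba y1 y2 : bfs leb2 (fun z : R * R =>
    kerc e (z.1 - t) * trapeze e y1 y2 z.2 * a z.1 z.2).
  apply: (@bfs_weighted _ (fun r => kerc e (r - t)) _ (fun z => a z.1 z.2) M).
  - exact: bfs_kerc.
  - exact: bfs_trapeze.
  - exact: kr_meas kr.
  - by move=> z; exact: kr_bd kr _ _.
(* The weak equation needs an ordered pair, since its test function must be nonnegative; both sides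
   here are antisymmetric in [x] and [x']. *)
wlog xx : x x' / x <= x'.
  move=> W; case: (leP x x') => [/W//|/ltW /W] h.
  rewrite -opprB h.
  rewrite (@eq_ln_int _ (fun y => trapeze e x x' y * a0 y)
    (fun y => -1 * (trapeze e x' x y * a0 y))); last first.
    by move=> y; rewrite anti mulrA.
  rewrite ln_intZ//.
  rewrite (@eq_hp_int _ (fun z => kerc e (z.1 - t) * trapeze e x x' z.2 * a z.1 z.2)
    (fun z => -1 * (kerc e (z.1 - t) * trapeze e x' x z.2 * a z.1 z.2))); last first.
    by move=> z _; rewrite [in LHS]anti; ring.
  by rewrite hp_intZ//; ring.
rewrite (weak_equation kr e0 t xx) /pot.
have bg y : bfs leb2 (fun z : R * R =>
    tramp e t z.1 * kerc e (z.2 - y) * (a z.1 z.2 ^+ 2 / 2)).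
  apply: (@bfs_weighted _ _ (fun r => kerc e (r - y))
    (fun z => a z.1 z.2 ^+ 2 / 2) (M ^+ 2 / 2)).
  - exact: bfs_tramp.
  - exact: bfs_kerc.
  - exact: measurable_kr_sq kr.
  - by move=> z; exact: kr_sq_le kr _ _.
rewrite (_ : \int[leb2]_(z in halfplane) (tramp e t z.1 *
    (kerc e (z.2 - x) - kerc e (z.2 - x')) * (a z.1 z.2 ^+ 2 / 2)) =
  \int[leb2]_(z in halfplane) (tramp e t z.1 * kerc e (z.2 - x) * (a z.1 z.2 ^+ 2 / 2)) -
  \int[leb2]_(z in halfplane) (tramp e t z.1 * kerc e (z.2 - x') * (a z.1 z.2 ^+ 2 / 2)));
  last by rewrite -hp_intB//; apply: eq_hp_int => z _; ring.
rewrite (_ : \int[mu]_y (trapeze e x x' y * a0 y) =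
  \int[mu]_y (trapeze e 0 x' y * a0 y) - \int[mu]_y (trapeze e 0 x y * a0 y)); last first.
  by rewrite -ln_intB//; apply: eq_ln_int => y; rewrite /trapeze; ring.
by ring.
Qed.

Lemma pot_dx e t x : kruzhkov M a0 a -> 0 < e ->
  is_derive x 1 (pot e a0 a t) (amol e a0 a t x).
Proof.
move=> kr e0; have M0 := kr_M_ge0 kr.
apply: (@is_derive_quad _ _ _ _ (2 / e ^+ 2 * (2 * (1 + e)) * M +
  2 / e ^+ 2 * (2 * (1 + e)) * M)) => x' xx.
rewrite pot_diff// /amol.
have b0 q : bfs mu q -> bfs mu (fun y => q y * a0 y) by exact: (bfs_kr0 kr).
have ba q : bfs mu q -> bfs leb2 (fun z : R * R =>
    kerc e (z.1 - t) * q z.2 * a z.1 z.2).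
  move=> bq; apply: (@bfs_weighted _ (fun r => kerc e (r - t)) _ (fun z => a z.1 z.2) M).
  - exact: bfs_kerc.
  - exact: bq.
  - exact: kr_meas kr.
  - by move=> z; exact: kr_bd kr _ _.
rewrite (_ : _ + _ - _ =
  kerp e (- t) * (\int[mu]_y (trapeze e x x' y * a0 y) -
    (x' - x) * \int[mu]_y (kerc e (y - x) * a0 y)) +
  (\int[leb2]_(z in halfplane) (kerc e (z.1 - t) * trapeze e x x' z.2 * a z.1 z.2) -
   (x' - x) * \int[leb2]_(z in halfplane)
     (kerc e (z.1 - t) * kerc e (z.2 - x) * a z.1 z.2))); last by ring.
have c1 := bfs_trapeze e0 x x'; have c2 := bfs_kerc e0 x.
have d1 := ba _ c1; have d2 := ba _ c2.
have d3 := b0 _ c1; have d4 := b0 _ c2.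
rewrite -ln_intZ// -ln_intB//; last exact: bfsZ.
rewrite -hp_intZ// -hp_intB//; last exact: bfsZ.
have cc : bfs mu (fun y => trapeze e x x' y - (x' - x) * kerc e (y - x)).
  by apply: bfsB => //; exact: bfsZ.
have bb : bfs mu (fun y => 2 / e ^+ 2 * (x' - x) ^+ 2 *
    (\1_`[x - (1 + e), x + (1 + e)] y : R)) by apply: bfsZ; exact: bfs_box.
have ib : \int[mu]_y (2 / e ^+ 2 * (x' - x) ^+ 2 * \1_`[x - (1 + e), x + (1 + e)] y) =
    2 / e ^+ 2 * (x' - x) ^+ 2 * (2 * (1 + e)).
  rewrite ln_intZ; last exact: bfs_box.
  by rewrite int_box; [ring|lra].
rewrite (le_trans (ler_normD _ _))// [leRHS]mulrDl lerD//.
  have /andP[k1 k2] := kerp_itv e (- t).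
  rewrite normrM (ger0_norm k1) -[leRHS]mul1r ler_pM//.
  rewrite (@eq_ln_int _ _ (fun y => (trapeze e x x' y - (x' - x) * kerc e (y - x)) * a0 y));
    last by move=> y; ring.
  rewrite [leRHS](_ : _ = 2 / e ^+ 2 * (x' - x) ^+ 2 * (2 * (1 + e)) * M); last by ring.
  rewrite -ib; apply: line_bound => //.
  - by move=> r; exact: kerp_box_quad.
  - exact: kr_meas0 kr.
  - exact: kr_bd0 kr.
rewrite (@eq_hp_int _ _ (fun z => kerc e (z.1 - t) *
  (trapeze e x x' z.2 - (x' - x) * kerc e (z.2 - x)) * a z.1 z.2)); last first.
  by move=> z _; ring.
rewrite [leRHS](_ : _ = 1 * (2 / e ^+ 2 * (x' - x) ^+ 2 * (2 * (1 + e))) * M); last by ring.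
rewrite -ib -[X in X * _ * M](int_kerc e0 t).
apply: (@tensor_bound _ (fun r => kerc e (r - t))
    (fun y => trapeze e x x' y - (x' - x) * kerc e (y - x)) _ _
    (fun z => a z.1 z.2)) => //.
- exact: bfs_kerc.
- exact: bfs_kerc.
- by move=> r; rewrite ger0_norm// kerc_ge0.
- by move=> r; exact: kerp_box_quad.
- exact: kr_meas kr.
- by move=> z; exact: kr_bd kr _ _.
Qed.

(** The derivatives are averages of bounded functions, so these constants are independent of [e], in
    contrast to those for [gmol] and [amol]. The factor 2 comes from bounding the two terms of
    [amol] separately. *)
Lemma pot_lip e t x s y : kruzhkov M a0 a -> 0 < e ->
  `|pot e a0 a t x - pot e a0 a s y| <= M ^+ 2 / 2 * `|t - s| + 2 * M * `|x - y|.
Proof.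
move=> kr e0.
rewrite (_ : _ - _ = (pot e a0 a t x - pot e a0 a s x) +
  (pot e a0 a s x - pot e a0 a s y)); last by ring.
rewrite (le_trans (ler_normD _ _))// lerD//.
  apply: (bounded_derive_lipschitz (fun r => pot_dt r x kr e0)) => r.
  by rewrite normrN; exact: gmol_le kr e0.
apply: (bounded_derive_lipschitz (fun r => pot_dx s r kr e0)) => r.
exact: amol_le.
Qed.

(** The limit of [trapeze e a b] as [e] tends to 0. As a difference of two half-line indicators it
    satisfies [step a b + step b c = step a c] whatever the order of the points. *)
Definition step a b y : R := (a <= y)%R%:R - (b <= y)%R%:R.

(* The integral of [f] from [0] to [x], signed when [x < 0]. *)
Definition prim (f : R -> R) x : R := \int[mu]_y (step 0 x y * f y).

Lemma bfs_step a' b : bfs mu (step a' b).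
Proof.
apply: (@bfs_itv _ _ 1 (- (`|a'| + `|b|)) (`|a'| + `|b|)).
- have h c : measurable_fun setT (fun y : R => (c <= y)%R%:R : R).
    rewrite (_ : (fun y => _) = \1_`[c, +oo[); first by apply: measurable_indic; exact: measurable_itv.
    by apply/funext => y; rewrite indicE mem_setE in_itv/= andbT.
  exact: measurable_funB.
- by move=> y; rewrite /step; rewrite ler_norml; case: (a' <= y); case: (b <= y) => /=; lra.
- have ha := ler_norm a'; have hb := ler_norm b.
  have ha' := ler_norm (- a'); have hb' := ler_norm (- b); rewrite !normrN in ha' hb'.
  have na := normr_ge0 a'; have nb := normr_ge0 b.
  move=> y; rewrite negb_and -!ltNge /step => /orP[h|h].
    have ya : y < a' by lra.
    have yb : y < b by lra.
    by rewrite !leNgt ya yb subrr.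
  have ya : a' <= y by lra.
  have yb : b <= y by lra.
  by rewrite ya yb subrr.
Qed.

Lemma trapeze_step e x1 x2 y : 0 < e -> `|trapeze e x1 x2 y - step x1 x2 y| <=
  \1_`[x1 - e, x1 + e] y + \1_`[x2 - e, x2 + e] y.
Proof.
move=> e0.
have h x : `|kerp e (y - x) - (x <= y)%R%:R| <= \1_`[x - e, x + e] y.
  have [hx|] := boolP (x - e <= y <= x + e).
    rewrite (in_box hx) ler_norml; have := kerp_itv e (y - x).
    by case: (x <= y) => /= /andP[k1 k2]; apply/andP; split; lra.
  rewrite negb_and -!ltNge => /orP[hx|hx].
    rewrite kerp_left//; last by lra.
    have yx : y < x by lra.
    by rewrite (leNgt x y) yx subrr normr0 in_box_ge0.
  rewrite kerp_right//; last by lra.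
  have yx : x <= y by lra.
  by rewrite yx subrr normr0 in_box_ge0.
rewrite /trapeze /step (_ : _ - _ - _ = (kerp e (y - x1) - (x1 <= y)%R%:R) -
  (kerp e (y - x2) - (x2 <= y)%R%:R)); last by ring.
by rewrite (le_trans (ler_normB _ _))// lerD.
Qed.

(** At time [- e] the smoothed time indicator has ended before [s = 0], so the flux term disappears;
    the initial data are read there and not at time 0. The two flanks of the trapeze, each of width
    [2 * e], give [4 * e * M]. *)
Lemma pot_initial e x : kruzhkov M a0 a -> 0 < e ->
  `|pot e a0 a (- e) x - prim a0 x| <= 4 * e * M.
Proof.
move=> kr e0.
have -> : pot e a0 a (- e) x = \int[mu]_y (trapeze e 0 x y * a0 y).
  rewrite /pot (@eq_hp_int _ _ (fun z => 0 * 0)); last first.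
    move=> z; rewrite /halfplane/= => z0; rewrite /tramp z0 kerp_right//; last by lra.
    by ring.
  by rewrite mul0r Rintegral_cst ?mul0r ?subr0//; exact: measurable_halfplane.
rewrite /prim -ln_intB; [|exact/(bfs_kr0 kr)/bfs_trapeze|exact/(bfs_kr0 kr)/bfs_step].
rewrite (@eq_ln_int _ _ (fun y => (trapeze e 0 x y - step 0 x y) * a0 y)); last first.
  by move=> y; ring.
rewrite [leRHS](_ : _ = (\int[mu]_y (\1_`[0 - e, 0 + e] y + \1_`[x - e, x + e] y)) * M);
  last first.
  rewrite ln_intD; [|exact: bfs_box|exact: bfs_box].
  by rewrite !int_box; [ring|lra|lra].
apply: line_bound.
- by apply: bfsB; [exact: bfs_trapeze|exact: bfs_step].
- by apply: bfsD; exact: bfs_box.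
- by move=> y; exact: trapeze_step.
- exact: kr_meas0 kr.
- exact: kr_bd0 kr.
Qed.

End PotentialDerivatives.

(** * Convergence of mollifications in L^1 *)

Section Modulus.
Context {R : realType}.
Implicit Types (t x y s k e B : R).
Local Notation mu := (@lebesgue_measure R).
Local Notation leb2 := (@leb2 R).

Definition inv_succ (n : nat) : R := n.+1%:R^-1.

Lemma inv_succ_gt0 n : 0 < inv_succ n.
Proof. by rewrite invr_gt0. Qed.

Lemma cvg_inv_succ : inv_succ n @[n --> \oo] --> 0.
Proof. exact: cvg_harmonic. Qed.

Lemma measurable_kerc_sub d (T : measurableType d) e (p q : T -> R) : 0 < e ->
  measurable_fun setT p -> measurable_fun setT q ->
  measurable_fun setT (fun w => kerc e (p w - q w)).
Proof.
move=> e0 mp mq; apply: (@measurableT_comp _ _ _ _ _ _ (kerc e)).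
  by apply: continuous_measurable_fun; exact: kerc_cont.
exact: measurable_funB.
Qed.

Definition seg B : set R := `[- B, B]%classic.

Lemma measurable_seg B : measurable (seg B).
Proof. exact: measurable_itv. Qed.

Lemma seg_fin B : (mu (seg B) < +oo)%E.
Proof.
by rewrite /seg lebesgue_measure_itv/=; case: ifP => // _; rewrite -EFinB ltry.
Qed.

Section one_dim.
Variables (h : R -> R) (C : R).
Hypotheses (mh : measurable_fun setT h) (hC : forall x, `|h x| <= C).

Definition osc e x : \bar R := (\int[mu]_y (kerc e (y - x) * `|h y - h x|)%:E)%E.

Lemma osc_ge0 e x : 0 < e -> (0 <= osc e x)%E.
Proof.
by move=> e0; apply: integral_ge0 => y _; rewrite lee_fin mulr_ge0// kerc_ge0.
Qed.

Lemma measurable_osc e : 0 < e -> measurable_fun setT (osc e).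
Proof.
move=> e0.
pose F (w : R * R) := (kerc e (w.2 - w.1) * `|h w.2 - h w.1|)%:E.
have mF : measurable_fun setT F.
  apply/measurable_EFinP; apply: measurable_funM; first exact: measurable_kerc_sub.
  by apply: measurableT_comp => //; apply: measurable_funB; apply: measurableT_comp.
have F0 w : (0 <= F w)%E by rewrite lee_fin mulr_ge0// kerc_ge0.
exact: (@measurable_fun_fubini_tonelli_F _ _ _ _ _ mu F mF F0).
Qed.

Lemma osc_le e x : 0 < e -> (osc e x <= (2 * C)%:E)%E.
Proof.
move=> e0; apply: (@le_trans _ _ (\int[mu]_y ((2 * C)%:E * (kerc e (y - x))%:E))%E).
  apply: ge0_le_integral => //.
  - by move=> y _; rewrite lee_fin mulr_ge0// kerc_ge0.
  - apply/measurable_EFinP; apply: measurable_funM; first exact: measurable_kerc.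
    by apply: measurableT_comp => //; apply: measurable_funB.
  - by apply/measurable_EFinP; apply: measurable_funM => //; exact: measurable_kerc.
  - move=> y _; rewrite -EFinM lee_fin mulrC ler_wpM2r ?kerc_ge0//.
    by rewrite mulrDl mul1r (le_trans (ler_normB _ _))// lerD.
rewrite integralZl//; last by apply: bfs_integrable => //; exact: bfs_kerc.
rewrite bfs_EFin_int//; last exact: bfs_kerc.
by rewrite int_kerc// mule1.
Qed.

(** The kernel is at most [1 / e] on a ball of measure [2 * e], so [osc] is at most twice the
    averaged oscillation, which tends to 0 at each Lebesgue point. *)
Lemma cvg_osc_ae : {ae mu, forall x, osc (inv_succ n) x @[n --> \oo] --> 0%E}.
Proof.
have lh : locally_integrable setT h.
  split => //; first exact: openT.
  move=> K _ cK; have mK := compact_measurable cK.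
  apply: (@le_lt_trans _ _ (\int[mu]_(x in K) (cst C%:E x))%E).
    apply: ge0_le_integral => //.
    - apply/measurable_EFinP; apply: measurableT_comp => //.
      by apply: measurable_funTS.
    - by move=> x _; rewrite lee_fin.
  rewrite integral_cst//; have := compact_finite_measure cK.
  by move=> ?; apply: lte_mul_pinfty => //; rewrite lee_fin (le_trans _ (hC 0)).
have [N [mN N0 sN]] := lebesgue_differentiation lh.
exists N; split => //; apply: subset_trans sN => x; apply: contra_not => hx.
have cd : davg h x (inv_succ n) @[n --> \oo] --> 0%E.
  apply: (@cvg_comp _ _ _ inv_succ (davg h x) \oo (0^'+)) => // A hA.
  have hn : \forall n \near \oo, 0 < inv_succ n -> A (inv_succ n) := cvg_inv_succ hA.
  by change (\forall n \near \oo, A (inv_succ n)); apply: filterS hn => n; apply;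
    exact: inv_succ_gt0.
have cv : (2%:E * davg h x (inv_succ n))%E @[n --> \oo] --> 0%E.
  by rewrite -[X in _ --> X](mule0 2%:E); exact: cvgeZl cd.
apply: (squeeze_cvge _ (cvg_cst 0%E) cv).
near=> n; rewrite osc_ge0 ?inv_succ_gt0//=.
set e := inv_succ n; have e0 : 0 < e := inv_succ_gt0 n.
have mb := measurable_ball x e.
have mhx : measurable_fun (ball x e) (fun y => h y - h x).
  by apply: measurable_funTS; exact: measurable_funB.
have -> : (2%:E * davg h x e = \int[mu]_(y in ball x e) (e^-1 * `|h y - h x|)%:E)%E.
  rewrite /davg /iavg lebesgue_measure_ball; last exact: ltW.
  under [RHS]eq_integral do rewrite EFinM.
  rewrite ge0_integralZl//; last 2 first.
  - by apply/measurable_EFinP; exact: measurableT_comp.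
  - by rewrite lee_fin invr_ge0 ltW.
  rewrite muleA; congr (_ * _)%E.
  rewrite inver mulrn_eq0/= gt_eqF//= -EFinM; congr EFin.
  by field; rewrite gt_eqF.
rewrite [leRHS]integral_mkcond; apply: ge0_le_integral => //.
- by move=> y _; rewrite lee_fin mulr_ge0// kerc_ge0.
- apply/measurable_EFinP; apply: measurable_funM; first exact: measurable_kerc.
  by apply: measurableT_comp => //; apply: measurable_funB.
- have mE : measurable_fun (ball x e) (fun y => (e^-1 * `|h y - h x|)%:E).
    apply/measurable_EFinP; apply: measurable_funM; first exact: measurable_cst.
    exact: measurableT_comp.
  exact: (measurable_restrictT _ mb).1 mE.
- move=> y _; rewrite patchE; case: ifPn.
    by move=> _; rewrite lee_fin ler_wpM2r// kerc_le.
  rewrite notin_setE /ball/= => /negP; rewrite -leNgt distrC => ey.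
  by rewrite (kerc_out e0 ey) mul0r.
Unshelve. all: by end_near. Qed.

Lemma cvg_int_osc B :
  (\int[mu]_(x in seg B) osc (inv_succ n) x)%E @[n --> \oo] --> 0%E.
Proof.
have [N [mN N0 sN]] := cvg_osc_ae.
have := @dominated_convergence _ _ R mu (seg B) (measurable_seg _)
  (fun n => osc (inv_succ n)) (cst 0%E) (cst (2 * C)%:E).
case.
- by move=> n; apply: measurable_funTS; apply: measurable_osc; exact: inv_succ_gt0.
- exact: measurable_cst.
- by exists N; split => //; apply: subset_trans sN => x; apply: contra_not => + _.
- apply/integrableP; split; first exact: measurable_cst.
  rewrite integral_cst/=; last exact: measurable_seg.
  by apply: lte_mul_pinfty => //; exact: seg_fin.
- apply: aeW => x n _; rewrite gee0_abs; first exact/osc_le/inv_succ_gt0.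
  exact/osc_ge0/inv_succ_gt0.
by move=> _ _; rewrite integral0.
Qed.

End one_dim.

Section two_dim.
Variables (f : R * R -> R) (C : R).
Hypotheses (mf : measurable_fun setT f) (fC : forall z, `|f z| <= C).

Lemma measurable_section s : measurable_fun setT (fun y => f (s, y)).
Proof. by apply: measurableT_comp => //; exact: pair1_measurable. Qed.

(** Oscillation in the second variable only. One such term for each variable controls the
    oscillation in the plane, which reduces the convergence to Lebesgue differentiation on the
    line. *)
Definition osc2 e (z : R * R) : \bar R := osc (fun y => f (z.1, y)) e z.2.

Lemma osc2_ge0 e z : 0 < e -> (0 <= osc2 e z)%E.
Proof. exact: osc_ge0. Qed.

Lemma measurable_osc2 e : 0 < e -> measurable_fun setT (osc2 e).
Proof.
move=> e0.
pose F (w : R * R * R) := (kerc e (w.2 - w.1.2) * `|f (w.1.1, w.2) - f w.1|)%:E.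
have mF : measurable_fun setT F.
  apply/measurable_EFinP; apply: measurable_funM.
    by apply: measurable_kerc_sub => //; exact: measurableT_comp.
  apply: measurableT_comp => //; apply: measurable_funB; apply: measurableT_comp => //.
  by apply: measurable_fun_pair => //; exact: measurableT_comp.
have F0 w : (0 <= F w)%E by rewrite lee_fin mulr_ge0// kerc_ge0.
have := @measurable_fun_fubini_tonelli_F _ _ _ _ _ mu F mF F0.
by congr (measurable_fun _ _); apply/funext => -[s x].
Qed.

Lemma osc2_le e z : 0 < e -> (osc2 e z <= (2 * C)%:E)%E.
Proof.
by move=> e0; apply: osc_le => //; exact: measurable_section.
Qed.

Lemma cvg_int_osc2 A B :
  (\int[mu]_(s in seg A) \int[mu]_(x in seg B) osc2 (inv_succ n) (s, x))%E
    @[n --> \oo] --> 0%E.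
Proof.
have fin := seg_fin.
have C0 : 0 <= 2 * C by rewrite mulr_ge0// (le_trans _ (fC (0, 0))).
have [K KE] : exists K, K%:E = ((2 * C)%:E * mu (seg B))%E.
  by exists (2 * C * fine (mu (seg B))); rewrite EFinM fineK// ge0_fin_numE.
have i0 n s : (0 <= \int[mu]_(x in seg B) osc2 (inv_succ n) (s, x))%E.
  by apply: integral_ge0 => x _; exact/osc2_ge0/inv_succ_gt0.
have := @dominated_convergence _ _ R mu (seg A) (measurable_seg _)
  (fun n s => \int[mu]_(x in seg B) osc2 (inv_succ n) (s, x))%E
  (cst 0%E) (cst K%:E).
case.
- move=> n; apply: measurable_funTS.
  pose F (z : R * R) := (osc2 (inv_succ n) z * (\1_(seg B) z.2)%:E)%E.
  have mF : measurable_fun setT F.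
    apply: emeasurable_funM; first exact: (measurable_osc2 (inv_succ_gt0 n)).
    have mi : measurable_fun setT (\1_(seg B) : R -> R).
      by apply: measurable_indic; exact: measurable_seg.
    by apply/measurable_EFinP; exact: measurableT_comp mi _.
  have F0 w : (0 <= F w)%E.
    by rewrite mule_ge0// ?lee_fin// osc2_ge0// inv_succ_gt0.
  have := @measurable_fun_fubini_tonelli_F _ _ _ _ _ mu F mF F0.
  congr (measurable_fun _ _); apply/funext => s.
  rewrite [RHS]integral_mkcond; apply: eq_integral => x _.
  rewrite /F/= patchE indicE; case: ifPn => _; rewrite ?mule1//= mule0//.
- exact: measurable_cst.
- apply: aeW => s _.
  exact: (@cvg_int_osc (fun y => f (s, y)) C (measurable_section s) (fun x => fC (s, x)) B).
- apply/integrableP; split; first exact: measurable_cst.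
  rewrite integral_cst/=; last exact: measurable_seg.
  by apply: lte_mul_pinfty => //; exact: seg_fin.
- apply: aeW => s n _; rewrite gee0_abs//.
  rewrite /= KE -(integral_cst mu (measurable_seg _)); apply: ge0_le_integral => //.
  + exact: measurable_seg.
  + by move=> x _; exact: (osc2_ge0 _ (inv_succ_gt0 n)).
  + apply: measurable_funTS; apply: (measurableT_comp (measurable_osc2 (inv_succ_gt0 n))).
    exact: pair1_measurable.
  + by move=> x _; exact: (osc2_le _ (inv_succ_gt0 n)).
by move=> _ _; rewrite integral0.
Qed.

End two_dim.
End Modulus.

Section L1Convergence.
Context {R : realType}.
Implicit Types (t x y s k e B c d : R).
Local Notation mu := (@lebesgue_measure R).
Local Notation leb2 := (@leb2 R).

Lemma int_indic_seg B (g : R -> \bar R) :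
  (\int[mu]_(s in seg B) g s = \int[mu]_s ((\1_(seg B) s)%:E * g s))%E.
Proof.
rewrite integral_mkcond; apply: eq_integral => s _.
by rewrite patchE indicE; case: ifPn => _; rewrite ?mul1e ?mul0e.
Qed.

Lemma leb2_tonelli1 (F : R * R -> \bar R) : measurable_fun setT F ->
  (forall w, 0 <= F w)%E ->
  (\int[leb2]_w F w = \int[mu]_s \int[mu]_y F (s, y))%E.
Proof. by move=> mF F0; exact: (@fubini_tonelli1 _ _ _ _ R mu mu F mF F0). Qed.

Lemma leb2_tonelli2 (F : R * R -> \bar R) : measurable_fun setT F ->
  (forall w, 0 <= F w)%E ->
  (\int[leb2]_w F w = \int[mu]_y \int[mu]_s F (s, y))%E.
Proof. by move=> mF F0; exact: (@fubini_tonelli2 _ _ _ _ R mu mu F mF F0). Qed.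

Lemma kerc_sym e r : kerc e (- r) = kerc e r.
Proof.
rewrite /kerc mulNr (_ : clamp (- (r / e)) = - clamp (r / e)) ?sqrrN//.
move: (r / e) => c; rewrite /clamp.
by repeat (case: ifPn => ?); lra.
Qed.

Definition mol (f : R * R -> R) e (z : R * R) : R :=
  \int[leb2]_(w in halfplane) (kerc e (w.1 - z.1) * kerc e (w.2 - z.2) * f w).

Variables (f : R * R -> R) (C : R).
Hypotheses (mf : measurable_fun setT f) (fC : forall z, `|f z| <= C).

Let fs (z : R * R) := f (z.2, z.1).

Let mfs : measurable_fun setT fs.
Proof. by apply: measurableT_comp => //; exact: measurable_fun_pair. Qed.

Let fsC z : `|fs z| <= C.
Proof. exact: fC. Qed.

Let V1 e (z : R * R) : \bar R :=
  (\int[mu]_s ((kerc e (s - z.1))%:E * osc2 f e (s, z.2)))%E.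

(** Going from [f (t, x)] to [f w] through [f (w.1, x)] splits the error: the move in space gives a
    time average of [osc2 f], the move in time gives the oscillation of the transposed function
    [fs]. The condition [e <= z.1] gives the kernel its full mass. *)
Lemma mol_sub_le e (z : R * R) : 0 < e -> e <= z.1 ->
  (`|mol f e z - f z|%:E <= V1 e z + osc2 fs e (z.2, z.1))%E.
Proof.
move=> e0 ez; case: z ez => t x /= et.
pose kk (w : R * R) := kerc e (w.1 - t) * kerc e (w.2 - x).
have bkk : bfs leb2 kk.
  by apply: (@bfs_prod _ (fun r => kerc e (r - t)) (fun r => kerc e (r - x))); exact: bfs_kerc.
have kk0 w : 0 <= kk w by rewrite mulr_ge0 ?kerc_ge0.
have ikk : \int[leb2]_(w in halfplane) kk w = 1.
  rewrite (@int_prod _ (fun r => kerc e (r - t)) (fun r => kerc e (r - x)));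
    [|exact: bfs_kerc|exact: bfs_kerc].
  by rewrite int_kerc// int_kerc_pos// kerp_left ?subr0 ?mulr1//; lra.
have bkf : bfs leb2 (fun w : R * R => kk w * f w).
  exact: (@bfsM _ _ _ leb2 kk f C bkk mf fC).
have mfc : measurable_fun setT (fun w : R * R => f w - f (t, x)).
  exact: measurable_funB.
have bkd : bfs leb2 (fun w : R * R => kk w * (f w - f (t, x))).
  apply: (@bfsM _ _ _ leb2 kk _ (C + C) bkk mfc) => w.
  by rewrite (le_trans (ler_normB _ _))// lerD.
have -> : mol f e (t, x) - f (t, x) =
    \int[leb2]_(w in halfplane) (kk w * (f w - f (t, x))).
  rewrite (@eq_hp_int _ _ (fun w => kk w * f w - f (t, x) * kk w)); last first.
    by move=> w _; ring.
  by rewrite hp_intB//; [rewrite hp_intZ// ikk mulr1|exact: bfsZ].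
have bkn : bfs leb2 (fun w : R * R => kk w * `|f w - f (t, x)|).
  apply: (bfs_dominated _ bkd).
    apply: measurable_funM; first by case: bkk.
    exact: measurableT_comp.
  by move=> w; rewrite !normrM normr_id.
apply: (@le_trans _ _ (\int[leb2]_(w in halfplane) (kk w * `|f w - f (t, x)|))%:E).
  rewrite lee_fin; apply: hp_norm_int => // w _.
  by rewrite normrM (ger0_norm (kk0 _)).
have E := @bfs_EFin_int _ _ _ leb2 halfplane measurable_halfplane _ bkn.
pose F1 (w : R * R) := (kk w * `|f w - f (w.1, x)|)%:E.
pose F2 (w : R * R) := (kk w * `|f (w.1, x) - f (t, x)|)%:E.
have mfx : measurable_fun setT (fun w : R * R => f (w.1, x)).
  by apply: measurableT_comp => //; exact: measurable_fun_pair.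
have mF1 : measurable_fun setT F1.
  apply/measurable_EFinP; apply: measurable_funM; first by case: bkk.
  by apply: measurableT_comp => //; exact: measurable_funB.
have mF2 : measurable_fun setT F2.
  apply/measurable_EFinP; apply: measurable_funM; first by case: bkk.
  by apply: measurableT_comp => //; exact: measurable_funB.
have F10 w : (0 <= F1 w)%E by rewrite lee_fin mulr_ge0.
have F20 w : (0 <= F2 w)%E by rewrite lee_fin mulr_ge0.
apply: (@le_trans _ _ (\int[leb2]_w (F1 w + F2 w))%E).
  rewrite -E [leLHS]integral_mkcond; apply: ge0_le_integral => //.
  - by move=> w _; rewrite patchE; case: ifP => // _; rewrite lee_fin mulr_ge0.
  - have mbn : measurable_fun halfplane (fun w : R * R => (kk w * `|f w - f (t, x)|)%:E).
      by apply: measurable_funTS; apply/measurable_EFinP; case: bkn.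
    exact: (measurable_restrictT _ measurable_halfplane).1 mbn.
  - exact: emeasurable_funD.
  - move=> w _; rewrite patchE; case: ifPn => _; last by rewrite adde_ge0.
    rewrite -EFinD -mulrDr lee_fin ler_wpM2l//.
    by rewrite (le_trans _ (ler_normD _ _))// le_eqVlt; apply/orP; left;
      apply/eqP; congr (`| _ |); ring.
rewrite ge0_integralD//; apply: leeD.
  rewrite leb2_tonelli1// le_eqVlt; apply/orP; left; apply/eqP.
  apply: eq_integral => s _; rewrite /F1 /kk /osc2 /osc/=.
  under eq_integral do rewrite -mulrA EFinM.
  rewrite ge0_integralZl//.
  - apply/measurable_EFinP; apply: measurable_funM; first exact: measurable_kerc.
    apply: measurableT_comp => //; apply: measurable_funB => //.
    exact: measurable_section.
  - by move=> y _; rewrite lee_fin mulr_ge0// kerc_ge0.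
  - by rewrite lee_fin kerc_ge0.
rewrite leb2_tonelli1// le_eqVlt; apply/orP; left; apply/eqP.
apply: eq_integral => s _; rewrite /F2 /kk /fs/=.
under eq_integral do rewrite mulrAC EFinM.
rewrite integralZl//; last by apply: bfs_integrable => //; exact: bfs_kerc.
rewrite bfs_EFin_int//; last exact: bfs_kerc.
by rewrite int_kerc// mule1.
Qed.

Let V1_ge0 e z : 0 < e -> (0 <= V1 e z)%E.
Proof.
move=> e0; apply: integral_ge0 => s _.
by rewrite mule_ge0 ?osc2_ge0// lee_fin kerc_ge0.
Qed.

Let measurable_V1 e : 0 < e -> measurable_fun setT (V1 e).
Proof.
move=> e0.
pose F (w : R * R * R) := ((kerc e (w.2 - w.1.1))%:E * osc2 f e (w.2, w.1.2))%E.
have mF : measurable_fun setT F.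
  apply: emeasurable_funM.
    apply/measurable_EFinP; apply: measurable_kerc_sub => //.
    exact: measurableT_comp.
  apply: (measurableT_comp (measurable_osc2 mf e0)).
  by apply: measurable_fun_pair => //; exact: measurableT_comp.
have F0 w : (0 <= F w)%E by rewrite mule_ge0 ?osc2_ge0// lee_fin kerc_ge0.
exact: (@measurable_fun_fubini_tonelli_F _ _ _ _ _ mu F mF F0).
Qed.

Let boxw c B (z : R * R) : R := \1_`[c, B] z.1 * \1_(seg B) z.2.

Let measurable_boxw c B : measurable_fun setT (fun z => (boxw c B z)%:E).
Proof.
have m1 : measurable_fun setT (\1_`[c, B] : R -> R) by exact: measurable_indic.
have m2 : measurable_fun setT (\1_(seg B) : R -> R).
  by apply: measurable_indic; exact: measurable_seg.
apply/measurable_EFinP; apply: measurable_funM.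
  exact: measurableT_comp m1 _.
exact: measurableT_comp m2 _.
Qed.

Let boxw_ge0 c B z : 0 <= boxw c B z.
Proof. by rewrite mulr_ge0// indicE. Qed.

(** Exchanging the integrals, the kernel is integrated first over its centre [t] and contributes at
    most 1. It reaches at most [e <= 1] beyond the box, whence the enlarged segment [B + 1]. *)
Lemma int_boxw_V1 e c B : 0 < e -> e <= 1 -> 0 <= c ->
  (\int[leb2]_z ((boxw c B z)%:E * V1 e z) <=
   \int[mu]_(s in seg (B + 1)%R) \int[mu]_(x in seg B) osc2 f e (s, x))%E.
Proof.
move=> e0 e1 c0.
have mo := measurable_osc2 mf e0.
have mos x : measurable_fun setT (fun s => osc2 f e (s, x)).
  by apply: (measurableT_comp mo); exact: pair2_measurable.
have i1 A r : (0 <= ((\1_A r : R)%:E : \bar R))%E by rewrite lee_fin indicE.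
have m1 : measurable_fun setT (fun s => (\1_(seg (B + 1)) s : R)%:E).
  by apply/measurable_EFinP; apply: measurable_indic; exact: measurable_seg.
have m2 : measurable_fun setT (fun s => (\1_(seg B) s : R)%:E).
  by apply/measurable_EFinP; apply: measurable_indic; exact: measurable_seg.
have mc : measurable_fun setT (fun s => (\1_`[c, B] s : R)%:E).
  by apply/measurable_EFinP; apply: measurable_indic; exact: measurable_itv.
pose G (z : R * R) := ((\1_(seg (B + 1)) z.1)%:E * ((\1_(seg B) z.2)%:E * osc2 f e z))%E.
have mG : measurable_fun setT G.
  apply: emeasurable_funM; first exact: (measurableT_comp m1 _).
  by apply: emeasurable_funM => //; exact: (measurableT_comp m2 _).
have G0 z : (0 <= G z)%E by rewrite !mule_ge0 ?osc2_ge0.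
apply: (@le_trans _ _ (\int[leb2]_z G z)%E); last first.
  rewrite (leb2_tonelli1 mG G0) int_indic_seg le_eqVlt; apply/orP; left; apply/eqP.
  apply: eq_integral => s _; rewrite int_indic_seg -ge0_integralZl//.
  - apply: emeasurable_funM => //.
    by apply: (measurableT_comp mo); exact: pair1_measurable.
  - by move=> x _; rewrite mule_ge0 ?osc2_ge0.
pose BV (z : R * R) := ((boxw c B z)%:E * V1 e z)%E.
have mBV : measurable_fun setT BV by apply: emeasurable_funM => //; exact: measurable_V1.
have BV0 w : (0 <= BV w)%E by rewrite mule_ge0 ?V1_ge0// lee_fin.
rewrite (leb2_tonelli2 mBV BV0) (leb2_tonelli2 mG G0).
have mI (F : R * R -> \bar R) : measurable_fun setT F -> (forall w, 0 <= F w)%E ->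
    measurable_fun setT (fun y => \int[mu]_s F (s, y))%E.
  by move=> mF F0; exact: (@measurable_fun_fubini_tonelli_G _ _ _ _ _ mu F mF F0).
apply: ge0_le_integral => //.
- by move=> x _; apply: integral_ge0.
- exact: mI.
- exact: mI.
move=> x _.
pose H (z : R * R) := ((\1_`[c, B] z.1)%:E * (\1_(seg B) x)%:E *
  ((kerc e (z.2 - z.1))%:E * osc2 f e (z.2, x)))%E.
have mH : measurable_fun setT H.
  apply: emeasurable_funM.
    by apply: emeasurable_funM => //; exact: (measurableT_comp mc _).
  apply: emeasurable_funM; first exact/measurable_EFinP/measurable_kerc_sub.
  exact: (measurableT_comp (mos x) _).
have H0 z : (0 <= H z)%E.
  by rewrite !mule_ge0 ?osc2_ge0 ?lee_fin ?kerc_ge0.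
have mk t : measurable_fun setT (fun s => (kerc e (s - t))%:E * osc2 f e (s, x))%E.
  by apply: emeasurable_funM => //; apply/measurable_EFinP; exact: measurable_kerc.
apply: (@le_trans _ _ (\int[mu]_t \int[mu]_s H (t, s))%E).
  rewrite le_eqVlt; apply/orP; left; apply/eqP; apply: eq_integral => t _.
  rewrite /BV /boxw /V1 /H/= -EFinM -ge0_integralZl//.
  - exact: mk.
  - by move=> s _; rewrite mule_ge0 ?osc2_ge0// lee_fin kerc_ge0.
rewrite (@fubini_tonelli _ _ _ _ R mu mu H mH H0).
apply: ge0_le_integral => //.
- by move=> s _; apply: integral_ge0.
- exact: mI.
- exact: (measurableT_comp mG (pair2_measurable _)).
move=> s _; rewrite /H /G/=.
have osx : (0 <= (\1_(seg B) x)%:E * osc2 f e (s, x))%E by rewrite mule_ge0 ?osc2_ge0.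
have -> : (\int[mu]_t ((\1_`[c, B] t)%:E * (\1_(seg B) x)%:E *
      ((kerc e (s - t))%:E * osc2 f e (s, x))) =
    \int[mu]_t ((\1_`[c, B] t * kerc e (s - t))%:E) *
      ((\1_(seg B) x)%:E * osc2 f e (s, x)))%E.
  rewrite -ge0_integralZr.
  - apply: eq_integral => t _; rewrite (EFinM (\1_`[c, B] t)) -!muleA.
    by congr (_ * _)%E; rewrite muleCA.
  - exact: measurableT.
  - apply/measurable_EFinP; apply: measurable_funM; first exact/measurable_EFinP.
    exact: measurable_kerc_sub.
  - by move=> t _; rewrite lee_fin mulr_ge0 ?kerc_ge0// indicE.
  - exact: osx.
rewrite lee_wpmul2r//.
have bk : bfs mu (fun t => kerc e (t - s)) by exact: bfs_kerc.
rewrite [in leRHS]indicE; case: (boolP (s \in seg (B + 1))) => hs /=.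
  apply: (@le_trans _ _ (\int[mu]_t (kerc e (t - s))%:E)%E); last first.
    by rewrite bfs_EFin_int// int_kerc.
  apply: ge0_le_integral => //.
  - by move=> t _; rewrite lee_fin mulr_ge0 ?kerc_ge0// indicE.
  - apply/measurable_EFinP; apply: measurable_funM; first exact/measurable_EFinP.
    exact: measurable_kerc_sub.
  - by apply/measurable_EFinP; case: bk.
  - move=> t _; rewrite lee_fin -(opprB t s) kerc_sym indicE.
    by case: (t \in _); rewrite ?mul1r ?mul0r ?kerc_ge0.
rewrite integral0_eq// => t _; congr EFin.
rewrite indicE; case: (boolP (t \in _)); last by rewrite mul0r.
rewrite inE/= in_itv/= => /andP[ct tB]; rewrite mul1r.
apply: kerc_out => //; move: hs; rewrite notin_setE/seg/= in_itv/= => /negP.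
rewrite negb_and -!ltNge ler_normr => /orP[hs|hs]; apply/orP.
- by right; lra.
- by left; lra.
Qed.

Lemma int_boxw_osc2 e c B : 0 < e -> 0 <= c ->
  (\int[leb2]_z ((boxw c B z)%:E * osc2 fs e (z.2, z.1)) <=
   \int[mu]_(x in seg B) \int[mu]_(t in seg B) osc2 fs e (x, t))%E.
Proof.
move=> e0 c0.
have mo := measurable_osc2 mfs e0.
have i1 A r : (0 <= ((\1_A r : R)%:E : \bar R))%E by rewrite lee_fin indicE.
have m2 : measurable_fun setT (fun s => (\1_(seg B) s : R)%:E).
  by apply/measurable_EFinP; apply: measurable_indic; exact: measurable_seg.
pose F (z : R * R) := ((boxw c B z)%:E * osc2 fs e (z.2, z.1))%E.
have F0 w : (0 <= F w)%E by rewrite mule_ge0 ?osc2_ge0// lee_fin.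
have mF : measurable_fun setT F.
  apply: emeasurable_funM => //; apply: (measurableT_comp mo).
  exact: measurable_fun_pair.
pose G (z : R * R) := ((\1_(seg B) z.1)%:E * ((\1_(seg B) z.2)%:E * osc2 fs e (z.2, z.1)))%E.
have mG : measurable_fun setT G.
  apply: emeasurable_funM; first exact: (measurableT_comp m2 _).
  apply: emeasurable_funM; first exact: (measurableT_comp m2 _).
  by apply: (measurableT_comp mo); exact: measurable_fun_pair.
have G0 z : (0 <= G z)%E by rewrite !mule_ge0 ?osc2_ge0.
apply: (@le_trans _ _ (\int[leb2]_z G z)%E).
  apply: ge0_le_integral => //; first by move=> z _; exact: F0.
  move=> z _; rewrite /F /G /boxw (EFinM (\1_`[c, B] z.1)) -muleA.
  rewrite lee_wpmul2r ?mule_ge0 ?osc2_ge0//.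
  rewrite lee_fin !indicE; case: (boolP (z.1 \in `[c, B]%classic)) => //.
  rewrite inE/= in_itv/= => /andP[cz zB]; rewrite mem_set//= /seg/= in_itv/= zB andbT.
  lra.
rewrite (leb2_tonelli2 mG G0) int_indic_seg le_eqVlt; apply/orP; left; apply/eqP.
apply: eq_integral => x _; rewrite int_indic_seg -ge0_integralZl//.
- by apply: eq_integral => t _; rewrite /G/= muleCA.
- apply: emeasurable_funM => //.
  by apply: (measurableT_comp mo); exact: pair1_measurable.
- by move=> t _; rewrite mule_ge0 ?osc2_ge0.
Qed.

Lemma mol_le e z : 0 < e -> `|mol f e z| <= C.
Proof.
move=> e0.
have := @tensor_bound _ (fun r => kerc e (r - z.1)) (fun r => kerc e (r - z.2))
    (fun r => kerc e (r - z.1)) (fun r => kerc e (r - z.2)) f C.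
rewrite !int_kerc// !mul1r; apply => //; do ?exact: bfs_kerc.
- by move=> r; rewrite ger0_norm// kerc_ge0.
- by move=> r; rewrite ger0_norm// kerc_ge0.
Qed.

Lemma continuous_mol e : 0 < e -> continuous (mol f e).
Proof.
move=> e0.
have := @lipschitz_cont2 _ (fun t x => mol f e (t, x)) (8 / e * C) (8 / e * C).
rewrite (_ : (fun z : R * R => _) = mol f e); last by apply/funext => -[].
by apply => t x s y; exact: mol_lip.
Qed.

Lemma bfs_box_mol e c B : 0 < e ->
  bfs leb2 (fun z : R * R => \1_`[c, B] z.1 * \1_(seg B) z.2 * `|mol f e z - f z|).
Proof.
move=> e0.
have m : measurable_fun setT (fun z : R * R => `|mol f e z - f z|).
  apply: measurableT_comp => //; apply: measurable_funB => //.
  by apply: continuous_measurable_plane; exact: continuous_mol.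
apply: (@bfs_weighted _ (\1_`[c, B]) (\1_(seg B)) _ (C + C) (bfs_box _ _) (bfs_box _ _) m).
by move=> z; rewrite normr_id (le_trans (ler_normB _ _))// lerD// mol_le.
Qed.

Lemma near_inv_succ_le d : 0 < d -> \forall n \near \oo, inv_succ n <= d.
Proof.
by move=> d0; apply: filterS (near_infty_natSinv_lt (PosNum d0)) => n /ltW.
Qed.

Lemma cvge0_near_lt (u : nat -> \bar R) d :
  u @ \oo --> 0%E -> 0 < d -> \forall n \near \oo, (u n < d%:E)%E.
Proof.
move=> /fine_cvgP[fu cu] d0; near=> n.
have fn : u n \is a fin_num by near: n; exact: fu.
by rewrite -(fineK fn) lte_fin; near: n; exact: (cvgr_lt _ cu).
Unshelve. all: by end_near. Qed.

Lemma cvge0D_near_lt (u v : nat -> \bar R) d :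
  u @ \oo --> 0%E -> v @ \oo --> 0%E -> 0 < d ->
  \forall n \near \oo, (u n + v n < d%:E)%E.
Proof.
move=> cu cv d0; have d2 : 0 < d / 2 by rewrite divr_gt0.
move: (cvge0_near_lt cu d2) (cvge0_near_lt cv d2); apply: filterS2 => n h1 h2.
have -> : (d%:E = (d / 2)%:E + (d / 2)%:E)%E by rewrite -EFinD -splitr.
exact: lteD.
Qed.

(** The margin [c] keeps the times away from 0: once the scale is below [c], kernels centred in the
    box are not cut by the half plane. *)
Lemma near_mol_L1 c B d : 0 < c -> 0 < d -> \forall n \near \oo,
  \int[leb2]_(z in halfplane) (\1_`[c, B] z.1 * \1_(seg B) z.2 *
     `|mol f (inv_succ n) z - f z|) < d.
Proof.
move=> c0 d0.
have c1 := @cvg_int_osc2 _ f C mf fC (B + 1) B.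
have c2 := @cvg_int_osc2 _ fs C mfs fsC B B.
have hT := cvge0D_near_lt c1 c2 d0.
near=> n.
have e0 : 0 < inv_succ n :> R := inv_succ_gt0 n.
have e1 : inv_succ n <= 1 :> R.
  by near: n; exact: near_inv_succ_le.
have ec : inv_succ n <= c.
  by near: n; exact: near_inv_succ_le.
rewrite -lte_fin; apply: (@le_lt_trans _ _
  (\int[mu]_(s in seg (B + 1)%R) \int[mu]_(x in seg B) osc2 f (inv_succ n) (s, x) +
  \int[mu]_(s in seg B) \int[mu]_(x in seg B) osc2 fs (inv_succ n) (s, x))%E); last first.
  by near: n; exact: hT.
set e := inv_succ n in e0 e1 ec *.
have bb := bfs_box_mol c B e0.
have E := @bfs_EFin_int _ _ _ leb2 halfplane measurable_halfplane _ bb.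
have b0 : 0 <= c by exact: ltW.
apply: le_trans (leeD (int_boxw_V1 _ e0 e1 b0) (int_boxw_osc2 B e0 b0)).
have i0 (z : R * R) : 0 <= boxw c B z by [].
have mV2 : measurable_fun setT (fun z : R * R => osc2 fs e (z.2, z.1)).
  by apply: (measurableT_comp (measurable_osc2 mfs e0)); exact: measurable_fun_pair.
pose g1 (z : R * R) := ((boxw c B z)%:E * V1 e z)%E.
pose g2 (z : R * R) := ((boxw c B z)%:E * osc2 fs e (z.2, z.1))%E.
have g10 z : (0 <= g1 z)%E by rewrite mule_ge0 ?V1_ge0// lee_fin.
have g20 z : (0 <= g2 z)%E by rewrite mule_ge0 ?osc2_ge0// lee_fin.
have mg1 : measurable_fun setT g1.
  by apply: emeasurable_funM => //; exact: measurable_V1.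
have mg2 : measurable_fun setT g2 by exact: emeasurable_funM.
have -> : (\int[leb2]_z ((boxw c B z)%:E * V1 e z) +
    \int[leb2]_z ((boxw c B z)%:E * osc2 fs e (z.2, z.1)) =
    \int[leb2]_z (g1 z + g2 z))%E.
  by rewrite ge0_integralD.
rewrite -E [leLHS]integral_mkcond; apply: ge0_le_integral => //.
- by move=> z _; rewrite patchE; case: ifP => // _; rewrite lee_fin mulr_ge0.
- have mbn : measurable_fun halfplane (fun z : R * R =>
      (\1_`[c, B] z.1 * \1_(seg B) z.2 * `|mol f e z - f z|)%:E).
    by apply: measurable_funTS; apply/measurable_EFinP; case: bb.
  exact: (measurable_restrictT _ measurable_halfplane).1 mbn.
- exact: emeasurable_funD.
move=> z _; rewrite patchE; case: ifPn => _; last first.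
  by rewrite adde_ge0.
rewrite /g1 /g2 -ge0_muleDr; [|exact: V1_ge0|exact: osc2_ge0].
rewrite EFinM -/(boxw c B z).
have [zc|zc] := boolP (z.1 \in `[c, B]%classic); last first.
  by rewrite /boxw indicE (negbTE zc) mul0r !mul0e.
rewrite lee_wpmul2l ?lee_fin//; apply: mol_sub_le => //.
by move: zc; rewrite inE/= in_itv/= => /andP[cz _]; exact: le_trans cz.
Unshelve. all: by end_near. Qed.

End L1Convergence.

(** * The viscosity inequality *)

Section Touching.
Context {R : realType}.
Implicit Types (t x y s k e q c : R).
Local Notation mu := (@lebesgue_measure R).
Local Notation leb2 := (@leb2 R).

(* Here [a], [an], [gn] stand for the solution and the mollifications of [a] and
   [a ^ 2 / 2]. The left-hand side is [P / c] times the Kruzhkov integrand plus the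
   integrand of [test_mass_ge0], both divided by [2 F^+], for the test function
   [(F^+)^2] with [F_t = q - 4 kap dt + gn] and [F_x = k - 4 kap dy - an]. It is
   negative, up to the mollification error, because the Kruzhkov term dominates
   [P |a - k| / 2] away from [a = k] while [q + k ^ 2 / 2 <= - c] takes over there. *)
Lemma touching_pointwise c kap P q k a an gn dt dy rho :
  0 < c -> 0 <= kap -> 0 <= P -> `|a - k| <= P -> `|a + k| <= P ->
  q + k ^+ 2 / 2 <= - c -> `|dt| <= rho -> `|dy| <= rho ->
  (4 * kap + 2 * kap * P) * rho <= c / 2 ->
  P / c * (`|a - k| * ((q - 4 * kap * dt + gn) +
     (a + k) / 2 * (k - 4 * kap * dy - an))) + (q - 4 * kap * dt + gn) <=
  - c / 2 + (1 + P ^+ 2 / c) * (`|gn - a ^+ 2 / 2| + P * `|an - a|).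
Proof.
move=> c0 kap0 P0 amk apk qk hdt hdy small.
set E := `|gn - a ^+ 2 / 2| + P * `|an - a|.
have E1 : `|gn - a ^+ 2 / 2| <= E by rewrite lerDl mulr_ge0.
have rho0 : 0 <= rho by exact: le_trans hdt.
have p1 : `|4 * kap * dt| <= 4 * kap * rho.
  by rewrite normrM ger0_norm ?mulr_ge0// ler_wpM2l// mulr_ge0.
have p2 : `|(a + k) / 2 * (4 * kap * dy)| <= 2 * kap * P * rho.
  rewrite !normrM (ger0_norm kap0) normfV !normr_nat.
  rewrite [leLHS](_ : _ = 2 * kap * (`|a + k| * `|dy|)); last by field.
  rewrite -[leRHS]mulrA.
  by rewrite ler_wpM2l ?mulr_ge0// ler_pM.
have p3 : `|(a + k) / 2 * (an - a)| <= P * `|an - a| / 2.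
  rewrite !normrM normfV normr_nat -mulrAC.
  by rewrite ler_wpM2r ?invr_ge0// ler_wpM2r.
have p4 : 0 <= P * `|an - a| by rewrite mulr_ge0.
have p5 : 0 <= 2 * kap * P * rho by rewrite !mulr_ge0.
have p6 : 0 <= 4 * kap * rho by rewrite !mulr_ge0.
rewrite mulrDl in small.
(* For [gn = a^2 / 2], [an = a] and [dt = dy = 0] the left-hand side is exactly [q + k^2 / 2]; the
   rest is perturbation. *)
have b1 : (q - 4 * kap * dt + gn) + (a + k) / 2 * (k - 4 * kap * dy - an) <= - c / 2 + E.
  rewrite (_ : _ + _ = q + k ^+ 2 / 2 - 4 * kap * dt - (a + k) / 2 * (4 * kap * dy)
    + (gn - a ^+ 2 / 2) - (a + k) / 2 * (an - a)); last by field.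
  move: p1 p2 p3; rewrite !ler_norml => /andP[p11 _] /andP[p21 _] /andP[p31 _].
  have := ler_norm (gn - a ^+ 2 / 2); rewrite /E.
  move: (4 * kap * dt) ((a + k) / 2 * (4 * kap * dy)) ((a + k) / 2 * (an - a))
    (gn - a ^+ 2 / 2) (q + k ^+ 2 / 2) (4 * kap * rho) (2 * kap * P * rho)
    (P * `|an - a|) p11 p21 p31 p4 small qk => u1 u2 u3 w v r1 r2 r3 *; lra.
(* The excess [P / 2 * |a - k|] is what the gain [- c / 2] of [b1], multiplied by [P / c * |a - k|],
   cancels exactly; this fixes the weight [P / c]. *)
have b2 : q - 4 * kap * dt + gn <= - c / 2 + P / 2 * `|a - k| + E.
  have h : (a ^+ 2 - k ^+ 2) / 2 <= P / 2 * `|a - k|.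
    rewrite (_ : (a ^+ 2 - k ^+ 2) / 2 = (a + k) / 2 * (a - k)); last by field.
    rewrite (le_trans (ler_norm _))// !normrM normfV normr_nat ler_wpM2r//.
    by rewrite ler_wpM2r// invr_ge0.
  move: p1; rewrite ler_norml => /andP[p11 _].
  have h2 := ler_norm (gn - a ^+ 2 / 2).
  rewrite (_ : _ + _ = q + k ^+ 2 / 2 - 4 * kap * dt + (a ^+ 2 - k ^+ 2) / 2
    + (gn - a ^+ 2 / 2)); last by field.
  move: (4 * kap * dt) (gn - a ^+ 2 / 2) (q + k ^+ 2 / 2) (4 * kap * rho)
    (2 * kap * P * rho) ((a ^+ 2 - k ^+ 2) / 2) (P / 2 * `|a - k|) p11 small qk h p5 E1 h2
    => u1 w v r1 r2 r3 r4 *; lra.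
have Pc : 0 <= P / c by rewrite divr_ge0// ltW.
have b3 : P / c * (`|a - k| * ((q - 4 * kap * dt + gn) +
     (a + k) / 2 * (k - 4 * kap * dy - an))) <= P / c * (`|a - k| * (- c / 2 + E)).
  by apply: ler_wpM2l => //; apply: ler_wpM2l.
apply: (le_trans (lerD b3 b2)).
have E0 : 0 <= E by rewrite addr_ge0.
have b4 : P / c * (`|a - k| * E) <= P ^+ 2 / c * E.
  rewrite mulrA [leRHS](_ : _ = P / c * P * E); last by ring.
  by rewrite ler_wpM2r// ler_wpM2l.
rewrite [leLHS](_ : _ = - c / 2 + E + P / c * (`|a - k| * E)); last by field; rewrite gt_eqF.
by rewrite mulrDl mul1r; lra.
Qed.

Definition pos r : R := Num.max r 0.

Lemma pos_ge0 r : 0 <= pos r.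
Proof. by rewrite /pos le_max lexx orbT. Qed.

(** Squaring removes the corner of the positive part, which makes [(F^+)^2] an admissible C^1 test
    function. *)
Lemma is_derive_sqr_pos (F : R -> R) f x :
  is_derive x 1 F f -> is_derive x 1 (fun y => pos (F y) ^+ 2) (2 * pos (F x) * f).
Proof.
move=> dF.
have db (r : R) : is_derive r 1 (fun s : R => pos s ^+ 2) (2 * pos r).
  apply: (@is_derive_quad _ _ _ _ 1) => s _; rewrite mul1r ler_norml /pos.
  have h := sqr_ge0 (s - r); have hs2 := sqr_ge0 s; have hr2 := sqr_ge0 r.
  case: (leP r 0) => hr; case: (leP s 0) => hs.
  - by apply/andP; split; lra.
  - have h1 : 0 <= s * - r by rewrite mulr_ge0 ?oppr_ge0// ltW.
    by apply/andP; split; lra.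
  - have h1 : 0 <= r * - s by rewrite mulr_ge0 ?oppr_ge0// ltW.
    by apply/andP; split; lra.
  - by apply/andP; split; lra.
have := @is_derive1_comp _ (fun r => pos r ^+ 2) F x _ _ (db (F x)) dF.
by rewrite mulrC.
Qed.

Lemma continuous_pos : continuous (pos : R -> R).
Proof.
apply: (@lipschitz_cont _ _ 1) => x y; rewrite mul1r /pos.
have := ler_norm (x - y); have := ler_norm (- (x - y)); rewrite normrN => h1 h2.
by rewrite ler_norml; case: (leP x 0) => hx; case: (leP y 0) => hy; apply/andP; split; lra.
Qed.

Lemma bfs_box2 (f : R * R -> R) C t1 t2 x1 x2 : measurable_fun setT f ->
  (forall z, `|f z| <= C * (\1_`[t1, t2] z.1 * \1_`[x1, x2] z.2)) -> bfs leb2 f.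
Proof.
move=> mf hf.
pose g (z : R * R) := C * (\1_`[t1, t2] z.1 * \1_`[x1, x2] z.2).
have b : bfs leb2 g by apply: bfsZ; apply: bfs_prod; exact: bfs_box.
by apply: (@bfs_dominated _ _ _ leb2 f g mf b) => z; exact: le_trans (ler_norm _).
Qed.

End Touching.

Section Bump.
Context {R : realType}.
Implicit Types (t x y s k e q c v kap eta rho : R).
Local Notation mu := (@lebesgue_measure R).
Local Notation leb2 := (@leb2 R).

Definition parab c q kap x0 x : R := c + q * (x - x0) - 2 * kap * (x - x0) ^+ 2.

Lemma is_derive_parab c q kap x0 x :
  is_derive x 1 (parab c q kap x0) (q - 4 * kap * (x - x0)).
Proof.
apply: (@is_derive_quad _ _ _ _ (2 * `|kap|)) => y _.
rewrite (_ : _ - _ - _ = - (2 * kap * (y - x) ^+ 2)); last by rewrite /parab; ring.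
by rewrite normrN normrM (ger0_norm (sqr_ge0 _)) normrM normr_nat.
Qed.

Lemma continuous_parab c q kap x0 : continuous (parab c q kap x0).
Proof.
move=> x; apply: differentiable_continuous; apply/derivable1_diffP.
by have [] := is_derive_parab c q kap x0 x.
Qed.

Variables (M : R) (a0 : R -> R) (a : R -> R -> R).

(* If a paraboloid of curvature [kap] touches [pot] from below at [(t0, x0)] up to
   [eta], then raising it by [eta] and doubling the curvature makes it exceed [pot]
   only near [(t0, x0)]. *)
Definition bumpF e v q k kap eta t0 x0 t x : R :=
  parab (v + eta) q kap t0 t + parab 0 k kap x0 x - pot e a0 a t x.

Lemma continuous_gmol e : kruzhkov M a0 a -> 0 < e ->
  continuous (fun z : R * R => gmol e a z.1 z.2).
Proof.
move=> kr e0; apply: lipschitz_cont2 => t x s y; exact: gmol_lip kr e0.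
Qed.

Lemma continuous_amol e : kruzhkov M a0 a -> 0 < e ->
  continuous (fun z : R * R => amol e a0 a z.1 z.2).
Proof.
move=> kr e0; apply: lipschitz_cont2 => t x s y; exact: amol_lip kr e0.
Qed.

Lemma continuous_pot e : kruzhkov M a0 a -> 0 < e ->
  continuous (fun z : R * R => pot e a0 a z.1 z.2).
Proof.
move=> kr e0; apply: lipschitz_cont2 => t x s y; exact: pot_lip kr e0.
Qed.

Section bump.
Variables (e v q k kap eta rho t0 x0 : R).
Local Notation F := (bumpF e v q k kap eta t0 x0).

Lemma continuous_bumpF : kruzhkov M a0 a -> 0 < e ->
  continuous (fun z : R * R => F z.1 z.2).
Proof.
move=> kr e0 z; apply: cvgB; last exact: (continuous_pot kr e0).
apply: cvgD.
  apply: (@continuous_comp _ _ _ fst (parab (v + eta) q kap t0)); first exact: cvg_fst.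
  exact: continuous_parab.
apply: (@continuous_comp _ _ _ snd (parab 0 k kap x0)); first exact: cvg_snd.
exact: continuous_parab.
Qed.

Lemma bumpF_dt t x : kruzhkov M a0 a -> 0 < e ->
  is_derive t 1 (F^~ x) (q - 4 * kap * (t - t0) + gmol e a t x).
Proof.
move=> kr e0; have d1 := is_derive_parab (v + eta) q kap t0 t.
have d2 := pot_dt t x kr e0.
have := is_deriveB (is_deriveD d1 (is_derive_cst (parab 0 k kap x0 x) t 1)) d2.
by rewrite addr0 opprK.
Qed.

Lemma bumpF_dx t x : kruzhkov M a0 a -> 0 < e ->
  is_derive x 1 (F t) (k - 4 * kap * (x - x0) - amol e a0 a t x).
Proof.
move=> kr e0; have d1 := is_derive_parab 0 k kap x0 x.
have d2 := pot_dx t x kr e0.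
have := is_deriveB (is_deriveD (is_derive_cst (parab (v + eta) q kap t0 t) x 1) d1) d2.
by rewrite add0r.
Qed.

Hypothesis touch : forall t x,
  v + q * (t - t0) + k * (x - x0) - kap * ((t - t0) ^+ 2 + (x - x0) ^+ 2) - eta
  <= pot e a0 a t x.

Lemma bumpF_le t x : F t x <= 2 * eta - kap * ((t - t0) ^+ 2 + (x - x0) ^+ 2).
Proof.
by have := touch t x; rewrite /bumpF /parab => h; lra.
Qed.

(** The value of [eta] is the one for which [2 * eta - kap * rho ^+ 2 = 0]: beyond distance [rho]
    the upper bound [bumpF_le] is no longer positive. *)
Lemma pos_bumpF_box t x : 0 < kap -> 0 < rho -> eta = kap * rho ^+ 2 / 2 ->
  pos (F t x) <= 2 * eta * (\1_`[t0 - rho, t0 + rho] t * \1_`[x0 - rho, x0 + rho] x).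
Proof.
move=> kap0 rho0 etaE; have h := bumpF_le t x.
have st := sqr_ge0 (t - t0); have sx := sqr_ge0 (x - x0).
have eta0 : 0 <= eta by rewrite etaE divr_ge0// mulr_ge0 ?sqr_ge0// ltW.
have out r : ~~ (- rho <= r <= rho) -> rho ^+ 2 <= r ^+ 2.
  rewrite negb_and -!ltNge => /orP[hr|hr].
    by rewrite -(sqrrN r) lerXn2r// ?nnegrE; lra.
  by rewrite lerXn2r// ?nnegrE; lra.
have zero : kap * rho ^+ 2 <= kap * ((t - t0) ^+ 2 + (x - x0) ^+ 2) -> pos (F t x) = 0.
  move=> hz; rewrite /pos max_r//; apply: (le_trans h); rewrite etaE; lra.
have [ht|ht] := boolP (- rho <= t - t0 <= rho); last first.
  rewrite zero; first by rewrite !mulr_ge0 ?in_box_ge0.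
  by apply: ler_wpM2l; [exact: ltW|have := out _ ht; lra].
have [hx|hx] := boolP (- rho <= x - x0 <= rho); last first.
  rewrite zero; first by rewrite !mulr_ge0 ?in_box_ge0.
  by apply: ler_wpM2l; [exact: ltW|have := out _ hx; lra].
rewrite in_box; last by lra.
rewrite in_box; last by lra.
rewrite !mulr1 /pos ge_max mulr_ge0// andbT (le_trans h)// gerBl.
by rewrite mulr_ge0 ?addr_ge0// ltW.
Qed.

Lemma bfs_bump (f : R * R -> R) C : kruzhkov M a0 a -> 0 < e ->
  0 < kap -> 0 < rho -> eta = kap * rho ^+ 2 / 2 -> continuous f ->
  (forall z, `|z.1 - t0| <= rho -> `|z.2 - x0| <= rho -> `|f z| <= C) ->
  bfs leb2 (fun z : R * R => 2 * pos (F z.1 z.2) * f z).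
Proof.
move=> kr e0 kap0 rho0 etaE cf fC.
have C0 : 0 <= C.
  by apply: le_trans (fC (t0, x0) _ _); rewrite //= subrr normr0 ltW.
apply: (@bfs_box2 _ _ (4 * eta * C) (t0 - rho) (t0 + rho) (x0 - rho) (x0 + rho)).
  apply: continuous_measurable_plane => z; apply: cvgM; last exact: cf.
  apply: cvgM; first exact: cvg_cst.
  apply: (@continuous_comp _ _ _ (fun z : R * R => F z.1 z.2) pos).
    exact: continuous_bumpF.
  exact: continuous_pos.
move=> z; have hb := pos_bumpF_box z.1 z.2 kap0 rho0 etaE.
have p0 := pos_ge0 (F z.1 z.2).
rewrite !normrM normr_nat (ger0_norm p0).
have [ht|ht] := boolP (t0 - rho <= z.1 <= t0 + rho); last first.
  have i0 : \1_`[t0 - rho, t0 + rho] z.1 = 0 :> R.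
    by rewrite indicE memNset//= in_itv/=; exact/negP.
  rewrite i0 mul0r mulr0 in hb *.
  by rewrite (_ : pos _ = 0) ?mulr0 ?mul0r//; apply/eqP; rewrite eq_le hb.
have [hx|hx] := boolP (x0 - rho <= z.2 <= x0 + rho); last first.
  have i0 : \1_`[x0 - rho, x0 + rho] z.2 = 0 :> R.
    by rewrite indicE memNset//= in_itv/=; exact/negP.
  rewrite i0 !mulr0 in hb *.
  by rewrite (_ : pos _ = 0) ?mulr0 ?mul0r//; apply/eqP; rewrite eq_le hb.
rewrite (in_box ht) (in_box hx) !mulr1 in hb *.
rewrite ler_pM ?mulr_ge0//; first lra.
by apply: fC; rewrite ler_norml; lra.
Qed.

(** With [rho < t0] the bump vanishes at [t = 0], so the initial data drop out of the inequalities
    tested on it. *)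
Lemma test_C1_bump : kruzhkov M a0 a -> 0 < e ->
  0 < kap -> 0 < rho -> eta = kap * rho ^+ 2 / 2 -> rho < t0 ->
  test_C1 (fun t x => pos (F t x) ^+ 2)
    (fun t x => 2 * pos (F t x) * (q - 4 * kap * (t - t0) + gmol e a t x))
    (fun t x => 2 * pos (F t x) * (k - 4 * kap * (x - x0) - amol e a0 a t x)).
Proof.
move=> kr e0 kap0 rho0 etaE rt.
have cpF : continuous (fun z : R * R => pos (F z.1 z.2)).
  move=> z; apply: (@continuous_comp _ _ _ (fun z : R * R => F z.1 z.2) pos).
    exact: continuous_bumpF.
  exact: continuous_pos.
have k4 : 0 <= 4 * kap by rewrite mulr_ge0// ltW.
have cft : continuous (fun z : R * R => q - 4 * kap * (z.1 - t0) + gmol e a z.1 z.2).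
  move=> z; apply: cvgD; last exact: (continuous_gmol kr e0).
  apply: (@continuous_comp _ _ _ fst (fun t => q - 4 * kap * (t - t0))); first exact: cvg_fst.
  apply: (@lipschitz_cont _ _ (4 * kap)) => t s.
  rewrite (_ : _ - _ = - (4 * kap) * (t - s)); last by ring.
  by rewrite normrM normrN (ger0_norm k4).
have cfx : continuous (fun z : R * R => k - 4 * kap * (z.2 - x0) - amol e a0 a z.1 z.2).
  move=> z; apply: cvgB; last exact: (continuous_amol kr e0).
  apply: (@continuous_comp _ _ _ snd (fun t => k - 4 * kap * (t - x0))); first exact: cvg_snd.
  apply: (@lipschitz_cont _ _ (4 * kap)) => t s.
  rewrite (_ : _ - _ = - (4 * kap) * (t - s)); last by ring.
  by rewrite normrM normrN (ger0_norm k4).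
have c2pF : continuous (fun z : R * R => 2 * pos (F z.1 z.2)).
  by move=> z; apply: cvgM; [exact: cvg_cst|exact: cpF].
have eta0 : 0 <= eta by rewrite etaE divr_ge0// mulr_ge0 ?sqr_ge0// ltW.
have lin c r : `|r| <= rho -> `|c - 4 * kap * r| <= `|c| + 4 * kap * rho.
  move=> hr; rewrite (le_trans (ler_normB _ _))// lerD2l normrM (ger0_norm k4).
  by rewrite ler_wpM2l.
split.
- by move=> t x; exact: sqr_ge0.
- exists (Num.max (`|t0| + rho) (`|x0| + rho)) => t x h.
  have := pos_bumpF_box t x kap0 rho0 etaE; have p0 := pos_ge0 (F t x).
  have out r r0 : `|r0| + rho < `|r| -> \1_`[r0 - rho, r0 + rho] r = 0 :> R.
    move=> hr; rewrite indicE memNset//= in_itv/= => /andP[h1 h2].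
    have k1 := ler_norm r0; have k2 := ler_norm (- r0); rewrite normrN in k2.
    by move: hr; rewrite ltNge => /negP; apply; rewrite ler_norml; apply/andP; split; lra.
  suff -> : \1_`[t0 - rho, t0 + rho] t * \1_`[x0 - rho, x0 + rho] x = 0 :> R.
    by rewrite mulr0 => hp; rewrite (_ : pos _ = 0) ?expr0n//; apply/eqP; rewrite eq_le hp.
  case: h => h; [rewrite (out t t0) ?mul0r//|rewrite (out x x0) ?mulr0//].
    by apply: le_lt_trans h; rewrite le_max lexx.
  by apply: le_lt_trans h; rewrite le_max lexx orbT.
- by move=> t x; apply: is_derive_sqr_pos; exact: bumpF_dt.
- by move=> t x; apply: is_derive_sqr_pos; exact: bumpF_dx.
- by move=> z; apply: cvgM; exact: cpF.
- by move=> z; apply: cvgM; [exact: c2pF|exact: cft].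
- by move=> z; apply: cvgM; [exact: c2pF|exact: cfx].
- apply: (@bfs_bump _ (`|q| + 4 * kap * rho + M ^+ 2 / 2)) => // z h1 h2.
  by rewrite (le_trans (ler_normD _ _))// lerD ?lin// (gmol_le _ _ kr e0).
- apply: (@bfs_bump _ (`|k| + 4 * kap * rho + 2 * M)) => // z h1 h2.
  by rewrite (le_trans (ler_normB _ _))// lerD ?lin// amol_le.
- rewrite (_ : (fun x => pos (F 0 x) ^+ 2) = (fun x => 0 * \1_`[0, 1] x)).
    by apply: bfsZ; exact: bfs_box.
  apply/funext => x; rewrite mul0r.
  have := pos_bumpF_box 0 x kap0 rho0 etaE; have p0 := pos_ge0 (F 0 x).
  have i0 : \1_`[t0 - rho, t0 + rho] 0 = 0 :> R.
    by rewrite indicE memNset//= in_itv/= => /andP[h1 h2]; lra.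
  rewrite i0 mul0r mulr0 => hp; rewrite (_ : pos _ = 0) ?expr0n//.
  by apply/eqP; rewrite eq_le hp.
Qed.

End bump.
End Bump.

Section TouchingLemma.
Context {R : realType}.
Implicit Types (t x y s k e q c v kap eta rho r B K d : R).
Local Notation mu := (@lebesgue_measure R).
Local Notation leb2 := (@leb2 R).
Variables (M : R) (a0 : R -> R) (a : R -> R -> R).

Lemma amol_mol e t x : 0 < e -> e <= t ->
  amol e a0 a t x = mol (fun z : R * R => a z.1 z.2) e (t, x).
Proof. by move=> e0 et; rewrite /amol kerp_left ?mul0r ?add0r//; lra. Qed.

Lemma int_small_box t x r : 0 < r -> r < t ->
  \int[leb2]_(z in halfplane) (\1_`[t - r, t + r] z.1 * \1_`[x - r, x + r] z.2) =
  4 * r ^+ 2.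
Proof.
move=> r0 rt; rewrite int_prod; [|exact: bfs_box|exact: bfs_box].
rewrite (_ : \int[mu]_(s in `]0, +oo[) \1_`[t - r, t + r] s =
    \int[mu]_s (\1_`[t - r, t + r] s : R)).
  by rewrite !int_box; [ring|lra|lra].
rewrite Rintegral_mkcond; apply: eq_ln_int => s.
rewrite patchE mem_setE in_itv/= andbT; case: ltP => // s0.
by rewrite indicE memNset//= in_itv/= => /andP[h1 h2]; lra.
Qed.

Section local.
Variables (e v q k kap eta rho t0 x0 : R).
Local Notation F := (bumpF a0 a e v q k kap eta t0 x0).
Hypothesis touch : forall t x,
  v + q * (t - t0) + k * (x - x0) - kap * ((t - t0) ^+ 2 + (x - x0) ^+ 2) - eta
  <= pot e a0 a t x.

Lemma pos_bumpF_out t x : 0 < kap -> 0 < rho -> eta = kap * rho ^+ 2 / 2 ->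
  ~~ ((t0 - rho <= t <= t0 + rho) && (x0 - rho <= x <= x0 + rho)) ->
  pos (F t x) = 0.
Proof.
move=> kap0 rho0 etaE h; have hb := pos_bumpF_box touch t x kap0 rho0 etaE.
apply/eqP; rewrite eq_le pos_ge0 andbT (le_trans hb)//.
move: h; rewrite negb_and => /orP[h|h].
  by rewrite [\1_`[t0 - _, _] _]indicE memNset ?mul0r ?mulr0//= in_itv/=; exact/negP.
by rewrite [\1_`[x0 - _, _] _]indicE memNset ?mulr0//= in_itv/=; exact/negP.
Qed.

(** The bump equals [eta] at its centre, and its Lipschitz bounds near it do not involve [e]; it
    therefore stays above [eta / 2] on a box whose size [r] is independent of [e]. *)
Lemma pos_bumpF_center r K t x : kruzhkov M a0 a -> 0 < e -> 0 < kap -> 0 <= eta ->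
  v = pot e a0 a t0 x0 -> `|q| <= K -> `|k| <= K -> 0 < r -> r <= 1 ->
  ((K + M ^+ 2 / 2) + (K + 2 * M) + 4 * kap) * r <= eta / 2 ->
  eta / 2 * (\1_`[t0 - r, t0 + r] t * \1_`[x0 - r, x0 + r] x) <= pos (F t x).
Proof.
move=> kr e0 kap0 eta0 vE qK kK r0 r1 small.
have M0 := kr_M_ge0 kr.
have [ht|ht] := boolP (t0 - r <= t <= t0 + r); last first.
  rewrite [\1_`[t0 - _, _] _]indicE memNset ?mul0r ?mulr0 ?pos_ge0//= in_itv/=.
  exact/negP.
have [hx|hx] := boolP (x0 - r <= x <= x0 + r); last first.
  rewrite [\1_`[x0 - _, _] _]indicE memNset ?mulr0 ?pos_ge0//= in_itv/=.
  exact/negP.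
rewrite (in_box ht) (in_box hx) !mulr1 /pos le_max; apply/orP; left.
have dt : `|t - t0| <= r by rewrite ler_norml; lra.
have dx : `|x - x0| <= r by rewrite ler_norml; lra.
(* [r <= 1] bounds the quadratic terms by linear ones, so that one linear smallness condition on [r]
   is enough. *)
have sq u : `|u| <= r -> u ^+ 2 <= r.
  move=> ur; rewrite -(real_normK (num_real u)) expr2 -[leRHS]mulr1.
  by rewrite ler_pM// (le_trans ur).
have K0 : 0 <= K by exact: le_trans qK.
have h1 : `|q * (t - t0)| <= K * r by rewrite normrM ler_pM.
have h2 : `|k * (x - x0)| <= K * r by rewrite normrM ler_pM.
have h3 := pot_lip t0 x0 t x kr e0; rewrite -vE in h3.
have h4 : M ^+ 2 / 2 * `|t0 - t| <= M ^+ 2 / 2 * r.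
  by rewrite distrC ler_wpM2l// divr_ge0// sqr_ge0.
have h5 : 2 * M * `|x0 - x| <= 2 * M * r by rewrite distrC ler_wpM2l// mulr_ge0.
have h6 : kap * (t - t0) ^+ 2 <= kap * r by apply: ler_wpM2l; [exact: ltW|exact: sq].
have h7 : kap * (x - x0) ^+ 2 <= kap * r by apply: ler_wpM2l; [exact: ltW|exact: sq].
have {}h3 := le_trans h3 (lerD h4 h5).
move: h1 h2 h3; rewrite !ler_norml => /andP[h1 _] /andP[h2 _] /andP[h3 _].
rewrite /bumpF /parab [leRHS](_ : _ = (v - pot e a0 a t x) + q * (t - t0) + k * (x - x0)
  - 2 * (kap * (t - t0) ^+ 2) - 2 * (kap * (x - x0) ^+ 2) + eta); last by ring.
rewrite (_ : _ * r = K * r + (M ^+ 2 / 2 * r + 2 * M * r) + K * r + 4 * (kap * r)) in small;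
  last by ring.
move: (v - pot _ _ _ _ _) (q * _) (k * _) (kap * (t - t0) ^+ 2)
  (kap * (x - x0) ^+ 2) (K * r) (M ^+ 2 / 2 * r) (2 * M * r) (kap * r) h1 h2 h3 h6 h7 small
  => *; lra.
Qed.

End local.
End TouchingLemma.

Section Supersolution.
Context {R : realType}.
Implicit Types (t x y s k e q c v kap eta rho r B K d P : R).
Local Notation mu := (@lebesgue_measure R).
Local Notation leb2 := (@leb2 R).
Variables (M : R) (a0 : R -> R) (a : R -> R -> R).

(** [touching_pointwise] is multiplied by [2 F^+] and integrated. The left side is nonnegative by
    the Kruzhkov and mass inequalities. On the right the gain [- c F^+] amounts to at least
    [2 * eta * c * r ^+ 2], whereas the mollification error is at most half of that by the choice of
    [d]. *)
Lemma not_touched_below e q k c kap K B P eta rho r d t0 x0 tmin :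
  kruzhkov M a0 a -> 0 < e -> 0 < c -> 0 < kap -> 0 <= K -> P = M + K ->
  `|q| <= K -> `|k| <= K -> q + k ^+ 2 / 2 <= - c ->
  0 < tmin -> e <= tmin / 2 -> tmin <= t0 -> t0 <= B -> `|x0| <= B ->
  0 < rho -> rho <= tmin / 2 -> rho <= 1 -> (4 * kap + 2 * kap * P) * rho <= c / 2 ->
  eta = kap * rho ^+ 2 / 2 ->
  0 < r -> r <= tmin / 2 -> r <= 1 ->
  ((K + M ^+ 2 / 2) + (K + 2 * M) + 4 * kap) * r <= eta / 2 ->
  4 * (1 + P ^+ 2 / c) * (1 + P) * d <= c * r ^+ 2 ->
  \int[leb2]_(z in halfplane) (\1_`[tmin / 2, B + 1] z.1 * \1_(seg (B + 1)) z.2 *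
     `|mol (fun z : R * R => a z.1 z.2) e z - a z.1 z.2|) <= d ->
  \int[leb2]_(z in halfplane) (\1_`[tmin / 2, B + 1] z.1 * \1_(seg (B + 1)) z.2 *
     `|mol (fun z : R * R => a z.1 z.2 ^+ 2 / 2) e z - a z.1 z.2 ^+ 2 / 2|) <= d ->
  ~ (forall t x, pot e a0 a t0 x0 + q * (t - t0) + k * (x - x0)
       - kap * ((t - t0) ^+ 2 + (x - x0) ^+ 2) - eta <= pot e a0 a t x).
Proof.
move=> kr e0 c0 kap0 K0 PE qK kK qk tm0 et tt0 t0B x0B rho0 rhot rho1 small etaE
  r0 rt r1 rsmall dsmall Ea Eg touch.
have M0 := kr_M_ge0 kr.
have eta0 : 0 < eta by rewrite etaE divr_gt0// mulr_gt0// exprn_gt0.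
have P0 : 0 <= P by rewrite PE addr_ge0.
set w := fun z : R * R => \1_`[tmin / 2, B + 1] z.1 * \1_(seg (B + 1)) z.2 : R.
pose F := bumpF a0 a e (pot e a0 a t0 x0) q k kap eta t0 x0.
pose phit t x := 2 * pos (F t x) * (q - 4 * kap * (t - t0) + gmol e a t x).
pose phix t x := 2 * pos (F t x) * (k - 4 * kap * (x - x0) - amol e a0 a t x).
have rt0 : rho < t0 by clear -rhot tt0 tm0; lra.
have test : test_C1 (fun t x => pos (F t x) ^+ 2) phit phix.
  exact: (@test_C1_bump _ M a0 a e (pot e a0 a t0 x0) q k kap eta rho t0 x0 touch).
have F0 x : pos (F 0 x) = 0.
  apply: (pos_bumpF_out touch kap0 rho0 etaE).
  by apply/negP => /andP[/andP[h1 h2] _]; clear -h1 rt0; lra.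
have z1 (f : R -> R) : \int[mu]_x (f x * pos (F 0 x) ^+ 2) = 0.
  rewrite (@eq_ln_int _ _ (fun=> 0)); last by move=> x; rewrite F0 expr0n/= mulr0.
  by rewrite Rintegral_cst// mul0r.
(* The Kruzhkov constant is the space slope [k] of the paraboloid at its centre. *)
have i1 := kr_ineq kr k test; rewrite z1 addr0 in i1.
have i2 := test_mass_ge0 kr test.
rewrite (@eq_ln_int _ _ (fun=> 0)) in i2; last by move=> x; rewrite F0 expr0n.
rewrite Rintegral_cst// mul0r addr0 in i2.
pose X (z : R * R) := `|a z.1 z.2 - k| *
  (phit z.1 z.2 + (a z.1 z.2 + k) / 2 * phix z.1 z.2).
have bX : bfs leb2 X := bfs_entropy k (kr_meas kr) (kr_bd kr) test.
have bt : bfs leb2 (fun z : R * R => phit z.1 z.2) := test_bfs_t test.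
have ba := @bfs_box_mol _ (fun z : R * R => a z.1 z.2) M (kr_meas kr)
  (fun z => kr_bd kr z.1 z.2) e (tmin / 2) (B + 1) e0.
have bg := @bfs_box_mol _ (fun z : R * R => a z.1 z.2 ^+ 2 / 2) (M ^+ 2 / 2)
  (measurable_kr_sq kr) (fun z => kr_sq_le kr z.1 z.2) e (tmin / 2) (B + 1) e0.
have bs : bfs leb2 (fun z : R * R => \1_`[t0 - r, t0 + r] z.1 * \1_`[x0 - r, x0 + r] z.2).
  by apply: bfs_prod; exact: bfs_box.
pose C2 := 1 + P ^+ 2 / c.
have C20 : 0 <= C2 by rewrite addr_ge0// divr_ge0 ?sqr_ge0// ltW.
have Pc0 : 0 <= P / c by rewrite divr_ge0// ltW.
pose ea (z : R * R) := w z * `|mol (fun z : R * R => a z.1 z.2) e z - a z.1 z.2|.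
pose eg (z : R * R) := w z *
  `|mol (fun z : R * R => a z.1 z.2 ^+ 2 / 2) e z - a z.1 z.2 ^+ 2 / 2|.
pose sm (z : R * R) : R := \1_`[t0 - r, t0 + r] z.1 * \1_`[x0 - r, x0 + r] z.2.
have key : \int[leb2]_(z in halfplane) (P / c * X z + phit z.1 z.2) <=
  \int[leb2]_(z in halfplane) (4 * eta * C2 * (eg z + P * ea z) - c * (eta / 2) * sm z).
  apply: hp_le_int.
  - by apply: bfsD => //; exact: bfsZ.
  - apply: bfsB; last exact: bfsZ.
    by apply: bfsZ; apply: bfsD => //; exact: bfsZ.
  case=> t x tpos; rewrite /halfplane/= in tpos.
  have sF := pos_bumpF_center t x kr e0 kap0 (ltW eta0) erefl qK kK r0 r1 rsmall.
  rewrite -/(F t x) in sF.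
  have w0 : 0 <= w (t, x) by rewrite mulr_ge0// in_box_ge0.
  have eg0 : 0 <= eg (t, x) by rewrite mulr_ge0.
  have ea0 : 0 <= ea (t, x) by rewrite mulr_ge0.
  have cs : c * (eta / 2) * sm (t, x) <= c * pos (F t x).
    by rewrite -[c * (eta / 2) * _]mulrA; apply: ler_wpM2l; [exact: ltW|exact: sF].
  have [hin|hout] := boolP ((t0 - rho <= t <= t0 + rho) && (x0 - rho <= x <= x0 + rho));
    last first.
    have Fz : pos (F t x) = 0 by exact: (pos_bumpF_out touch kap0 rho0 etaE).
    rewrite /X /phit /phix/= Fz !(mulr0, mul0r, addr0); rewrite Fz mulr0 in cs.
    have : 0 <= 4 * eta * C2 * (eg (t, x) + P * ea (t, x)).
      by rewrite !mulr_ge0// ?addr_ge0// ?mulr_ge0// ltW.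
    by move: (4 * eta * C2 * _) (c * (eta / 2) * _) cs => u1 u2 cs; clear -cs => h; lra.
  move/andP: hin => [/andP[h1 h2] /andP[h3 h4]].
  have dt : `|t - t0| <= rho by rewrite ler_norml; clear -h1 h2; lra.
  have dx : `|x - x0| <= rho by rewrite ler_norml; clear -h3 h4; lra.
  have te : e <= t by clear -et rhot tt0 h1; lra.
  have amk : `|a t x - k| <= P.
    by rewrite PE (le_trans (ler_normB _ _))// lerD// (kr_bd kr).
  have apk : `|a t x + k| <= P.
    by rewrite PE (le_trans (ler_normD _ _))// lerD// (kr_bd kr).
  (* The bounds [rho <= tmin / 2] and [rho <= 1] place the support of the bump in the box where the
     mollification errors are measured. *)
  have w1 : w (t, x) = 1.
    move: x0B; rewrite ler_norml => /andP[x01 x02].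
    have b1 : tmin / 2 <= t <= B + 1 by clear -tt0 rhot rho1 t0B h1 h2; lra.
    have b2 : - (B + 1) <= x <= B + 1 by clear -x01 x02 rho1 h3 h4; lra.
    by rewrite /w/= (in_box b1) mul1r /seg (in_box b2).
  have pw := @touching_pointwise _ c kap P q k (a t x) (amol e a0 a t x) (gmol e a t x)
    (t - t0) (x - x0) rho c0 (ltW kap0) P0 amk apk qk dt dx small.
  have pF0 := pos_ge0 (F t x).
  have pF1 : pos (F t x) <= 2 * eta.
    have := pos_bumpF_box touch t x kap0 rho0 etaE.
    have b1 : t0 - rho <= t <= t0 + rho by rewrite h1.
    have b2 : x0 - rho <= x <= x0 + rho by rewrite h3.
    by rewrite (in_box b1) (in_box b2) !mulr1.
  have egE : eg (t, x) = `|gmol e a t x - a t x ^+ 2 / 2| by rewrite /eg w1 mul1r.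
  have eaE : ea (t, x) = `|amol e a0 a t x - a t x|.
    by rewrite /ea w1 mul1r amol_mol.
  rewrite -egE -eaE -/C2 in pw.
  rewrite [leLHS](_ : _ = 2 * pos (F t x) * (P / c * (`|a t x - k| *
    ((q - 4 * kap * (t - t0) + gmol e a t x) +
     (a t x + k) / 2 * (k - 4 * kap * (x - x0) - amol e a0 a t x))) +
    (q - 4 * kap * (t - t0) + gmol e a t x))); last first.
    by rewrite /X /phit /phix/=; ring.
  have pF2 : 0 <= 2 * pos (F t x) by rewrite mulr_ge0.
  apply: (le_trans (ler_wpM2l pF2 pw)).
  have C2e : 0 <= C2 * (eg (t, x) + P * ea (t, x)).
    by rewrite mulr_ge0// addr_ge0// mulr_ge0.
  have := ler_wpM2r C2e pF1.
  rewrite -[4 * eta * C2 * _]mulrA.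
  move: (C2 * _) C2e (pos (F t x)) pF0 (c * (eta / 2) * sm (t, x)) cs => y y0 p p0 u hu hy.
  by clear -y0 p0 hu hy; lra.
have I1 : 0 <= \int[leb2]_(z in halfplane) (P / c * X z + phit z.1 z.2).
  rewrite hp_intD//; last exact: bfsZ.
  by rewrite addr_ge0// hp_intZ// mulr_ge0.
have {key I1} := le_trans I1 key.
rewrite hp_intB; [|by apply: bfsZ; apply: bfsD => //; exact: bfsZ|exact: bfsZ].
rewrite hp_intZ; last by apply: bfsD => //; exact: bfsZ.
rewrite hp_intD//; last exact: bfsZ.
have rt0' : r < t0 by clear -rt tt0 tm0; lra.
rewrite hp_intZ// hp_intZ// int_small_box//.
have h1 : 4 * eta * C2 * (\int[leb2]_(z in halfplane) eg z +
    P * \int[leb2]_(z in halfplane) ea z) <= eta * (c * r ^+ 2).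
  apply: (@le_trans _ _ (eta * (4 * C2 * (1 + P) * d))); last first.
    by rewrite ler_wpM2l// ltW.
  rewrite [leRHS](_ : _ = 4 * eta * C2 * (d + P * d)); last by ring.
  rewrite ler_wpM2l ?mulr_ge0 ?(ltW eta0)//.
  by rewrite lerD// ler_wpM2l.
have h2 : 0 < eta * (c * r ^+ 2) by rewrite !mulr_gt0// exprn_gt0.
rewrite (_ : c * (eta / 2) * (4 * r ^+ 2) = 2 * (eta * (c * r ^+ 2))); last by field.
by move: (4 * eta * C2 * _) (eta * (c * r ^+ 2)) h1 h2 => u1 u2; clear => h1 h2 h; lra.
Qed.

(** The order of the quantifiers is the point: [eta] and the threshold for [n] are fixed before the
    touching point and the slopes, because the comparison finds these only after [n]. The choices
    are made in the order [rho], [eta], [r], [d], [n]. *)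
Lemma pot_not_touched_below c kap K B tmin : kruzhkov M a0 a ->
  0 < c -> 0 < kap -> 0 <= K -> 0 < tmin ->
  exists2 eta, 0 < eta & \forall n \near \oo, forall t0 x0 q k,
    tmin <= t0 -> t0 <= B -> `|x0| <= B -> `|q| <= K -> `|k| <= K ->
    q + k ^+ 2 / 2 <= - c ->
    ~ (forall t x, pot (inv_succ n) a0 a t0 x0 + q * (t - t0) + k * (x - x0)
       - kap * ((t - t0) ^+ 2 + (x - x0) ^+ 2) - eta <= pot (inv_succ n) a0 a t x).
Proof.
move=> kr c0 kap0 K0 tm0; have M0 := kr_M_ge0 kr.
have [P PE] : exists P, P = M + K by eexists.
have P0 : 0 <= P by rewrite PE addr_ge0.
have [S SE] : exists S, S = 4 * kap + 2 * kap * P by eexists.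
have S0 : 0 < S by rewrite SE ltr_wpDr ?mulr_ge0 ?mulr_gt0// ltW.
have pick b l : 0 < b -> 0 < l ->
    exists rho, [/\ 0 < rho, rho <= tmin / 2, rho <= 1 & l * rho <= b].
  move=> b0 l0; exists (Num.min (Num.min (tmin / 2) 1) (b / l)); split.
  - by rewrite !lt_min !divr_gt0// ltr01.
  - by rewrite ge_min ge_min lexx.
  - by rewrite ge_min ge_min lexx orbT.
  - by rewrite mulrC -ler_pdivlMr// ge_min lexx orbT.
have c2 : 0 < c / 2 by rewrite divr_gt0.
have [rho [rho0 rhot rho1 small]] := pick (c / 2) S c2 S0.
have [eta etaE] : exists eta, eta = kap * rho ^+ 2 / 2 by eexists.
have eta0 : 0 < eta by rewrite etaE divr_gt0// mulr_gt0// exprn_gt0.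
have [Q QE] : exists Q, Q = (K + M ^+ 2 / 2) + (K + 2 * M) + 4 * kap by eexists.
have Q0 : 0 < Q.
  by rewrite QE ltr_wpDl ?mulr_gt0// !addr_ge0 ?mulr_ge0 ?sqr_ge0// invr_ge0.
have eta2 : 0 < eta / 2 by rewrite divr_gt0.
have [r [r0 rt r1 rsmall]] := pick (eta / 2) Q eta2 Q0.
have [D DE] : exists D, D = 4 * (1 + P ^+ 2 / c) * (1 + P) by eexists.
have D0 : 0 < D.
  by rewrite DE !mulr_gt0// ltr_wpDr// divr_ge0 ?sqr_ge0// ltW.
have [d d0 dsmall] : exists2 d, 0 < d & D * d <= c * r ^+ 2.
  exists (c * r ^+ 2 / D); last by rewrite mulrC divfK// gt_eqF.
  by rewrite divr_gt0// mulr_gt0// exprn_gt0.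
have tm2 : 0 < tmin / 2 by rewrite divr_gt0.
have na := @near_mol_L1 _ (fun z : R * R => a z.1 z.2) M (kr_meas kr)
  (fun z => kr_bd kr z.1 z.2) (tmin / 2) (B + 1) d tm2 d0.
have ng := @near_mol_L1 _ (fun z : R * R => a z.1 z.2 ^+ 2 / 2) (M ^+ 2 / 2)
  (measurable_kr_sq kr) (fun z => kr_sq_le kr z.1 z.2) (tmin / 2) (B + 1) d tm2 d0.
have ne := near_inv_succ_le tm2.
exists eta => //.
near=> n.
move=> t0 x0 q k h1 h2 h3 h4 h5 h6.
rewrite SE in small; rewrite QE in rsmall; rewrite DE in dsmall.
apply: (@not_touched_below (inv_succ n) q k c kap K B P eta rho r d t0 x0 tmin) => //.
- exact: inv_succ_gt0.
- by near: n.
- by apply: ltW; near: n.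
- by apply: ltW; near: n.
Unshelve. all: by end_near. Qed.

End Supersolution.

(** * The Hopf-Lax formula *)

Section PerspectiveBound.
Context {R : realType}.
Implicit Types (t x y s k e q c v kap eta r B K T lam w : R).
Variables (M : R) (a0 : R -> R) (a : R -> R -> R).

(** Exact expansion of the perspective function [(w^2 + lam) / (2 * s)] at [(w0, s0)]. For
    [lam >= 0] this function is convex, and the remainder is visibly of one sign. *)
Lemma persp_taylor s s0 w w0 lam : 0 < s -> 0 < s0 ->
  (w0 ^+ 2 + lam) / (2 * s0) - (w ^+ 2 + lam) / (2 * s) =
  - ((w0 ^+ 2 + lam) / (2 * s0 ^+ 2)) * (s0 - s) + w0 / s0 * (w0 - w)
  - 2^-1 * ((s0 * (w - w0) - w0 * (s - s0)) ^+ 2 + lam * (s - s0) ^+ 2) / (s * s0 ^+ 2).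
Proof. by move=> sp s0p; field; rewrite !gt_eqF. Qed.

(** The curvature blows up as [s] tends to 0; [tau] and [tau / 2] keep both points away from there
    and give a bound uniform in [w]. *)
Lemma persp_taylor_le s s0 w w0 lam tau W : 0 < tau -> tau <= s0 -> tau / 2 <= s ->
  `|w0| <= W -> 0 <= lam ->
  - ((w0 ^+ 2 + lam) / (2 * s0 ^+ 2)) * (s0 - s) + w0 / s0 * (w0 - w)
  - (2 / tau + (2 * W ^+ 2 + lam) / tau ^+ 3) * ((s0 - s) ^+ 2 + (w0 - w) ^+ 2)
  <= (w0 ^+ 2 + lam) / (2 * s0) - (w ^+ 2 + lam) / (2 * s).
Proof.
move=> tau0 ts0 ts w0W lam0.
have s00 : 0 < s0 by lra.
have sp : 0 < s by lra.
have W0 : 0 <= W by exact: le_trans w0W.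
rewrite (persp_taylor w w0 lam sp s00) lerD2l lerN2.
have w2 : w0 ^+ 2 <= W ^+ 2.
  by rewrite -(real_normK (num_real w0)) lerXn2r// nnegrE.
set A := (s0 * (w - w0) - w0 * (s - s0)) ^+ 2.
set ds := (s0 - s) ^+ 2; set dw := (w0 - w) ^+ 2.
have ds0 : 0 <= ds by exact: sqr_ge0.
have dw0 : 0 <= dw by exact: sqr_ge0.
have hA : A <= 2 * (s0 ^+ 2 * dw + W ^+ 2 * ds).
  have h1 : A <= 2 * (s0 ^+ 2 * dw + w0 ^+ 2 * ds).
    rewrite -subr_ge0 /A /dw /ds.
    rewrite (_ : _ - _ = (s0 * (w - w0) + w0 * (s - s0)) ^+ 2); last by ring.
    exact: sqr_ge0.
  apply: (le_trans h1); rewrite ler_wpM2l// lerD2l.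
  by apply: ler_wpM2r.
rewrite (_ : (s - s0) ^+ 2 = ds); last by rewrite /ds; ring.
have den : 0 < s * s0 ^+ 2 by rewrite mulr_gt0// exprn_gt0.
rewrite ler_pdivrMr//.
have d1 : tau / 2 * s0 ^+ 2 <= s * s0 ^+ 2 by rewrite ler_wpM2r// sqr_ge0.
have t2 : tau ^+ 2 <= s0 ^+ 2 by rewrite lerXn2r// nnegrE; lra.
have d2 : tau ^+ 3 / 2 <= s * s0 ^+ 2.
  apply: le_trans d1; rewrite [leLHS](_ : _ = tau / 2 * tau ^+ 2); last by ring.
  by rewrite ler_wpM2l// divr_ge0// ltW.
have Wl : 0 <= (2 * W ^+ 2 + lam) / tau ^+ 3.
  rewrite divr_ge0 ?exprn_ge0 ?(ltW tau0)//; apply: addr_ge0 => //.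
  by apply: mulr_ge0 => //; exact: sqr_ge0.
have p1 : s0 ^+ 2 * dw <= 2 / tau * dw * (s * s0 ^+ 2).
  rewrite [leLHS](_ : _ = 2 / tau * dw * (tau / 2 * s0 ^+ 2)); last first.
    by field; rewrite gt_eqF.
  by rewrite ler_wpM2l// mulr_ge0// divr_ge0// ltW.
have p2 : (W ^+ 2 + lam / 2) * ds <= (2 * W ^+ 2 + lam) / tau ^+ 3 * ds * (s * s0 ^+ 2).
  rewrite [leLHS](_ : _ = (2 * W ^+ 2 + lam) / tau ^+ 3 * ds * (tau ^+ 3 / 2)); last first.
    by field; rewrite gt_eqF.
  by rewrite ler_wpM2l// mulr_ge0.
have p3 : 0 <= 2 / tau * ds * (s * s0 ^+ 2).
  have t20 : 0 <= 2 / tau by rewrite divr_ge0// ltW.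
  by apply: mulr_ge0; [exact: mulr_ge0|exact: ltW].
have p4 : 0 <= (2 * W ^+ 2 + lam) / tau ^+ 3 * dw * (s * s0 ^+ 2).
  by apply: mulr_ge0; [exact: mulr_ge0|exact: ltW].
rewrite [leRHS](_ : _ = 2 / tau * ds * (s * s0 ^+ 2) + 2 / tau * dw * (s * s0 ^+ 2) +
  ((2 * W ^+ 2 + lam) / tau ^+ 3 * ds * (s * s0 ^+ 2) +
   (2 * W ^+ 2 + lam) / tau ^+ 3 * dw * (s * s0 ^+ 2))); last by ring.
have h5 : 2^-1 * (A + lam * ds) <= s0 ^+ 2 * dw + (W ^+ 2 + lam / 2) * ds by lra.
by apply: (le_trans h5); clear -p1 p2 p3 p4; lra.
Qed.

Lemma pot_initial_ge e t y : kruzhkov M a0 a -> 0 < e -> 0 <= t ->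
  prim a0 y - (4 * e * M + M ^+ 2 / 2 * e) - M ^+ 2 / 2 * t <= pot e a0 a t y.
Proof.
move=> kr e0 t0.
have h1 := pot_initial y kr e0.
have h2 := pot_lip (- e) y t y kr e0.
rewrite subrr normr0 mulr0 addr0 in h2.
rewrite (_ : - e - t = - (t + e)) ?normrN ?(ger0_norm (_ : 0 <= t + e)) in h2;
  [|lra|ring].
by move: h1 h2; rewrite !ler_norml => /andP[h1 _] /andP[_ h2]; lra.
Qed.

End PerspectiveBound.

Section HopfLaxLower.
Context {R : realType}.
Implicit Types (t x y s k e q c v kap eta r B K T lam w h sig : R).
Variables (M : R) (a0 : R -> R) (a : R -> R -> R).

(* For [lam > 0], [- ((x - y)^2 + lam) / (2 (T - t))] is a strict subsolution of the
   Hamilton-Jacobi equation, so it cannot touch the potential from below at an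
   approximate minimum of the difference away from [t = 0]. *)
Lemma pot_ge_hopf_lax T ts x h sig : kruzhkov M a0 a -> 0 < ts -> ts < T ->
  (forall y, h <= prim a0 y + (x - y) ^+ 2 / (2 * T)) -> 0 < sig ->
  \forall n \near \oo, h - sig <= pot (inv_succ n) a0 a ts x.
Proof.
move=> kr ts0 tsT hh sig0; have M0 := kr_M_ge0 kr.
have T0 : 0 < T by exact: lt_trans tsT.
have [L1 L1E] : exists L1, L1 = M ^+ 2 / 2 by eexists.
have [L2 L2E] : exists L2, L2 = 2 * M by eexists.
have L10 : 0 <= L1 by rewrite L1E divr_ge0// sqr_ge0.
have L20 : 0 <= L2 by rewrite L2E mulr_ge0.
(* At [(ts, x)] the comparison function then costs exactly [sig / 2]. *)
have [lam lamE] : exists lam, lam = sig * (T - ts) by eexists.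
have lam0 : 0 < lam by rewrite lamE mulr_gt0// subr_gt0.
(* Before [tmin] the potential has dropped by at most [sig / 4] through its Lipschitz bound in time,
   which leaves it too high for a minimum point. *)
have [tmin tminE] : exists tmin, tmin = sig / (4 * (L1 + 1)) by eexists.
have tmin0 : 0 < tmin by rewrite tminE divr_gt0// mulr_gt0// ltr_wpDl.
(* Comparing an approximate minimum point with [(ts, x)] bounds [(w0^2 + lam) / (2 * s0)] by
   [sig / 2 + L1 * T + L2 * |w0|], and [L2 * |w0|] is at most [w0^2 / (2 * T) + L2 ^+ 2 * T / 2].
   Hence [lam / (2 * s0) <= D], that is [tau <= s0]. *)
have [D DE] : exists D, D = sig / 2 + L1 * T + L2 ^+ 2 * T / 2 by eexists.
have D0 : 0 < D.
  have h1 : 0 <= L1 * T by rewrite mulr_ge0// ltW.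
  have h2 : 0 <= L2 ^+ 2 * T / 2 by rewrite divr_ge0// mulr_ge0 ?sqr_ge0// ltW.
  by rewrite DE; lra.
have [tau tauE] : exists tau, tau = lam / (2 * D) by eexists.
have tau0 : 0 < tau by rewrite tauE divr_gt0// mulr_gt0.
(* From the same comparison, [w0^2 <= 2 * T * (D + L2 * |w0|)], which fails when [|w0| > W]. *)
have [W WE] : exists W, W = 1 + 2 * T * (D + L2) by eexists.
have W1 : 1 <= W by rewrite WE lerDl mulr_ge0 ?addr_ge0 ?mulr_ge0// ltW.
(* The strictness of the subsolution at [s0] is [lam / (2 * s0 ^+ 2)], and [s0 <= T]. *)
have [c cE] : exists c, c = lam / (2 * T ^+ 2) by eexists.
have c0 : 0 < c by rewrite cE divr_gt0// mulr_gt0// exprn_gt0.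
have [K KE] : exists K, K = (W ^+ 2 + lam) / (2 * tau ^+ 2) + W / tau by eexists.
have K1 : 0 <= (W ^+ 2 + lam) / (2 * tau ^+ 2).
  apply: divr_ge0; first by apply: addr_ge0; [exact: sqr_ge0|exact: ltW].
  by apply: mulr_ge0 => //; exact: sqr_ge0.
have K2 : 0 <= W / tau by rewrite divr_ge0 ?(ltW tau0)//; lra.
have K0 : 0 <= K by rewrite KE addr_ge0.
have [r rE] : exists r, r = Num.min tmin tau / 2 by eexists.
have r0 : 0 < r by rewrite rE divr_gt0// lt_min tmin0.
have [kap1 kap1E] : exists kap1, kap1 = 2 / tau + (2 * W ^+ 2 + lam) / tau ^+ 3.
  by eexists.
have kap10 : 0 <= kap1.
  rewrite kap1E addr_ge0 ?divr_ge0 ?exprn_ge0 ?(ltW tau0)//.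
  by apply: addr_ge0; [apply: mulr_ge0 => //; exact: sqr_ge0|exact: ltW].
(* [kap1] is the curvature of the comparison function, used for times within [r] of [t0]. The second
   term makes the paraboloid drop faster than the Lipschitz functions involved at all other
   times. *)
have [kap kapE] : exists kap, kap = kap1 + 2 * (L1 + L2 + K) / r + 1 by eexists.
have kap2 : 0 <= 2 * (L1 + L2 + K) / r.
  by rewrite divr_ge0 ?(ltW r0)// mulr_ge0// !addr_ge0.
have kap0 : 0 < kap by rewrite kapE ltr_wpDl ?addr_ge0.
have [eta eta0 htouch] := pot_not_touched_below (T + `|x| + W) kr c0 kap0 K0 tmin0.
have small : exists2 d, 0 < d & 4 * d * M + L1 * d <= sig / 4.
  exists (sig / 4 / (4 * M + L1 + 1)).
    by rewrite divr_gt0 ?divr_gt0// ltr_wpDl// addr_ge0// mulr_ge0.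
  rewrite [leLHS](_ : _ = (4 * M + L1) * (sig / 4 / (4 * M + L1 + 1))); last by ring.
  by apply: mul_div_succ_le; rewrite ?divr_gt0// addr_ge0// mulr_ge0.
have [d d0 hd] := small.
near=> n.
have [e eE] : exists e : R, e = inv_succ n by eexists.
have e0 : 0 < e by rewrite eE; exact: inv_succ_gt0.
have ed : e <= d by rewrite eE; near: n; exact: near_inv_succ_le.
rewrite -eE leNgt; apply/negP => contra.
have touch : forall t0 x0 q k,
    tmin <= t0 -> t0 <= T + `|x| + W -> `|x0| <= T + `|x| + W -> `|q| <= K -> `|k| <= K ->
    q + k ^+ 2 / 2 <= - c ->
    ~ (forall t y, pot e a0 a t0 x0 + q * (t - t0) + k * (y - x0)
       - kap * ((t - t0) ^+ 2 + (y - x0) ^+ 2) - eta <= pot e a0 a t y).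
  by rewrite eE; near: n; exact: htouch.
pose A := pot e a0 a.
have lipA t y s z : A t y - L1 * `|t - s| - L2 * `|y - z| <= A s z.
  have := pot_lip t y s z kr e0; rewrite -L1E -L2E -/(A t y) -/(A s z).
  by rewrite ler_norml => /andP[_]; clear; lra.
pose m t y := A t y + ((x - y) ^+ 2 + lam) / (2 * (T - t)).
have sT0 t : t < T -> 0 < 2 * (T - t) by move=> tT; rewrite mulr_gt0// subr_gt0.
have low t y : 0 <= t -> t < T -> h - sig / 4 - L1 * t <= m t y.
  move=> t0 tT.
  have h1 := pot_initial_ge y kr e0 t0; rewrite -L1E -/(A t y) in h1.
  have h2 : 4 * e * M + L1 * e <= sig / 4.
    by apply: le_trans hd; rewrite lerD ?ler_wpM2r ?ler_wpM2l.
  have h3 : (x - y) ^+ 2 / (2 * T) <= ((x - y) ^+ 2 + lam) / (2 * (T - t)).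
    apply: ler_pM.
    - exact: sqr_ge0.
    - by rewrite invr_ge0 mulr_ge0// ltW.
    - by rewrite lerDl ltW.
    - by rewrite lef_pV2 ?posrE ?sT0 ?mulr_gt0// ler_wpM2l// gerBl.
  have h4 := hh y; rewrite /m.
  by move: (A t y) (prim a0 y) (_ / (2 * T)) (_ / (2 * (T - t))) (L1 * t) (4 * e * M + _)
    h1 h2 h3 h4; clear => *; lra.
pose E : set R := [set m z.1 z.2 | z in [set z : R * R | 0 <= z.1 < T]].
have mts : m ts x = A ts x + sig / 2.
  rewrite /m subrr expr0n/= add0r lamE; congr (_ + _).
  by field; rewrite gt_eqF// subr_gt0.
have Ets : E (m ts x) by exists (ts, x) => //=; rewrite (ltW ts0).
have Elb : has_lbound E.
  exists (h - sig / 4 - L1 * T) => _ [[t y] /= /andP[t0 tT] <-].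
  by apply: le_trans (low _ _ t0 tT); rewrite lerD2l lerN2 ler_wpM2l// ltW.
have Einf : has_inf E by split => //; exists (m ts x).
have infle t y : 0 <= t -> t < T -> inf E <= m t y.
  by move=> t0 tT; apply: ge_inf => //; exists (t, y) => //=; rewrite t0.
(* The point must be within [eta] of the infimum and also no worse than [(ts, x)]; if [(ts, x)] is
   itself within [eta], it is taken. *)
have [[t0 y0] [t00 t0T] hm] : exists2 z : R * R, 0 <= z.1 /\ z.1 < T &
    m z.1 z.2 < inf E + eta /\ m z.1 z.2 <= m ts x.
  have [hts|hts] := ltP (m ts x) (inf E + eta).
    by exists (ts, x) => /=; split => //; exact: ltW.
  have [_ [z /= /andP[z0 zT] <-] hz] := inf_adherent eta0 Einf.
  by exists z => //; split => //; exact: ltW (lt_le_trans hz hts).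
rewrite /= in t00 t0T hm; case: hm => hm1 hm2.
have [s0 s0E] : exists s0, s0 = T - t0 by eexists.
have [w0 w0E] : exists w0, w0 = x - y0 by eexists.
have s00 : 0 < s0 by rewrite s0E subr_gt0.
have AtsE : A ts x < h - sig by exact: contra.
have tmt0 : tmin <= t0.
  have h1 := low t0 y0 t00 t0T.
  have h2 : sig / 4 < L1 * t0.
    by move: (m t0 y0) h1 hm2 => u h1 hm2; clear -h1 hm2 mts AtsE; lra.
  rewrite tminE leNgt; apply/negP => h3.
  have h4 : L1 * t0 <= sig / 4.
    apply: (@le_trans _ _ ((L1 + 1) * t0)); first by rewrite ler_wpM2r// lerDl.
    apply: (@le_trans _ _ ((L1 + 1) * (sig / (4 * (L1 + 1))))).
      by rewrite ler_wpM2l ?addr_ge0// ltW.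
    by rewrite le_eqVlt; apply/orP; left; apply/eqP; field; rewrite gt_eqF// ltr_wpDl.
  by move: h2; rewrite ltNge h4.
have mle : A ts x - L1 * T - L2 * `|w0| + (w0 ^+ 2 + lam) / (2 * s0) <= A ts x + sig / 2.
  rewrite -mts; apply: le_trans hm2; rewrite /m -s0E -w0E lerD2r.
  apply: le_trans (lipA ts x t0 y0); rewrite -w0E lerD2r lerD2l lerN2 ler_wpM2l//.
  by rewrite ler_norml; clear -t00 t0T ts0 tsT; lra.
have w0sq : w0 ^+ 2 = `|w0| ^+ 2 by rewrite real_normK// num_real.
have s0T : s0 <= T by rewrite s0E gerBl.
have wle : w0 ^+ 2 / (2 * T) <= w0 ^+ 2 / (2 * s0).
  by rewrite ler_wpM2l ?sqr_ge0// lef_pV2 ?posrE ?mulr_gt0// ler_wpM2l.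
have tau_s0 : tau <= s0.
  have h1 : L2 * `|w0| - L2 ^+ 2 * T / 2 <= w0 ^+ 2 / (2 * T).
    rewrite -subr_ge0 w0sq.
    rewrite (_ : _ - _ = (`|w0| - L2 * T) ^+ 2 / (2 * T)); last by field; rewrite gt_eqF.
    by rewrite divr_ge0 ?sqr_ge0// mulr_ge0// ltW.
  have h2 : lam / (2 * s0) <= D.
    move: mle; rewrite mulrDl DE.
    by move: (A ts x) (w0 ^+ 2 / (2 * s0)) (w0 ^+ 2 / (2 * T)) (lam / (2 * s0)) h1 wle;
      clear => *; lra.
  rewrite tauE ler_pdivrMr ?mulr_gt0//; move: h2; rewrite ler_pdivrMr ?mulr_gt0//.
  by clear; lra.
have wW : `|w0| <= W.
  rewrite leNgt; apply/negP => Ww.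
  have h1 : w0 ^+ 2 / (2 * T) <= D + L2 * `|w0|.
    have h2 : 0 <= lam / (2 * s0) by rewrite divr_ge0 ?mulr_ge0// ltW.
    have h3 : 0 <= L2 ^+ 2 * T / 2 by rewrite divr_ge0// mulr_ge0 ?sqr_ge0// ltW.
    move: mle; rewrite mulrDl DE.
    by move: (A ts x) (w0 ^+ 2 / (2 * s0)) (w0 ^+ 2 / (2 * T)) (lam / (2 * s0)) wle h2 h3;
      clear => *; lra.
  move: h1; rewrite ler_pdivrMr ?mulr_gt0// w0sq => h1.
  have n1 : 1 <= `|w0| by rewrite (le_trans W1)// ltW.
  have h2 : W * `|w0| < `|w0| ^+ 2 by rewrite expr2 ltr_pM2r// (lt_le_trans ltr01).
  have h3 : (D + L2 * `|w0|) * (2 * T) <= W * `|w0|.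
    rewrite WE.
    have h4 : D * (2 * T) <= D * (2 * T) * `|w0|.
      by rewrite ler_peMr// !mulr_ge0// ltW.
    by move: n1 h4; clear; lra.
  by have := lt_le_trans h2 (le_trans h1 h3); rewrite ltxx.
have [q qE] : exists q, q = - ((w0 ^+ 2 + lam) / (2 * s0 ^+ 2)) by eexists.
have [k kE] : exists k, k = w0 / s0 by eexists.
have Wpos : 0 < W by exact: lt_le_trans W1.
have w2W : w0 ^+ 2 <= W ^+ 2 by rewrite w0sq lerXn2r// nnegrE// ltW.
have s2 : tau ^+ 2 <= s0 ^+ 2 by rewrite lerXn2r// nnegrE ltW.
have qK : `|q| <= K.
  rewrite qE normrN ger0_norm; last first.
    apply: divr_ge0; first by apply: addr_ge0; [exact: sqr_ge0|exact: ltW].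
    by apply: mulr_ge0 => //; exact: sqr_ge0.
  rewrite KE (le_trans _ (_ : (W ^+ 2 + lam) / (2 * tau ^+ 2) <= _))//; last by rewrite lerDl.
  apply: ler_pM.
  - by apply: addr_ge0; [exact: sqr_ge0|exact: ltW].
  - by rewrite invr_ge0; apply: mulr_ge0 => //; exact: sqr_ge0.
  - by rewrite lerD2r.
  - by rewrite lef_pV2 ?posrE ?mulr_gt0 ?exprn_gt0// ler_wpM2l.
have kK : `|k| <= K.
  rewrite kE normrM normfV (gtr0_norm s00) KE (le_trans _ (_ : W / tau <= _))//.
    by apply: ler_pM => //; rewrite ?invr_ge0 ?(ltW s00)// lef_pV2 ?posrE.
  by rewrite lerDr.
have qk : q + k ^+ 2 / 2 <= - c.
  rewrite qE kE (_ : _ + _ = - (lam / (2 * s0 ^+ 2))); last by field; rewrite gt_eqF.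
  rewrite lerN2 cE ler_wpM2l ?(ltW lam0)// lef_pV2 ?posrE ?mulr_gt0 ?exprn_gt0//.
  by rewrite ler_wpM2l// lerXn2r// nnegrE ltW.
apply: (touch t0 y0 q k tmt0 _ _ qK kK qk).
- by have := normr_ge0 x; clear -t0T Wpos; lra.
- rewrite (_ : y0 = x - w0); last by rewrite w0E; clear; ring.
  by rewrite (le_trans (ler_normB _ _))// lerD// lerDr ltW.
move=> t y.
(* Touching is required on the whole plane, also at times outside [[0, T[] where the comparison says
   nothing. Far from [t0] in time the Lipschitz bounds decide; otherwise [T - t >= tau / 2] and the
   Taylor bound holds for every [y]. *)
have [rt|rt] := ltP r `|t - t0|.
  have h1 := lipA t0 y0 t y.
  have h2 : q * (t - t0) <= K * `|t - t0|.
    by rewrite (le_trans (ler_norm _))// normrM ler_wpM2r.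
  have h3 : k * (y - y0) <= K * `|y - y0|.
    by rewrite (le_trans (ler_norm _))// normrM ler_wpM2r.
  rewrite (distrC t0 t) (distrC y0 y) in h1.
  have h4 : (L1 + L2 + K) * (`|t - t0| + `|y - y0|) <=
      kap * ((t - t0) ^+ 2 + (y - y0) ^+ 2).
    rewrite -(real_normK (num_real (t - t0))) -(real_normK (num_real (y - y0))).
    have := normr_ge0 (t - t0); have := normr_ge0 (y - y0).
    move: `|t - t0| `|y - y0| rt => u v rt v0 u0.
    have h5 : r * (u + v) <= 2 * (u ^+ 2 + v ^+ 2).
      have h6 := sqr_ge0 (u - v).
      have h7 : r * (u + v) <= u * (u + v) by rewrite ler_wpM2r ?addr_ge0// ltW.
      have h8 : 0 <= u ^+ 2 by exact: sqr_ge0.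
      have h9 : 0 <= v ^+ 2 by exact: sqr_ge0.
      by apply: (le_trans h7); clear -h6 h8 h9; lra.
    have h6 : 2 * (L1 + L2 + K) / r * (u ^+ 2 + v ^+ 2) <= kap * (u ^+ 2 + v ^+ 2).
      rewrite ler_wpM2r ?addr_ge0 ?sqr_ge0// kapE.
      by clear -kap10; lra.
    apply: le_trans h6.
    rewrite [leRHS](_ : _ = (L1 + L2 + K) / r * (2 * (u ^+ 2 + v ^+ 2))); last by ring.
    rewrite [leLHS](_ : _ = (L1 + L2 + K) / r * (r * (u + v))); last first.
      by field; rewrite gt_eqF.
    by rewrite ler_wpM2l// divr_ge0 ?(ltW r0)// !addr_ge0.
  have h5 : 0 <= L1 * `|y - y0| by rewrite mulr_ge0.
  have h6 : 0 <= L2 * `|t - t0| by rewrite mulr_ge0.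
  rewrite -/(A t0 y0) -/(A t y).
  by move: (A t0 y0) (A t y) (kap * _) (q * _) (k * _) h1 h2 h3 h4 h5 h6;
    clear -eta0 => *; lra.
have rtm : r <= tmin / 2 by rewrite rE ler_wpM2r ?invr_ge0// ge_min lexx.
have rtau : r <= tau / 2 by rewrite rE ler_wpM2r ?invr_ge0// ge_min lexx orbT.
move: rt; rewrite ler_norml => /andP[rt1 rt2].
have tpos : 0 <= t by clear -rt1 rtm tmt0 tmin0; lra.
have st : tau / 2 <= T - t by clear -rt2 rtau tau_s0 s0E; lra.
have tT : t < T by clear -st tau0; lra.
have h1 := infle t y tpos tT.
have h2 := @persp_taylor_le _ (T - t) s0 (x - y) w0 lam tau W tau0 tau_s0 st wW (ltW lam0).
rewrite -kap1E -qE -kE (_ : s0 - (T - t) = t - t0) in h2; last by rewrite s0E; clear; ring.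
rewrite (_ : w0 - (x - y) = y - y0) in h2; last by rewrite w0E; clear; ring.
have h3 : kap1 * ((t - t0) ^+ 2 + (y - y0) ^+ 2) <= kap * ((t - t0) ^+ 2 + (y - y0) ^+ 2).
  rewrite ler_wpM2r ?addr_ge0 ?sqr_ge0// kapE.
  by clear -kap2; lra.
rewrite /m -s0E -w0E in hm1 h1.
rewrite -/(A t0 y0) -/(A t y).
move: (A t0 y0) (A t y) (kap * _) (kap1 * _) (q * _) (k * _) (_ / (2 * s0))
  (_ / (2 * (T - t))) (inf E) hm1 h1 h2 h3.
by clear => *; lra.
Unshelve. all: by end_near. Qed.

End HopfLaxLower.

Section HopfLaxUpper.
Context {R : realType}.
Implicit Types (t x y s z e q C T sig r : R).
Local Notation mu := (@lebesgue_measure R).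
Local Notation leb2 := (@leb2 R).

Lemma mvt_segment (F f : R -> R) (x y : R) : (forall z : R, is_derive z 1 F (f z)) ->
  exists2 z, `|z - x| <= `|y - x| & F y - F x = f z * (y - x).
Proof.
move=> dF.
have cF a b : {within `[a, b], continuous F}.
  apply: continuous_subspaceT => z; apply: differentiable_continuous.
  by apply/derivable1_diffP; have [] := dF z.
case: (ltgtP x y) => [xy|yx|->].
- have [z] := MVT xy (fun z _ => dF z) (cF x y).
  rewrite in_itv/= => /andP[z1 z2] E; exists z => //.
  by rewrite !ger0_norm; lra.
- have [z] := MVT yx (fun z _ => dF z) (cF y x).
  rewrite in_itv/= => /andP[z1 z2] E; exists z.
    by rewrite !ler0_norm; lra.
  by rewrite -opprB E; ring.
- by exists y => //; rewrite !subrr mulr0.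
Qed.

(** Chain rule along a line: the mean value theorem is applied in each variable, and Lipschitz
    partial derivatives make the remainder quadratic. *)
Lemma is_derive_line (A At Ax : R -> R -> R) C q y t :
  (forall t x, is_derive t 1 (A^~ x) (At t x)) ->
  (forall t x, is_derive x 1 (A t) (Ax t x)) ->
  (forall t x s z, `|At t x - At s z| <= C * `|t - s| + C * `|x - z|) ->
  (forall t x s z, `|Ax t x - Ax s z| <= C * `|t - s| + C * `|x - z|) ->
  is_derive t 1 (fun s => A s (y + q * s)) (At t (y + q * t) + q * Ax t (y + q * t)).
Proof.
move=> dt dx lt lx.
have C0 : 0 <= C.
  have := lt 0 0 1 0; rewrite subrr normr0 mulr0 addr0 sub0r normrN normr1 mulr1.
  exact: le_trans.
apply: (@is_derive_quad _ _ _ _ (C + C * `|q| + `|q| * (C * `|q|))) => s _.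
have [r1 hr1 E1] := mvt_segment t s (fun r => dt r (y + q * s)).
have [r2 hr2 E2] := mvt_segment (y + q * t) (y + q * s) (dx t).
have yE : y + q * s - (y + q * t) = q * (s - t) by ring.
rewrite yE in hr2 E2.
rewrite (_ : _ - _ - _ = (At r1 (y + q * s) - At t (y + q * t)) * (s - t) +
   (Ax t r2 - Ax t (y + q * t)) * (q * (s - t))); last first.
  rewrite !mulrBl -E1 -E2; ring.
have h1 := lt r1 (y + q * s) t (y + q * t); rewrite yE normrM in h1.
have h2 := lx t r2 t (y + q * t); rewrite subrr normr0 mulr0 add0r in h2.
rewrite normrM in hr2.
have {}h1 : `|At r1 (y + q * s) - At t (y + q * t)| <= (C + C * `|q|) * `|s - t|.
  by apply: (le_trans h1); rewrite mulrDl -[C * _ * _]mulrA lerD2r ler_wpM2l.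
have {}h2 : `|Ax t r2 - Ax t (y + q * t)| <= C * `|q| * `|s - t|.
  by apply: (le_trans h2); rewrite -mulrA ler_wpM2l.
rewrite -(real_normK (num_real (s - t))) (le_trans (ler_normD _ _))// !normrM.
rewrite [leRHS](_ : _ = (C + C * `|q|) * `|s - t| * `|s - t| +
  C * `|q| * `|s - t| * (`|q| * `|s - t|)); last by ring.
by rewrite lerD// ler_wpM2r// mulr_ge0.
Qed.

Variables (M : R) (a0 : R -> R) (a : R -> R -> R).

Lemma gmol_amol_ge0 e q t x : kruzhkov M a0 a -> 0 < e -> e <= t ->
  0 <= gmol e a t x - q * amol e a0 a t x + q ^+ 2 / 2.
Proof.
move=> kr e0 et; rewrite amol_mol// /gmol /mol/=.
pose kk (w : R * R) := kerc e (w.1 - t) * kerc e (w.2 - x).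
have bkk : bfs leb2 kk.
  by apply: (@bfs_prod _ (fun r => kerc e (r - t)) (fun r => kerc e (r - x))); exact: bfs_kerc.
have kk0 w : 0 <= kk w by rewrite mulr_ge0 ?kerc_ge0.
have ikk : \int[leb2]_(w in halfplane) kk w = 1.
  rewrite (@int_prod _ (fun r => kerc e (r - t)) (fun r => kerc e (r - x)));
    [|exact: bfs_kerc|exact: bfs_kerc].
  by rewrite int_kerc// int_kerc_pos// kerp_left ?subr0 ?mulr1//; lra.
have ba := bfs_kr kr bkk; have bg := bfs_kr_sq kr bkk.
have -> : q ^+ 2 / 2 = \int[leb2]_(w in halfplane) (q ^+ 2 / 2 * kk w).
  by rewrite hp_intZ// ikk mulr1.
rewrite -hp_intZ// -hp_intB//; last exact: bfsZ.
rewrite -hp_intD//; [|apply: bfsB => //; exact: bfsZ|exact: bfsZ].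
apply: Rintegral_ge0 => w _.
rewrite [leRHS](_ : _ = kk w * ((a w.1 w.2 - q) ^+ 2 / 2)); last by rewrite /kk; field.
by rewrite mulr_ge0// divr_ge0// sqr_ge0.
Qed.

Lemma pot_le_hopf_lax T x y sig : kruzhkov M a0 a -> 0 < T -> 0 < sig ->
  \forall n \near \oo,
    pot (inv_succ n) a0 a T x <= prim a0 y + (x - y) ^+ 2 / (2 * T) + sig.
Proof.
move=> kr T0 sig0; have M0 := kr_M_ge0 kr.
have [q qE] : exists q, q = (x - y) / T by eexists.
(* [S * e] collects the error of [pot_initial] at time [- e] and the Lipschitz cost of moving from
   [(- e, y)] to [(e, y + q * e)]; the line is followed only from time [e], where the kernel has
   full mass. *)
have [S SE] : exists S, S = 4 * M + M ^+ 2 + 2 * M * `|q| by eexists.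
have S0 : 0 <= S by rewrite SE !addr_ge0 ?mulr_ge0 ?sqr_ge0.
have d0 : 0 < sig / (S + 1) by rewrite divr_gt0// ltr_wpDl.
near=> n.
have [e eE] : exists e : R, e = inv_succ n by eexists.
have e0 : 0 < e by rewrite eE; exact: inv_succ_gt0.
have ed : e <= sig / (S + 1) by rewrite eE; near: n; exact: near_inv_succ_le.
have eT : e <= T by rewrite eE; near: n; exact: near_inv_succ_le.
rewrite -eE.
have [C C1 C2] : exists2 C, 8 / e * (M ^+ 2 / 2) <= C & 16 / e * M <= C.
  by exists (Num.max (8 / e * (M ^+ 2 / 2)) (16 / e * M)); rewrite le_max lexx ?orbT.
have dl t : is_derive t 1 (fun s => pot e a0 a s (y + q * s))
    (- gmol e a t (y + q * t) + q * amol e a0 a t (y + q * t)).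
  apply: (@is_derive_line (pot e a0 a) (fun t x => - gmol e a t x) (amol e a0 a) C).
  - by move=> t' x'; exact: (pot_dt t' x' kr e0).
  - by move=> t' x'; exact: (pot_dx t' x' kr e0).
  - move=> t' x' s z; rewrite -opprD normrN.
    apply: (le_trans (gmol_lip t' x' s z kr e0)).
    by rewrite lerD// ler_wpM2r.
  - move=> t' x' s z; apply: (le_trans (amol_lip t' x' s z kr e0)).
    by rewrite lerD// ler_wpM2r.
have hline : pot e a0 a T (y + q * T) - pot e a0 a e (y + q * e) <= q ^+ 2 / 2 * (T - e).
  move: eT; rewrite le_eqVlt => /predU1P[->|eT']; first by rewrite !subrr mulr0.
  have cF : {within `[e, T], continuous (fun s => pot e a0 a s (y + q * s))}.
    apply: continuous_subspaceT => z; apply: differentiable_continuous.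
    by apply/derivable1_diffP; have [] := dl z.
  have [z] := MVT eT' (fun z _ => dl z) cF.
  rewrite in_itv/= => /andP[ez _] ->.
  apply: ler_wpM2r; first by rewrite subr_ge0 ltW.
  have := gmol_amol_ge0 q (y + q * z) kr e0 (ltW ez).
  by move: (gmol _ _ _ _) (q * amol _ _ _ _ _) (q ^+ 2 / 2); clear => *; lra.
have xE : y + q * T = x by rewrite qE divfK ?gt_eqF//; ring.
rewrite xE in hline.
have h1 := pot_initial y kr e0.
have h2 := pot_lip e (y + q * e) (- e) y kr e0.
rewrite (_ : y + q * e - y = q * e) in h2; last by ring.
rewrite (_ : e - - e = 2 * e) in h2; last by ring.
rewrite !normrM normr_nat (gtr0_norm e0) in h2.
have h3 : S * e <= sig.
  apply: (le_trans (ler_wpM2l S0 ed)); exact: mul_div_succ_le.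
have h4 : q ^+ 2 / 2 * (T - e) <= (x - y) ^+ 2 / (2 * T).
  rewrite (_ : (x - y) ^+ 2 / (2 * T) = q ^+ 2 / 2 * T); last first.
    by rewrite qE; field; rewrite gt_eqF.
  by rewrite ler_wpM2l ?divr_ge0 ?sqr_ge0// gerBl ltW.
move: h1 h2; rewrite !ler_norml => /andP[_ h1] /andP[_ h2].
rewrite SE in h3.
move: (pot e a0 a T x) (pot _ _ _ _ _) (pot _ _ _ _ _) (prim a0 y)
  (q ^+ 2 / 2 * (T - e)) ((x - y) ^+ 2 / (2 * T)) `|q| hline h1 h2 h3 h4.
by clear => *; lra.
Unshelve. all: by end_near. Qed.

End HopfLaxUpper.

(** * Primitives of the initial data *)

Section Primitive.
Context {R : realType}.
Implicit Types (x y c p : R) (f g : R -> R).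
Local Notation mu := (@lebesgue_measure R).

Lemma lebesgue_measure_translate c (A : set R) : measurable A ->
  pushforward mu (fun x : R => x + c : measurableTypeR R) A = mu A.
Proof.
move=> mA; apply/esym/lebesgue_measure_unique => //=; first exact: measurable_funD.
move=> _ _ [[a b]] _ <-.
rewrite /pushforward (_ : _ @^-1` _ = `](a - c), (b - c)]%classic); last first.
  by apply/seteqP; split=> x /=; rewrite !in_itv/= ltrBlDr lerBrDr.
rewrite !lebesgue_measure_itv/= !lte_fin ltrD2r; case: ifP => // _.
by rewrite -!EFinB; congr EFin; ring.
Qed.

Lemma int_translate c f : bfs mu f -> bfs mu (fun x => f (x + c)) ->
  \int[mu]_x f (x + c) = \int[mu]_x f x.
Proof.
move=> bf bg; congr fine.
have mf : measurable_fun setT (EFin \o f) by apply/measurable_EFinP; case: bf.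
have ig := bfs_integrable measurableT bg.
have mc : measurable_fun setT (fun x : R => x + c : measurableTypeR R).
  by apply: measurable_funD.
transitivity (\int[pushforward mu (fun x : R => (x + c)%R : measurableTypeR R)]_x (f x)%:E)%E.
  by rewrite integral_pushforward.
by apply: eq_measure_integral => //= A mA _; exact: lebesgue_measure_translate.
Qed.

Lemma bfs_step_bounded f M a b : measurable_fun setT f -> (forall x, `|f x| <= M) ->
  bfs mu (fun y => step a b y * f y).
Proof. by move=> mf fM; apply: (bfsM (bfs_step a b) mf fM). Qed.

Lemma int_step a b : \int[mu]_y (step a b y : R) = b - a.
Proof.
wlog ab : a b / a <= b.
  move=> W; case: (leP a b) => [/W//|/ltW /W] h.
  rewrite (@eq_ln_int _ _ (fun y => -1 * step b a y)); last first.
    by move=> y; rewrite /step; ring.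
  by rewrite ln_intZ ?h; [ring|exact: bfs_step].
rewrite (@eq_ln_int _ _ (\1_(`[a, b[ : set R))); last first.
  move=> y; rewrite /step indicE mem_setE in_itv/= leNgt.
  by have := le_trans ab; case: (ltP y a) => ya; case: (leP b y) => yb /=;
    rewrite ?subrr ?subr0// => _; have := le_lt_trans ab (le_lt_trans yb ya); rewrite ltxx.
rewrite /Rintegral integral_indic//.
rewrite setIT [X in fine X](_ : _ = (b - a)%:E)//.
rewrite [LHS]lebesgue_measure_itv/= lte_fin.
move: ab; rewrite le_eqVlt => /predU1P[->|->]; last by rewrite -EFinB.
by rewrite ltxx subrr.
Qed.

Section bounded.
Variables (f : R -> R) (M : R).
Hypotheses (mf : measurable_fun setT f) (fM : forall x, `|f x| <= M).

Lemma prim_sub x y : prim f y - prim f x = \int[mu]_r (step x y r * f r).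
Proof.
rewrite /prim -ln_intB; [|exact: bfs_step_bounded fM|exact: bfs_step_bounded fM].
by apply: eq_ln_int => r; rewrite /step; ring.
Qed.

Lemma prim_lip x y : `|prim f x - prim f y| <= M * `|x - y|.
Proof.
wlog xy : x y / x <= y.
  move=> W; case: (leP x y) => [/W//|/ltW /W].
  by rewrite distrC [in X in _ -> X]distrC => h; rewrite distrC; move: h; rewrite (distrC x y).
rewrite distrC prim_sub (distrC x y) (@ger0_norm _ (y - x)) ?subr_ge0// -int_step mulrC.
apply: line_bound => //; [exact: bfs_step|exact: bfs_step|].
move=> r; rewrite ger0_norm// /step subr_ge0.
by case: (leP y r) => //= /(le_trans xy) ->.
Qed.

Lemma prim_cst_add c x : prim (fun y => c + f y) x = c * x + prim f x.
Proof.
rewrite /prim (@eq_ln_int _ _ (fun y => c * step 0 x y + step 0 x y * f y)); last first.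
  by move=> y; ring.
rewrite ln_intD; [|exact/bfsZ/bfs_step|exact: bfs_step_bounded fM].
by rewrite ln_intZ ?int_step ?subr0//; exact: bfs_step.
Qed.

(** For [cr <= cl] the smaller linear function is [cl * x] on the left of 0 and [cr * x] on the
    right, as in the Riemann data; with the states in the opposite order a maximum would appear. *)
Lemma prim_riemann cl cr x : cr <= cl ->
  prim (riemann_data cl cr f) x = prim f x + Num.min (cl * x) (cr * x).
Proof.
move=> cc; have [x0|x0] := leP 0 x.
  have -> : Num.min (cl * x) (cr * x) = cr * x.
    by apply/min_idPr; rewrite ler_wpM2r.
  rewrite addrC -prim_cst_add; apply: eq_ln_int => r; rewrite /step /riemann_data.
  case: (ltP r 0) => // r0.
  by rewrite (leNgt x r) (lt_le_trans r0 x0) subrr !mul0r.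
have -> : Num.min (cl * x) (cr * x) = cl * x.
  by apply/min_idPl; rewrite ler_wnM2r// ltW.
rewrite addrC -prim_cst_add; apply: eq_ln_int => r; rewrite /step /riemann_data.
case: (ltP r 0) => // r0.
by rewrite (ltW (lt_le_trans x0 r0)) subrr !mul0r.
Qed.

Lemma prim_periodic p x : 0 < p -> (forall y, f (y + p) = f y) ->
  (\int[mu]_(y in `[0%R, p]%classic) (f y)%:E = 0)%E -> prim f (x + p) = prim f x.
Proof.
move=> p0 fp f0.
have shift a b : \int[mu]_r (step (a + p) (b + p) r * f r) = \int[mu]_r (step a b r * f r).
  have E : (fun r => step (a + p) (b + p) (r + p) * f (r + p)) = (fun r => step a b r * f r).
    by apply/funext => r; rewrite /step fp !lerD2r.
  rewrite -(@int_translate p (fun r => step (a + p) (b + p) r * f r)).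
  - by apply: eq_ln_int => r; exact: (congr1 (fun g => g r) E).
  - exact: bfs_step_bounded fM.
  - by rewrite E; exact: bfs_step_bounded fM.
apply/eqP; rewrite -subr_eq0; apply/eqP.
(* Translation by [p] identifies the integral from [p] to [x + p] with that from 0 to [x]; what
   remains is the integral over one period. *)
rewrite (_ : _ - _ = (prim f (x + p) - prim f (0 + p)) + (prim f p - prim f 0) -
  (prim f x - prim f 0)); last by rewrite add0r; ring.
rewrite !prim_sub shift addrAC subrr add0r.
rewrite -[RHS](_ : \int[mu]_(r in `[0, p]) f r = 0); last by rewrite /Rintegral f0.
have bf := bfs_step_bounded 0 p mf fM.
transitivity (\int[mu]_(r in `[0, p[) (step 0 p r * f r)).
  rewrite [RHS]Rintegral_mkcond; apply: eq_ln_int => r; rewrite patchE mem_setE in_itv/=.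
  rewrite /step leNgt; case: (ltP r 0) => //= r0; last first.
    by case: (leP p r); rewrite ?subrr ?mul0r.
  by rewrite (leNgt p) (lt_trans r0 p0) subrr mul0r.
have E r : r \in `[0, p[%classic -> step 0 p r * f r = f r.
  rewrite inE/= in_itv/= => /andP[r0 rp].
  by rewrite /step r0 leNgt rp subr0 mul1r.
rewrite -Rintegral_itv_bndo_bndc; first exact: eq_Rintegral.
apply: (@eq_integrable _ _ _ mu `[0, p[%classic _ (EFin \o (fun r => step 0 p r * f r))).
- exact: measurable_itv.
- by move=> r rp /=; rewrite E.
- by apply: bfs_integrable => //; exact: measurable_itv.
Qed.

End bounded.
End Primitive.

(** * Properties of the Hopf-Lax formula and convergence of the potential *)

Section HopfLaxFormula.
Context {R : realType}.
Implicit Types (t x y c p M h sig : R) (A B : R -> R).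

Definition hopf_lax A t x : R := inf (range (fun y => A y + (x - y) ^+ 2 / (2 * t))).

Definition lipR M A := forall x y, `|A x - A y| <= M * `|x - y|.

Lemma lipR_affine M A c C : lipR M A -> `|c| <= C -> lipR (C + M) (fun y => c * y + A y).
Proof.
move=> hA cC y z; rewrite (_ : _ - _ = c * (y - z) + (A y - A z)); last by ring.
by rewrite mulrDl (le_trans (ler_normD _ _))// lerD// normrM ler_wpM2r.
Qed.

Lemma le_hopf_lax A t x h : (forall y, h <= A y + (x - y) ^+ 2 / (2 * t)) ->
  h <= hopf_lax A t x.
Proof.
by move=> hA; apply: lb_le_inf; [exists (A 0 + (x - 0) ^+ 2 / (2 * t)), 0|move=> _ [y _ <-]].
Qed.

(** A real [inf] carries information only for a set bounded below. The Lipschitz loss [M * |x - y|]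
    is absorbed by the quadratic term through completion of the square. *)
Lemma hopf_lax_has_lbound M A t x : lipR M A -> 0 < t ->
  has_lbound (range (fun y => A y + (x - y) ^+ 2 / (2 * t))).
Proof.
move=> hA t0; exists (A x - M ^+ 2 * t / 2) => _ [y _ <-].
have h : A x - A y <= M * `|x - y| := le_trans (ler_norm _) (hA x y).
suff : M * `|x - y| <= (x - y) ^+ 2 / (2 * t) + M ^+ 2 * t / 2 by lra.
rewrite -[(x - y) ^+ 2]real_normK ?num_real// -subr_ge0.
rewrite (_ : _ - _ = (`|x - y| - M * t) ^+ 2 / (2 * t)); last first.
  by field; rewrite gt_eqF.
by rewrite divr_ge0 ?sqr_ge0// mulr_ge0// ltW.
Qed.

Lemma hopf_lax_le M A t x y : lipR M A -> 0 < t ->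
  hopf_lax A t x <= A y + (x - y) ^+ 2 / (2 * t).
Proof. by move=> hA t0; apply: ge_inf; [exact: hopf_lax_has_lbound hA t0|exists y]. Qed.

Lemma hopf_lax_approx M A t x sig : lipR M A -> 0 < t -> 0 < sig ->
  exists y, A y + (x - y) ^+ 2 / (2 * t) < hopf_lax A t x + sig.
Proof.
move=> hA t0 s0; have [] := @inf_adherent _ (range (fun y => A y + (x - y) ^+ 2 / (2 * t))) _ s0.
  split; last exact: hopf_lax_has_lbound hA t0.
  by exists (A 0 + (x - 0) ^+ 2 / (2 * t)), 0.
by move=> _ [y _ <-] hy; exists y.
Qed.

(** Completing the square in [y]: a linear datum [c * y] moves the vertex of the parabola by
    [c * t]. *)
Lemma hopf_lax_galilei M A t x c : lipR M A -> 0 < t ->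
  hopf_lax (fun y => c * y + A y) t x = c * x - c ^+ 2 * t / 2 + hopf_lax A t (x - c * t).
Proof.
move=> hA t0.
have hcA := lipR_affine hA (lexx `|c|).
have E y : c * y + A y + (x - y) ^+ 2 / (2 * t) =
    c * x - c ^+ 2 * t / 2 + (A y + (x - c * t - y) ^+ 2 / (2 * t)).
  by field; rewrite gt_eqF.
apply/eqP; rewrite eq_le; apply/andP; split; last first.
  by apply: le_hopf_lax => y; rewrite E lerD2l; exact: hopf_lax_le hA t0.
rewrite -lerBlDl; apply: le_hopf_lax => y.
by rewrite lerBlDl -E; exact: hopf_lax_le hcA t0.
Qed.

Lemma hopf_lax_min M A B t x : lipR M A -> lipR M B -> 0 < t ->
  hopf_lax (fun y => Num.min (A y) (B y)) t x = Num.min (hopf_lax A t x) (hopf_lax B t x).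
Proof.
move=> hA hB t0.
have hAB : lipR M (fun y => Num.min (A y) (B y)).
  move=> y z; have := hA y z; have := hB y z; rewrite !ler_norml => /andP[? ?] /andP[? ?].
  by rewrite /Num.min; case: ltP => ?; case: ltP => ?; apply/andP; split; lra.
apply/eqP; rewrite eq_le le_min -andbA; apply/and3P; split.
- apply: le_hopf_lax => y; apply: (le_trans (hopf_lax_le x y hAB t0)).
  by rewrite lerD2r ge_min lexx.
- apply: le_hopf_lax => y; apply: (le_trans (hopf_lax_le x y hAB t0)).
  by rewrite lerD2r ge_min lexx orbT.
- apply: le_hopf_lax => y; rewrite ge_min.
  have h1 := hopf_lax_le x y hA t0; have h2 := hopf_lax_le x y hB t0.
  by rewrite /Num.min; case: ltP => _; apply/orP; [left|right].
Qed.

Lemma int_periodic A p (k : int) x : (forall y, A (y + p) = A y) -> A (x + k%:~R * p) = A x.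
Proof.
move=> hA.
have hn n y : A (y + n%:R * p) = A y.
  elim: n => [|n IH]; first by rewrite mul0r addr0.
  by rewrite -natr1 mulrDl mul1r addrA hA.
case: k => n; first exact: hn.
by rewrite NegzE mulrNz mulNr -[in RHS](subrK (n.+1%:R * p) x) hn.
Qed.

Lemma hopf_lax_periodic A t p (k : int) x : (forall y, A (y + p) = A y) ->
  hopf_lax A t (x + k%:~R * p) = hopf_lax A t x.
Proof.
move=> hA; congr inf; apply/seteqP; split=> _ [y _ <-].
  exists (y - k%:~R * p) => //.
  rewrite -[in RHS](subrK (k%:~R * p) y) (int_periodic _ _ hA) subrK; congr (_ + _ ^+ 2 / _).
  by ring.
exists (y + k%:~R * p) => //; rewrite (int_periodic _ _ hA); congr (_ + _ ^+ 2 / _).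
by ring.
Qed.

(* The space-time shear that relates the two states of the shock is a whole
   number of periods at the times considered. *)
Lemma hopf_lax_states_sub M A cl cr t p (k : int) x : lipR M A -> 0 < t ->
  (forall y, A (y + p) = A y) ->
  (cl - cr) * t = k%:~R * p ->
  hopf_lax (fun y => cl * y + A y) t x - hopf_lax (fun y => cr * y + A y) t x =
  (cl - cr) * (x - (cl + cr) / 2 * t).
Proof.
move=> lA t0 hA kp; rewrite !(hopf_lax_galilei _ _ lA t0).
have -> : x - cr * t = x - cl * t + k%:~R * p by rewrite -kp; ring.
by rewrite (hopf_lax_periodic _ _ _ hA); field.
Qed.

Lemma cvg_pot M (a0 : R -> R) (a : R -> R -> R) t x : kruzhkov M a0 a -> 0 < t ->
  pot (inv_succ n) a0 a t x @[n --> \oo] --> hopf_lax (prim a0) t x.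
Proof.
move=> kr t0; apply/cvgrPdist_le => sig sig0.
have M0 := kr_M_ge0 kr.
have lA : lipR M (prim a0) := prim_lip (kr_meas0 kr) (kr_bd0 kr).
have s2 : 0 < sig / 2 by lra.
have [y hy] := hopf_lax_approx x lA t0 s2.
have up := pot_le_hopf_lax x y kr t0 s2.
(* The comparison function explodes at its final time, so the lower bound for final time [t] is
   available only at [t - d]; the Lipschitz bound in time, uniform in the scale, closes the gap. *)
have [d [d0 dt dM]] : exists d, [/\ 0 < d, d < t & M ^+ 2 / 2 * d <= sig / 2].
  exists (Num.min (t / 2) (sig / 2 / (M ^+ 2 / 2 + 1))); split.
  - by rewrite lt_min !divr_gt0// ltr_wpDl// divr_ge0// sqr_ge0.
  - by rewrite gt_min; apply/orP; left; lra.
  - apply: (@le_trans _ _ (M ^+ 2 / 2 * (sig / 2 / (M ^+ 2 / 2 + 1)))).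
      by rewrite ler_wpM2l ?ge_min ?lexx ?orbT// divr_ge0// sqr_ge0.
    by apply: mul_div_succ_le => //; rewrite divr_ge0// sqr_ge0.
have td0 : 0 < t - d by rewrite subr_gt0.
have tdt : t - d < t by rewrite gtrBl.
have lo := pot_ge_hopf_lax kr td0 tdt (fun y => hopf_lax_le x y lA t0) s2.
near=> n.
have h1 : pot (inv_succ n) a0 a t x <= prim a0 y + (x - y) ^+ 2 / (2 * t) + sig / 2.
  by near: n.
have h2 : hopf_lax (prim a0) t x - sig / 2 <= pot (inv_succ n) a0 a (t - d) x by near: n.
have := pot_lip t x (t - d) x kr (inv_succ_gt0 n).
rewrite subrr normr0 mulr0 addr0 subKr (gtr0_norm d0) => h3.
rewrite ler_distl; move: h3; rewrite ler_distl => /andP[h3 h4].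
by move: (pot _ _ _ _ _) (pot _ _ _ _ _) (hopf_lax _ _ _) (prim a0 y + _)
  (M ^+ 2 / 2 * d) hy dM
  h1 h2 h3 h4; clear => *; apply/andP; split; lra.
Unshelve. all: by end_near. Qed.

End HopfLaxFormula.

(** * The shock curve *)

Section ShockCurve.
Context {R : realType}.
Implicit Types (t x y s e M L : R).
Local Notation mu := (@lebesgue_measure R).
Local Notation leb2 := (@leb2 R).

Lemma leb2_ae_impl (P Q : R * R -> Prop) : (forall z, P z -> Q z) ->
  {ae leb2, forall z, P z} -> {ae leb2, forall z, Q z}.
Proof.
by move=> PQ [N [mN N0 PN]]; exists N; split=> // z nQ; apply: PN => /PQ.
Qed.

Lemma ae_eq_hp_int (f g : R * R -> R) : bfs leb2 f -> bfs leb2 g ->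
  {ae leb2, forall z, f z = g z} ->
  \int[leb2]_(z in halfplane) f z = \int[leb2]_(z in halfplane) g z.
Proof.
move=> [mf _] [mg _] fg; congr fine; apply: ae_eq_integral.
- exact: measurable_halfplane.
- by apply/measurable_EFinP; exact: measurable_funTS.
- by apply/measurable_EFinP; exact: measurable_funTS.
- by apply: leb2_ae_impl fg => z fgz _; rewrite fgz.
Qed.

(** Increments of [pot] in [x] see the solution only within [e] of the segment. For [e <= t] the
    correction by the initial data is absent, so [a0] and [b0] may differ. *)
Lemma pot_diff_ae e M (a0 b0 : R -> R) (a b : R -> R -> R) t x1 x2 (P : R * R -> Prop) :
  kruzhkov M a0 a -> kruzhkov M b0 b -> 0 < e -> e <= t -> x1 <= x2 ->
  {ae leb2, forall z, P z -> a z.1 z.2 = b z.1 z.2} ->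
  (forall s y, `|s - t| < e -> x1 - e < y -> y < x2 + e -> P (s, y)) ->
  pot e a0 a t x2 - pot e a0 a t x1 = pot e b0 b t x2 - pot e b0 b t x1.
Proof.
move=> ka kb e0 et xx ab HP.
rewrite !(pot_diff _ _ _ ka e0) !(pot_diff _ _ _ kb e0) kerp_left ?lerN2// !mul0r !add0r.
have bk : bfs leb2 (fun z : R * R => kerc e (z.1 - t) * trapeze e x1 x2 z.2).
  by apply: (@bfs_prod _ (fun r => kerc e (r - t))); [exact: bfs_kerc|exact: bfs_trapeze].
have ba := bfs_kr ka bk; have bb := bfs_kr kb bk.
apply: (ae_eq_hp_int ba bb).
apply: leb2_ae_impl ab => -[s y] /= abz.
have [st|st] := ltP `|s - t| e; last by rewrite (kerc_out e0 st) !mul0r.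
have [y1|y1] := ltP (x1 - e) y; last first.
  by rewrite /trapeze !kerp_left ?subrr ?mulr0 ?mul0r//; lra.
have [y2|y2] := ltP y (x2 + e); last first.
  by rewrite /trapeze !kerp_right ?subrr ?mulr0 ?mul0r//; lra.
by rewrite abz//; exact: HP.
Qed.

Lemma kruzhkov_le M M' (a0 : R -> R) (a : R -> R -> R) : M <= M' ->
  kruzhkov M a0 a -> kruzhkov M' a0 a.
Proof.
move=> MM [m m0 b b0 i]; split => //.
  by move=> t x; exact: le_trans (b t x) MM.
by move=> x; exact: le_trans (b0 x) MM.
Qed.

(** The limit of [pot_diff_ae] as the scale vanishes. Agreement is asked on a space-time
    neighbourhood of the segment at time [t], since an almost everywhere statement says nothing on a
    single line. *)
Lemma hopf_lax_sub_ae M1 M2 (a0 b0 : R -> R) (a b : R -> R -> R) t x1 x2 e1 (P : R * R -> Prop) :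
  kruzhkov M1 a0 a -> kruzhkov M2 b0 b -> 0 < t -> x1 <= x2 ->
  {ae leb2, forall z, P z -> a z.1 z.2 = b z.1 z.2} -> 0 < e1 ->
  (forall s y, `|s - t| < e1 -> x1 - e1 < y -> y < x2 + e1 -> P (s, y)) ->
  hopf_lax (prim a0) t x2 - hopf_lax (prim b0) t x2 =
  hopf_lax (prim a0) t x1 - hopf_lax (prim b0) t x1.
Proof.
move=> ka kb t0 xx ab e10 HP.
have {}ka : kruzhkov (Num.max M1 M2) a0 a by apply: kruzhkov_le ka; rewrite le_max lexx.
have {}kb : kruzhkov (Num.max M1 M2) b0 b by apply: kruzhkov_le kb; rewrite le_max lexx orbT.
have c x : pot (inv_succ n) a0 a t x - pot (inv_succ n) b0 b t x @[n --> \oo] -->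
    hopf_lax (prim a0) t x - hopf_lax (prim b0) t x
  by apply: cvgB; [exact: cvg_pot ka t0|exact: cvg_pot kb t0].
rewrite -(cvg_lim (@Rhausdorff R) (c x2)); apply: cvg_lim; first exact: Rhausdorff.
apply: cvg_trans (c x1); apply: near_eq_cvg.
near=> n.
have e0 : 0 < inv_succ n :> R := inv_succ_gt0 n.
have et : inv_succ n <= t by near: n; exact: near_inv_succ_le.
have ee : inv_succ n <= e1 by near: n; exact: near_inv_succ_le.
rewrite /=.
have := pot_diff_ae ka kb e0 et xx ab.
suff : forall s y, `|s - t| < inv_succ n -> x1 - inv_succ n < y -> y < x2 + inv_succ n -> P (s, y).
  move=> H /(_ H).
  move: (pot _ _ _ _ _) (pot _ _ _ _ _) (pot _ _ _ _ _) (pot _ _ _ _ _); clear => *; lra.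
move: (inv_succ n) ee => e ee s y h1 h2 h3; apply: HP; [exact: lt_le_trans h1 ee| |]; lra.
Unshelve. all: by end_near. Qed.

Lemma measurable_riemann_data (cl cr : R) (w : R -> R) : measurable_fun setT w ->
  measurable_fun setT (riemann_data cl cr w).
Proof.
move=> mw; apply: measurable_fun_ifT; [exact: measurable_fun_ltr| |];
  exact: measurable_funD.
Qed.

(** The regularity of the shock curve turns a strict inequality at time [t] into the neighbourhood
    that [hopf_lax_sub_ae] asks for. Taking [|L| + 1] covers a constant [L] that is zero or
    negative. *)
Lemma lipschitz_after_below (TS : R) (X : R -> R) t c : lipschitz_after TS X -> TS < t ->
  c < X t -> exists2 e : R, 0 < e &
    forall s y, `|s - t| < e -> y < c + e -> TS < s /\ y < X s.
Proof.
move=> [L XL] Tt cX; exists (Num.min (t - TS) ((X t - c) / (`|L| + 1))).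
  by rewrite lt_min subr_gt0 Tt divr_gt0 ?subr_gt0 ?ltr_wpDl.
set e := Num.min _ _ => s y st ye.
have e1 : e <= t - TS by rewrite /e ge_min lexx.
have e2 : (`|L| + 1) * e <= X t - c.
  by rewrite mulrC -ler_pdivlMr ?ltr_wpDl// /e ge_min lexx orbT.
have st' := st; rewrite ltr_norml in st'; case/andP: st' => s1 s2.
have sT : TS < s by lra.
have h : `|X s - X t| <= `|L| * e.
  apply: (le_trans (XL _ _ sT Tt)); apply: (@le_trans _ _ (`|L| * `|s - t|)).
    by rewrite ler_wpM2r// ler_norm.
  by rewrite ler_wpM2l// ltW.
split => //; move: h e2; rewrite mulrDl mul1r ler_norml => /andP[h _].
by move: (`|L| * e) h ye => le; clear; lra.
Qed.

Lemma lipschitz_after_above (TS : R) (X : R -> R) t c : lipschitz_after TS X -> TS < t ->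
  X t < c -> exists2 e : R, 0 < e &
    forall s y, `|s - t| < e -> c - e < y -> TS < s /\ X s < y.
Proof.
move=> [L XL] Tt Xc.
have [||e e0 he] := @lipschitz_after_below TS (fun s => - X s) t (- c) _ Tt.
- by exists L => t1 t2 h1 h2; rewrite -opprD normrN; exact: XL.
- by rewrite ltrN2.
exists e => // s y st ye; have [|Ts sX] := he s (- y) st; first by lra.
by split => //; rewrite -ltrN2.
Qed.

End ShockCurve.

Theorem theorem3 (R : realType) (ubl ubr p : R) (w0 : R -> R)
  (u ul ur : R -> R -> R) (TS : R) (X : R -> R) :
  0 < p -> ubr < ubl -> periodic_zero_avg p w0 ->
  entropy_solution (riemann_data ubl ubr w0) u ->
  entropy_solution (fun x => ubl + w0 x) ul ->
  entropy_solution (fun x => ubr + w0 x) ur ->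
  0 < TS -> lipschitz_after TS X ->
  {ae leb2, forall z : R * R, TS < z.1 ->
      (z.2 < X z.1 -> u z.1 z.2 = ul z.1 z.2) /\
      (X z.1 < z.2 -> u z.1 z.2 = ur z.1 z.2)} ->
  forall t : R, TS < t ->
    (exists k : int, (ubl - ubr) * t / p = k%:~R) ->
    X t = (ubl + ubr) / 2 * t.
Proof.
move=> p0 lr [mw [[M wM] [wp w00]]] eu el er TS0 XL ae t TSt [k kE].
have t0 : 0 < t by exact: lt_trans TSt.
have kp : (ubl - ubr) * t = k%:~R * p by rewrite -kE divfK ?gt_eqF.
have bc c y : `|c + w0 y| <= `|c| + M by rewrite (le_trans (ler_normD _ _))// lerD.
have [Ml kl] : exists M, kruzhkov M (fun x => ubl + w0 x) ul.
  by apply: (entropy_solution_kruzhkov _ (bc ubl) el); exact: measurable_funD.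
have [Mr kr] : exists M, kruzhkov M (fun x => ubr + w0 x) ur.
  by apply: (entropy_solution_kruzhkov _ (bc ubr) er); exact: measurable_funD.
have [Mu ku] : exists M, kruzhkov M (riemann_data ubl ubr w0) u.
  apply: (@entropy_solution_kruzhkov _ _ _ (Num.max (`|ubl| + M) (`|ubr| + M)) _ _ eu).
    exact: measurable_riemann_data.
  by move=> x; rewrite le_max /riemann_data; case: ifP => _; rewrite bc ?orbT.
have [W WE] : exists W, W = prim w0 by eexists.
have lW : lipR M W by rewrite WE; exact: prim_lip.
have pW y : W (y + p) = W y by rewrite WE; exact: (prim_periodic mw wM).
have El : prim (fun x => ubl + w0 x) = (fun x => ubl * x + W x).
  by apply/funext => x; rewrite (prim_cst_add mw wM) WE.
have Er : prim (fun x => ubr + w0 x) = (fun x => ubr * x + W x).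
  by apply/funext => x; rewrite (prim_cst_add mw wM) WE.
have Eu : prim (riemann_data ubl ubr w0) =
    (fun x => Num.min (ubl * x + W x) (ubr * x + W x)).
  by apply/funext => x; rewrite (prim_riemann mw wM _ (ltW lr)) WE addr_minr !(addrC (prim _ _)).
have dlr x : hopf_lax (fun x => ubl * x + W x) t x - hopf_lax (fun x => ubr * x + W x) t x =
    (ubl - ubr) * (x - (ubl + ubr) / 2 * t).
  exact: (hopf_lax_states_sub _ lW t0 pW kp).
have mlr x : hopf_lax (prim (riemann_data ubl ubr w0)) t x =
    Num.min (hopf_lax (fun x => ubl * x + W x) t x) (hopf_lax (fun x => ubr * x + W x) t x).
  rewrite Eu; apply: (@hopf_lax_min _ (Num.max `|ubl| `|ubr| + M)) t0.
    by apply: lipR_affine lW _; rewrite le_max lexx.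
  by apply: lipR_affine lW _; rewrite le_max lexx orbT.
have d0 : 0 < ubl - ubr by rewrite subr_gt0.
have [c cE] : exists c, c = (ubl + ubr) / 2 * t by eexists.
rewrite -cE in dlr *.
have [Hl HlE] : exists H, H = hopf_lax (fun x => ubl * x + W x) t by eexists.
have [Hr HrE] : exists H, H = hopf_lax (fun x => ubr * x + W x) t by eexists.
rewrite -HlE -HrE in dlr mlr.
have dc := dlr c; rewrite subrr mulr0 in dc.
case: (ltgtP (X t) c) => // Xc.
(* If the shock were left of [c], then [u] would equal [ur] around [[x, c]] and [min(Hl, Hr) - Hr]
   would be constant there; but it is 0 at [c] and negative at [x]. The midpoint keeps a positive
   distance from the shock. The other case is its mirror image with [ul]. *)
- have [x [Xx xc]] : exists x, X t < x /\ x < c.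
    by exists ((X t + c) / 2); split; lra.
  have [e e0 he] := lipschitz_after_above XL TSt Xx.
  have := @hopf_lax_sub_ae _ _ _ _ _ _ _ t x c e
    (fun z => TS < z.1 /\ X z.1 < z.2) ku kr t0 (ltW xc) _ e0.
  rewrite !Er -HrE !mlr => H.
  have {}H : Num.min (Hl c) (Hr c) - Hr c = Num.min (Hl x) (Hr x) - Hr x.
    apply: H; last by move=> s y st y1 _; exact: he.
    by apply: leb2_ae_impl ae => z h [/h[_]].
  have dx : Hl x < Hr x by rewrite -subr_lt0 dlr pmulr_rlt0// subr_lt0.
  move: H; rewrite (min_idPl (ltW dx)) (_ : Hl c = Hr c); last by apply/eqP; rewrite -subr_eq0 dc.
  by rewrite minxx; clear -dx; lra.
- have [x [cx xX]] : exists x, c < x /\ x < X t.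
    by exists ((X t + c) / 2); split; lra.
  have [e e0 he] := lipschitz_after_below XL TSt xX.
  have := @hopf_lax_sub_ae _ _ _ _ _ _ _ t c x e
    (fun z => TS < z.1 /\ z.2 < X z.1) ku kl t0 (ltW cx) _ e0.
  rewrite !El -HlE !mlr => H.
  have {}H : Num.min (Hl x) (Hr x) - Hl x = Num.min (Hl c) (Hr c) - Hl c.
    apply: H; last by move=> s y st _ y1; exact: he.
    by apply: leb2_ae_impl ae => z h [/h[+ _]].
  have dx : Hr x < Hl x by rewrite -subr_gt0 dlr pmulr_rgt0// subr_gt0.
  move: H; rewrite (min_idPr (ltW dx)) (_ : Hl c = Hr c); last by apply/eqP; rewrite -subr_eq0 dc.
  by rewrite minxx; clear -dx; lra.
Qed.
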